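(* Let $u_i:B_1\to N\subset\mathbb R^p$ be a sequence of harmonic maps with uniformly bounded energy satisfying (i)-(iii) of the context, and let $p_i,q_i$ be the coefficients in the neck expansion of $u_i$ described in the context. Then the sequence $$v_i(s,\theta):=\frac{1}{\sqrt{\lambda_i}} \left( u_i\left(s+\tfrac{1}{2}\log \lambda_i, \theta\right)- \left(p_i+\tfrac{1}{2}q_i\log \lambda_i\right) \right)$$ converges smoothly locally on $(-\infty,+\infty)\times S^1$ to $$v_\infty(s,\theta)= q_\infty s + a_\infty e^s \cos\theta + b_\infty e^s \sin\theta + c_\infty e^{-s}\cos \theta + d_\infty e^{-s}\sin \theta$$ for some $q_\infty\in\mathbb R^p$, where $a_\infty,b_\infty,c_\infty,d_\infty$ are the first order Taylor coefficients defined in the context, and $$|q_\infty|^2= 2 (a_\infty\cdot c_\infty + b_\infty \cdot d_\infty).$$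
   Context: $B_r\subset\mathbb R^2$ is the ball of radius $r$ centered at the origin, with the flat metric. $N$ is a closed Riemannian manifold isometrically embedded in $\mathbb R^p$; maps into $N$ are regarded as $\mathbb R^p$-valued. Harmonic maps are (smooth) critical points of $E(u)=\frac12\int|\nabla u|^2$. On $B_1\setminus\{0\}$ use polar coordinates $(r,\theta)$ and cylinder coordinates $(t,\theta)$ with $t=\log r$; $u_i(t,\theta)$ means $u_i$ in these coordinates. Assumptions on the sequence $u_i:B_1\to N$ (harmonic, $\sup_iE(u_i)<\infty$): (i) $u_i$ converges locally smoothly in $\overline{B}_1\setminus\{0\}$ to a limit map $u_\infty$, which (removable singularity theorem) extends to a smooth harmonic map $B_1\to N$; (ii) there is a sequence $\lambda_i>0$, $\lambda_i\to0$, such that $u_i(\lambda_i y)$ converges locally smoothly on $\mathbb R^2$ to a bubble map $\omega:\mathbb R^2\to N$ (a nonconstant harmonic map of finite energy); (iii) $\omega$ is the only bubble: whenever, along a subsequence, $x_i\to 0$ and $\mu_i\to 0^+$ are such that $u_i(x_i+\mu_i y)$ converges locally smoothly on $\mathbb R^2$ minus a finite set to a nonconstant map, the quantity $\frac{\lambda_i}{\mu_i}+\frac{\mu_i}{\lambda_i}+\frac{|x_i|}{\lambda_i+\mu_i}$ is bounded along that subsequence. Neck expansion: $p_i,q_i,a_i,b_i,c_i,d_i\in\mathbb R^p$ are uniformly bounded coefficients such that, for a small fixed $\delta\in(0,1)$ and any $\alpha\in(0,1)$, for $t\in[\log(\lambda_i/\delta),\log\delta]$, $$u_i= p_i + q_i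 t + a_{i} e^t\cos \theta + b_{i} e^t\sin \theta + c_{i} \lambda_i e^{-t}\cos \theta + d_{i} \lambda_i e^{-t}\sin \theta + O(\eta^{1+\alpha}),\qquad \eta=e^t+\lambda_ie^{-t},$$ with $O(\eta^{1+\alpha})$ bounded by $C\eta^{1+\alpha}$, $C$ independent of $i$, and $\left||q_i|^2-2\lambda_i(a_i\cdot c_i+b_i\cdot d_i)\right|\le C\lambda_i^{1+\alpha/2}$. (The paper proves such coefficients exist.) Taylor coefficients: $a_\infty,b_\infty\in\mathbb R^p$ are given by $u_\infty(x)=p_\infty+a_\infty x_1+b_\infty x_2+o(|x|)$ as $x\to0$. Let $\tilde\omega(y_1,y_2)=\omega\left(\frac{y_1}{|y|^2},\frac{y_2}{|y|^2}\right)$, which extends smoothly to the origin; $c_\infty,d_\infty\in\mathbb R^p$ are given by $\tilde\omega(y)=p_\infty+c_\infty y_1+d_\infty y_2+o(|y|)$ as $y\to 0$, where $p_\infty=u_\infty(0)=\tilde\omega(0)$.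
   Formalization: The claim that the whole sequence v_i converges is false (q_i/√λ_i may alternate between two limits ±q); proved instead: every subsequence of v_i has a further subsequence converging smoothly locally to v_∞ with some q_∞ (depending on it) satisfying the identity for |q_∞|². *)

(* Defs.v *)
From HB Require Import structures.
From mathcomp Require Import all_boot all_order all_algebra.
From mathcomp Require Import all_classical all_reals all_analysis.

Set Implicit Arguments.
Unset Strict Implicit.
Unset Printing Implicit Defensive.

Import Order.TTheory GRing.Theory Num.Theory.
Import numFieldNormedType.Exports.

Local Open Scope classical_set_scope.
Local Open Scope ring_scope.

Section Smooth.
Variables (R : realType) (V W : normedModType R).

Fixpoint iterD (vs : seq V) (f : V -> W) : V -> W :=
  if vs is v :: vs' then 'D_v (iterD vs' f) else f.

(* For an open set U of a finite-dimensional space this is C^oo on U. Only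
   germs at points of U matter: outside U, f may take arbitrary values. *)
Definition smooth_on (U : set V) (f : V -> W) : Prop :=
  forall (vs : seq V) (x : V), U x ->
    {for x, continuous (iterD vs f)} /\ forall v, derivable (iterD vs f) x v.

(* Locally smooth convergence on A of smooth maps f i defined on D: uniform
   convergence of every derivative on every compact subset of A, each
   derivative being evaluated only at points of D (A need not be contained in
   D, which expresses convergence up to a part of the boundary of D). *)
Definition cvg_smooth_within (D A : set V) (f : nat -> V -> W) (g : V -> W) :
    Prop :=
  forall (vs : seq V) (K : set V), compact K -> K `<=` A ->
  forall eps : R, 0 < eps ->
  \forall i \near \oo, forall x, K x -> D x ->
    `|iterD vs (f i) x - iterD vs g x| < eps.

Definition cvg_smooth (A : set V) (f : nat -> V -> W) (g : V -> W) : Prop :=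
  cvg_smooth_within setT A f g.

End Smooth.

Section Geometry.
Variable R : realType.

(* The library norms on R * R and on row vectors are sup norms; the Euclidean
   ones come from enorm2 and dotp. *)
Definition enorm2 (x : R * R) : R := Num.sqrt (x.1 ^+ 2 + x.2 ^+ 2).

Definition dotp (p : nat) (v w : 'rV[R]_p) : R := \sum_j v 0 j * w 0 j.

Definition eball (r : R) : set (R * R) := [set x | enorm2 x < r].

Definition eclosed_ball (r : R) : set (R * R) := [set x | enorm2 x <= r].

(* A closed n-dimensional manifold isometrically embedded in R^p: a compact
   subset with smooth slice charts, carrying the induced metric. *)
Definition closed_submanifold (n p : nat) (N : set 'rV[R]_p) : Prop :=
  [/\ (n <= p)%N, compact N &
    forall x, N x ->
    exists (U V : set 'rV[R]_p) (Phi Psi : 'rV[R]_p -> 'rV[R]_p),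
      [/\ open U /\ U x, open V,
          smooth_on U Phi /\ smooth_on V Psi,
          (forall y, U y -> V (Phi y) /\ Psi (Phi y) = y) /\
          (forall z, V z -> U (Psi z) /\ Phi (Psi z) = z) &
          forall y, U y ->
            (N y <-> forall j : 'I_p, (n <= j)%N -> Phi y 0 j = 0)]].

Definition grad_sq (p : nat) (u : R * R -> 'rV[R]_p) (x : R * R) : R :=
  dotp ('D_(1, 0) u x) ('D_(1, 0) u x) + dotp ('D_(0, 1) u x) ('D_(0, 1) u x).

Definition energy (p : nat) (A : set (R * R)) (u : R * R -> 'rV[R]_p) :
    \bar R :=
  (\int[@lebesgue_measure R \x @lebesgue_measure R]_(x in A)
     (2^-1 * grad_sq u x)%:E)%E.

(* Smooth critical points of the energy among maps U -> N: the variations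
   F (s, _) of u take their values in N and agree with u outside a compact
   subset K of U, so that only the energy over K varies. *)
Definition harmonic_map (p : nat) (U : set (R * R)) (N : set 'rV[R]_p)
    (u : R * R -> 'rV[R]_p) : Prop :=
  [/\ smooth_on U u,
      forall x, U x -> N (u x) &
      forall (e : R) (K : set (R * R)) (F : R * (R * R) -> 'rV[R]_p),
        0 < e -> compact K -> K `<=` U ->
        smooth_on [set z : R * (R * R) | `|z.1| < e /\ U z.2] F ->
        (forall s x, `|s| < e -> U x -> N (F (s, x))) ->
        (forall x, U x -> F (0, x) = u x) ->
        (forall s x, `|s| < e -> U x -> ~ K x -> F (s, x) = u x) ->
        is_derive (0 : R) 1
          (fun s : R => fine (energy K (fun x => F (s, x)))) 0].

Definition nonconstant_on (T : Type) (A : set (R * R)) (f : R * R -> T) :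
    Prop :=
  exists x y, [/\ A x, A y & f x <> f y].

Definition taylor1_at0 (p : nat) (f : R * R -> 'rV[R]_p)
    (f0 a b : 'rV[R]_p) : Prop :=
  (fun x => f x - (f0 + x.1 *: a + x.2 *: b)) =o_ (0 : R * R) id.

Definition inversion (y : R * R) : R * R :=
  (y.1 / enorm2 y ^+ 2, y.2 / enorm2 y ^+ 2).

(* Cylinder coordinates (t, theta) with t = log r. Functions on R x S^1 are
   represented by 2 pi-periodic functions of theta : R; locally smooth
   convergence on R x S^1 is the same as on R x R. *)
Definition cyl (z : R * R) : R * R :=
  (expR z.1 * cos z.2, expR z.1 * sin z.2).

Section Sequence.
Variable p : nat.
Implicit Types (lam : nat -> R) (u : nat -> R * R -> 'rV[R]_p).

Definition only_bubble lam u : Prop :=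
  forall (phi : nat -> nat) (x : nat -> R * R) (mu : nat -> R)
      (S : set (R * R)) (g : R * R -> 'rV[R]_p),
    {homo phi : m n / (m < n)%N} ->
    x @ \oo --> (0 : R * R) ->
    (forall k, 0 < mu k) -> mu @ \oo --> (0 : R) ->
    finite_set S ->
    cvg_smooth (~` S) (fun k y => u (phi k) (x k + mu k *: y)) g ->
    nonconstant_on (~` S) g ->
    exists C : R, forall k,
      lam (phi k) / mu k + mu k / lam (phi k)
        + enorm2 (x k) / (lam (phi k) + mu k) <= C.

Definition neck_approx (l : R) (pi qi ai bi ci di : 'rV[R]_p) (t th : R) :
    'rV[R]_p :=
  pi + t *: qi + (expR t * cos th) *: ai + (expR t * sin th) *: bi
  + (l * expR (- t) * cos th) *: ci + (l * expR (- t) * sin th) *: di.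

Definition neck_expansion lam u (ps qs As bs cs ds : nat -> 'rV[R]_p) : Prop :=
  (exists M : R, forall i,
    [/\ `|ps i| <= M, `|qs i| <= M, `|As i| <= M /\ `|bs i| <= M,
        `|cs i| <= M & `|ds i| <= M]) /\
  exists2 delta : R, 0 < delta < 1 &
  forall alpha : R, 0 < alpha < 1 ->
  exists C : R,
    (forall (i : nat) (t th : R), ln (lam i / delta) <= t <= ln delta ->
       `|u i (cyl (t, th))
         - neck_approx (lam i) (ps i) (qs i) (As i) (bs i) (cs i) (ds i) t th|
       <= C * (expR t + lam i * expR (- t)) `^ (1 + alpha)) /\
    (forall i : nat,
       `|dotp (qs i) (qs i)
         - 2 * lam i * (dotp (As i) (cs i) + dotp (bs i) (ds i))|
       <= C * lam i `^ (1 + alpha / 2)).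

(* The expansion bounds qs i / sqrt (lam i) but does not fix its direction:
   when N has an isometry sigma fixing both limit maps, one may alternate
   between maps u i and sigma \o u i. Hence rescaled_neck converges only along
   subsequences in general. *)
Definition rescaled_neck lam u (ps qs : nat -> 'rV[R]_p) (i : nat)
    (z : R * R) : 'rV[R]_p :=
  (Num.sqrt (lam i))^-1 *:
    (u i (cyl (z.1 + 2^-1 * ln (lam i), z.2))
     - (ps i + (2^-1 * ln (lam i)) *: qs i)).

Definition neck_limit (q a b c d : 'rV[R]_p) (z : R * R) : 'rV[R]_p :=
  z.1 *: q + (expR z.1 * cos z.2) *: a + (expR z.1 * sin z.2) *: b
  + (expR (- z.1) * cos z.2) *: c + (expR (- z.1) * sin z.2) *: d.

End Sequence.
End Geometry.

(* Main.v *)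
From HB Require Import structures.
Require Import Defs.
From mathcomp Require Import all_boot all_order all_algebra.
From mathcomp Require Import all_classical all_reals all_analysis.
From mathcomp Require Import perm ring lra.
Set Implicit Arguments.
Unset Strict Implicit.
Unset Printing Implicit Defensive.
Import Order.TTheory GRing.Theory Num.Theory.
Import numFieldNormedType.Exports.
Local Open Scope classical_set_scope.
Local Open Scope ring_scope.

(** Write V_i for the rescaled neck map and eps_i for the square root of lam_i. The
neck expansion controls V_i only uniformly; the equation of harmonic maps turns
this into convergence of all derivatives.

The coefficients. At a fixed small distance from the origin the expansion is
compared with the Taylor polynomial of the limit map, and at a fixed large
multiple of lam_i with that of the inverted bubble. The values in opposite
directions differ by twice the linear term, so that the coefficients converge to
ainf, binf, cinf, dinf ([outer_limits], [inner_limits]), and the centre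
ps_i + (ln lam_i / 2) qs_i converges to pinf ([base_point_limit]). The quadratic
identity for qs_i gives |qs_i| <= K eps_i ([q_bound]), so that qs_i / eps_i
converges along a subsequence; dividing the identity by lam_i gives that of
qinf ([q_limit_norm]). In the middle of the neck the remainder is of order
eps_i^(3/2), hence V_i converges uniformly on bounded sets
([neck_uniform_cvg]).

The equation. Moving a harmonic map along the coordinate lines of a slice chart
shows that its Laplacian is orthogonal to the tangent space
([euler_lagrange]). Its normal part is found by differentiating the constraints
twice, so that Lap w = A(w)(Dw, Dw) with smooth coefficients A near pinf
([harmonic_normal_form]). The equation survives the conformal change to cylinder
coordinates, and V_i satisfies Lap V_i = eps_i A(P_i + eps_i V_i)(DV_i, DV_i)
([rescaled_normal_form]): in the limit it becomes the Laplace equation.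

Uniform bounds on derivatives. A bounded function whose Laplacian is bounded has
a bounded gradient; on squares this follows from the maximum principle alone, by
comparing the odd part with an explicit barrier ([gradient_estimate]). Choosing a
point where distance to the boundary times gradient is maximal, the estimate
persists when the Laplacian is bounded by A (1 + |D| + eps |D|^2) with small eps
([small_quadratic_gradient]). It bounds the gradient of V_i, and then, by
induction, every derivative, since in the differentiated equation the highest
derivatives occur at most linearly ([all_derivatives_bounded]).

Finally, a family that tends to 0 uniformly on bounded sets and has bounded
derivatives of all orders has all derivatives tending to 0, by interpolation
([cvg_all_derivatives]); applied to V_i minus the limit map this is the theorem. *)

(** * Directional derivatives and differentiability *)

Section Lines.
Variables (R : realType) (V : normedModType R).
Implicit Types (f : V -> R) (x v w : V).

Lemma is_derive_line (W : normedModType R) (f : V -> W) x v (t : R) :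
  derivable f (x + t *: v) v ->
  is_derive t 1 (fun s : R => f (x + s *: v)) ('D_v f (x + t *: v)).
Proof.
move=> df.
have E : (fun h : R => h^-1 *: (((fun s : R => f (x + s *: v)) \o shift t) (h *: 1)
    - f (x + t *: v))) =
  (fun h : R => h^-1 *: ((f \o shift (x + t *: v)) (h *: v) - f (x + t *: v))).
  apply/funext => h /=; congr (_ *: (f _ - _)).
  by rewrite [_%:A]mulr1 scalerDl addrCA addrA addrC addrCA addrA.
by split; rewrite /derivable /derive E.
Qed.

Lemma MVT_line f x v (h : R) : 0 < h ->
  (forall t : R, 0 <= t <= h -> derivable f (x + t *: v) v) ->
  exists2 t : R, 0 < t < h & f (x + h *: v) - f x = h * 'D_v f (x + t *: v).
Proof.
move=> h0 df.
have df' (t : R) : 0 <= t <= h ->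
   is_derive t 1 (fun s : R => f (x + s *: v)) ('D_v f (x + t *: v)).
  by move=> /df; exact: is_derive_line.
have [||t th E] := @MVT R (fun s : R => f (x + s *: v))
    (fun t => 'D_v f (x + t *: v)) 0 h h0.
- by move=> t; rewrite in_itv/= => /andP[t0 th]; apply: df'; rewrite !ltW.
- apply: derivable_within_continuous => t; rewrite in_itv/= => th.
  by have [] := df' _ th.
exists t; first by rewrite in_itv/= in th.
by rewrite /= scale0r addr0 subr0 mulrC in E.
Qed.

Lemma derivable_approx (W : normedModType R) (f : V -> W) x v :
  derivable f x v -> forall e : R, 0 < e ->
  \forall h \near (0 : R), `|f (x + h *: v) - f x - h *: 'D_v f x| <= e * `|h|.
Proof.
move=> /derivable_nbhs /eqaddoP df e e0.
have := df _ e0; apply: filterS => h /=.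
by rewrite (addrC x) -(addrA (f _)) -opprD.
Qed.

Lemma eps_eq0 (a c : R) : 0 <= c -> (forall e : R, 0 < e -> `|a| <= c * e) -> a = 0.
Proof.
move=> c0 H; apply/eqP; rewrite -normr_le0; apply/ler_addgt0Pr => e e0; rewrite add0r.
have [c_eq0|cn0] := eqVneq c 0.
  by have := H _ e0; rewrite c_eq0 mul0r => /le_trans; apply; apply: ltW.
have cp : 0 < c by rewrite lt_def cn0.
by have := H (e / c) (divr_gt0 e0 cp); rewrite mulrCA divff// mulr1.
Qed.

Lemma deriveZdir f x v (a : R) :
  derivable f x v -> derivable f x (a *: v) ->
  'D_(a *: v) f x = a * 'D_v f x.
Proof.
move=> dv dav; apply/eqP; rewrite -subr_eq0; apply/eqP.
apply: (@eps_eq0 _ (1 + `|a|)); first by rewrite addr_ge0.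
move=> e e0.
have A1 := derivable_approx dav e0.
have A2 : \forall h \near (0 : R),
    `|f (x + (h * a) *: v) - f x - (h * a) *: 'D_v f x| <= e * `|h * a|.
  have c0 : (fun h : R => h * a) @ 0 --> 0.
    by rewrite -[X in _ --> X](mul0r a); apply: cvgMr_tmp; exact: cvg_id.
  exact: (c0 _ (derivable_approx dv e0)).
have [d /= d0 H] : nbhs (0 : R) [set h : R |
   (`|f (x + (h * a) *: v) - f x - (h * a) *: 'D_v f x| <= e * `|h * a|) /\
  `|f (x + h *: (a *: v)) - f x - h *: 'D_(a *: v) f x| <= e * `|h|].
  by apply: filterS2 A1 A2 => h.
have hd : 0 < d / 2 by rewrite divr_gt0.
have [] := H (d / 2).
  by rewrite /= sub0r normrN gtr0_norm// ltr_pdivrMr// ltr_pMr// ltr1n.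
set h := d / 2; rewrite scalerA normrM (gtr0_norm hd) -!/h.
set F := f _; set D1 := 'D_v f x; set D2 := 'D__ f x.
rewrite /GRing.scale/= => H1 H2.
rewrite -(ler_pM2l hd) -/h -[X in X * _ <= _](gtr0_norm hd) -normrM.
rewrite (_ : h * (D2 - a * D1) = (F - f x - h * a * D1) - (F - f x - h * D2)); last by ring.
apply: le_trans (ler_normB _ _) _; apply: le_trans (lerD H1 H2) _.
by rewrite le_eqVlt; apply/orP; left; apply/eqP; ring.
Qed.

(** Continuity of one of the two derivatives is needed: the increment along v + w
is the increment along v, followed by one along w that starts at a different
point. *)
Lemma deriveDdir f x v w :
  (\forall y \near x, derivable f y w) -> {for x, continuous ('D_w f)} ->
  derivable f x v -> derivable f x (v + w) ->
  'D_(v + w) f x = 'D_v f x + 'D_w f x.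
Proof.
move=> dw cw dv dvw; apply/eqP; rewrite -subr_eq0; apply/eqP.
apply: (@eps_eq0 _ 3) => // e e0.
have A1 := derivable_approx dvw e0.
have A2 := derivable_approx dv e0.
have /nbhs_ballP[r /= r0 A3] : nbhs x [set y | derivable f y w /\ `|'D_w f y - 'D_w f x| <= e].
  have := cw; move/cvgrPdist_le => /(_ _ e0) cw'.
  by apply: filterS2 dw cw' => y; split => //; rewrite distrC.
have [d /= d0 H] := filterI A1 A2.
pose h := Num.min (d / 2) (r / (`|v| + `|w| + 1)).
have vw : 0 < `|v| + `|w| + 1 by rewrite ltr_wpDl// addr_ge0.
have h0 : 0 < h by rewrite lt_min !divr_gt0.
have hd : h < d by rewrite gt_min ltr_pdivrMr// ltr_pMr// ltr1n.
have hr : h * (`|v| + `|w|) < r.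
  have : h <= r / (`|v| + `|w| + 1) by rewrite ge_min lexx orbT.
  by rewrite ler_pdivlMr//; apply: lt_le_trans; rewrite ltr_pM2l// ltrDl.
have B t : 0 <= t <= h -> derivable f (x + h *: v + t *: w) w /\
   `|'D_w f (x + h *: v + t *: w) - 'D_w f x| <= e.
  move=> /andP[t0 th]; apply: A3.
  rewrite -ball_normE /= -addrA opprD addrA subrr sub0r normrN.
  apply: le_lt_trans hr; apply: le_trans (ler_normD _ _) _.
  rewrite mulrDr !normrZ (gtr0_norm h0) (ger0_norm t0) lerD2l.
  by rewrite ler_wpM2r.
have [|t /andP[t0 th] E] := @MVT_line f (x + h *: v) w h h0.
  by move=> t /B[].
have [|H1 H2] := H h.
  by rewrite /= sub0r normrN gtr0_norm.
have [|_ H3] := B t; first by rewrite !ltW.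
move: H1 H2 H3 E; rewrite scalerDr addrA.
set F := f _; set F1 := f (x + h *: v); set D := 'D_w f _; rewrite /GRing.scale/=.
move=> H1 H2 H3 E.
rewrite -(ler_pM2l h0) -[X in X * _ <= _](gtr0_norm h0) -normrM.
rewrite (_ : h * _ = (F1 - f x - h * 'D_v f x) - (F - f x - h * 'D_(v + w) f x)
   + h * (D - 'D_w f x)); last first.
  by rewrite [h * (D - _)]mulrBr -E; ring.
apply: le_trans (ler_normD _ _) _.
apply: le_trans (lerD (ler_normB _ _) (lexx _)) _.
apply: le_trans (lerD (lerD H2 H1) (lexx _)) _.
rewrite normrM (gtr0_norm h0).
apply: le_trans (lerD (lexx _) (ler_wpM2l (ltW h0) H3)) _.
by rewrite le_eqVlt; apply/orP; left; apply/eqP; ring.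
Qed.

End Lines.

(** Finitely many linear coordinates, bounded by the norm. The chain rule needs no
more, and R, row vectors and products of such spaces all have them. *)
Record frame (R : realType) (V : normedModType R) := Frame {
  fdim : nat;
  fvec : 'I_fdim -> V;
  fco : 'I_fdim -> V -> R;
  fcoP : forall j a x y, fco j (a *: x + y) = a * fco j x + fco j y;
  fcoK : forall x, x = \sum_j fco j x *: fvec j;
  fco_bd : exists C, forall j x, `|fco j x| <= C * `|x| }.

Arguments fco {R V} f j.
Arguments fvec {R V} f j.

Section C1.
Variables (R : realType) (V : normedModType R) (F : frame V).
Implicit Types (f : V -> R) (x v w : V) (U : set V).

Definition C1 U f := forall x, U x -> forall v,
  derivable f x v /\ {for x, continuous ('D_v f)}.

Lemma derive_sumdir f U x n (a : 'I_n -> R) (e : 'I_n -> V) : open U -> C1 U f -> U x ->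
  'D_(\sum_j a j *: e j) f x = \sum_j a j * 'D_(e j) f x.
Proof.
move=> oU Cf Ux.
elim: n a e => [|n IH] a e; first by rewrite !big_ord0 derive0.
rewrite !big_ord_recr/= deriveDdir.
- by rewrite IH deriveZdir//; have [] := Cf _ Ux (e ord_max); have [] := Cf _ Ux (a ord_max *: e ord_max).
- near=> y; have Uy : U y by near: y; exact: open_nbhs_nbhs.
  by have [] := Cf _ Uy (a ord_max *: e ord_max).
- by have [] := Cf _ Ux (a ord_max *: e ord_max).
- by have [] := Cf _ Ux (\sum_(i < n) a (widen_ord (leqnSn n) i) *: e (widen_ord (leqnSn n) i)).
- by have [] := Cf _ Ux (\sum_(i < n) a (widen_ord (leqnSn n) i) *: e (widen_ord (leqnSn n) i) + a ord_max *: e ord_max).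
Unshelve. all: by end_near. Qed.

Lemma derive_coord f U x v : open U -> C1 U f -> U x ->
  'D_v f x = \sum_j fco F j v * 'D_(fvec F j) f x.
Proof.
by move=> oU Cf Ux; rewrite [X in 'D_X _ _](fcoK F) (derive_sumdir _ _ oU Cf Ux).
Qed.

Lemma fco_continuous j : continuous (fco F j).
Proof.
have [C HC] := fco_bd F.
move=> x; apply/cvgrPdist_lt => e e0; near=> y.
have -> : fco F j x - fco F j y = fco F j (x - y).
  by have := fcoP j (-1) y x; rewrite scaleN1r mulN1r addrC [X in _ = X -> _]addrC => ->.
apply: le_lt_trans (HC j _) _.
have C1 : 0 < `|C| + 1 by rewrite ltr_wpDl.
apply: (@le_lt_trans _ _ ((`|C| + 1) * `|x - y|)).
  by rewrite ler_wpM2r// (le_trans (ler_norm _))// lerDl.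
rewrite -ltr_pdivlMl// mulrC; near: y.
by apply: cvgr_dist_lt; rewrite ?divr_gt0.
Unshelve. all: by end_near. Qed.

(** The candidate differential is the linear form built from the derivatives along
the frame; by the mean value theorem the error on the segment from x to x + h
is governed by the continuity of these derivatives. *)
Lemma C1_differentiable f U x : open U -> C1 U f -> U x -> differentiable f x.
Proof.
move=> oU Cf Ux.
pose d (h : V) := \sum_j fco F j h * 'D_(fvec F j) f x.
have lind : linear d.
  move=> a u v; rewrite /d /GRing.scale/= mulr_sumr -big_split/=.
  by apply: eq_bigr => j _; rewrite fcoP mulrDl mulrA.
pose dM := GRing.isLinear.Build _ _ _ _ d lind.
pose dL : {linear V -> R} := HB.pack d dM.
have cd : continuous dL.
  move=> y; rewrite /dL/= /d; apply: cvg_big => [|j _]; first exact: add_continuous.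
  by apply: cvgMr_tmp; exact: fco_continuous.
have [C0 HC0] := fco_bd F.
pose C := `|C0|.
have HC j y : `|fco F j y| <= C * `|y|.
  by apply: le_trans (HC0 j y) _; rewrite ler_wpM2r// ler_norm.
have C_ge0 : 0 <= C by exact: normr_ge0.
have main : f \o shift x = cst (f x) + dL +o_ 0 id.
  apply/eqaddoP => e e0.
  pose e1 := e / (C * (fdim F)%:R + 1).
  have den : 0 < C * (fdim F)%:R + 1 by rewrite ltr_wpDl// mulr_ge0.
  have e10 : 0 < e1 by rewrite divr_gt0.
  have N : nbhs x [set y | U y /\ forall j, `|'D_(fvec F j) f y - 'D_(fvec F j) f x| <= e1].
    apply: filterI; first exact: open_nbhs_nbhs.
    apply: filter_forall => j.
    have [_ /cvgrPdist_le/(_ _ e10)] := Cf _ Ux (fvec F j).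
    by apply: filterS => y; rewrite distrC.
  have /nbhs_ballP[r /= r0 Hr] := N.
  near=> h.
  have hr : `|h| < r.
    near: h; apply/nbhs_ballP; exists r => //= y; rewrite -ball_normE/= sub0r normrN//.
  suff: `|f (x + h) - f x - d h| <= e * `|h|.
    by rewrite (addrC x) -(addrA (f _)) -opprD.
  have B t : 0 <= t <= 1 -> U (x + t *: h) /\
     forall j, `|'D_(fvec F j) f (x + t *: h) - 'D_(fvec F j) f x| <= e1.
    move=> /andP[t0 t1]; apply: Hr; rewrite -ball_normE/=.
    rewrite opprD addrA subrr sub0r normrN normrZ (ger0_norm t0).
    by apply: le_lt_trans hr; rewrite ler_piMl.
  have [|t /andP[t0 t1] E] := @MVT_line R V f x h 1 ltr01.
    by move=> t /B[Ut _]; have [] := Cf _ Ut h.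
  rewrite scale1r mul1r in E.
  have [|Ut Ht] := B t; first by rewrite !ltW.
  rewrite E (derive_coord _ oU Cf Ut).
  rewrite /= /d -sumrB.
  apply: le_trans (ler_norm_sum _ _ _) _.
  apply: (@le_trans _ _ (\sum_(j < fdim F) C * `|h| * e1)).
    apply: ler_sum => j _; rewrite -mulrBr normrM.
    exact: ler_pM.
  rewrite sumr_const card_ord -mulr_natr /e1.
  rewrite (_ : _ * _ = `|h| * e * (C * (fdim F)%:R / (C * (fdim F)%:R + 1))); last by ring.
  rewrite mulrC [X in _ <= X]mulrC ler_piMl ?mulr_ge0// ?(ltW e0)//.
  by rewrite ler_pdivrMr// mul1r lerDl.
have E := diff_unique cd main.
by apply/diff_locallyP; rewrite E.
Unshelve. all: by end_near. Qed.

End C1.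

(** * Functions of class C^k and smooth functions *)

Section CkGen.
Variables (R : realType) (V W : normedModType R).
Implicit Types (f g : V -> W) (U : set V).

(** Derivatives are peeled off from the inside, whereas iterD adds them on the
outside: the product and chain rules express a first derivative by functions of
the same kind, so that induction has to start with the innermost one. *)
Fixpoint Ck (k : nat) (U : set V) (f : V -> W) : Prop :=
  (forall x, U x -> {for x, continuous f}) /\
  if k is k'.+1 then
    (forall x, U x -> forall v, derivable f x v) /\ (forall v, Ck k' U ('D_v f))
  else True.

Lemma iterD_rcons (vs : seq V) v f : Defs.iterD (rcons vs v) f = Defs.iterD vs ('D_v f).
Proof. by elim: vs => //= w vs ->. Qed.

Lemma Ck_cont k U f : Ck k U f -> forall x, U x -> {for x, continuous f}.
Proof. by case: k => [|k] []. Qed.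

Lemma Ck_D k U f v : Ck k.+1 U f -> Ck k U ('D_v f).
Proof. by case=> [_ [_ H]]; exact: H. Qed.

Lemma CkSP k U f : Ck k.+1 U f <->
  [/\ forall x, U x -> {for x, continuous f},
      forall x, U x -> forall v, derivable f x v & forall v, Ck k U ('D_v f)].
Proof. by split=> [[? []]|[]]. Qed.

Lemma CkW k U f : Ck k.+1 U f -> Ck k U f.
Proof.
elim: k f => [|k IH] f [cf [df Df]]; first by split.
by split => //; split => // v; apply: IH.
Qed.

Lemma Ck_eq k U f g : open U -> (forall x, U x -> f x = g x) -> Ck k U f -> Ck k U g.
Proof.
move=> oU; elim: k f g => [|k IH] f g fg.
  move=> [cf _]; split=> // x Ux.
  have N : {near x, f =1 g}.
    by near=> y; apply: fg; near: y; exact: open_nbhs_nbhs.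
  rewrite /prop_for /continuous_at -(fg _ Ux); apply: cvg_trans (cf _ Ux).
  by apply: near_eq_cvg; apply: filterS N => y ->.
move=> Hf; have /CkSP[cf df Df] := Hf.
have N x : U x -> {near x, f =1 g}.
  by move=> Ux; near=> y; apply: fg; near: y; exact: open_nbhs_nbhs.
split.
  move=> x Ux; rewrite /prop_for /continuous_at -(fg _ Ux); apply: cvg_trans (cf _ Ux).
  by apply: near_eq_cvg; apply: filterS (N _ Ux) => y ->.
split; first by move=> x Ux v; exact: near_eq_derivable (N _ Ux) (df _ Ux v).
move=> v; apply: IH (Df v) => x Ux; apply: near_eq_derive; exact: N.
Unshelve. all: by end_near. Qed.

Lemma smooth_Ck U f : smooth_on U f <-> forall k, Ck k U f.
Proof.
split.
  move=> sf k; elim: k f sf => [|k IH] f sf.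
    by split=> // x Ux; have [] := sf [::] x Ux.
  split; first by move=> x Ux; have [] := sf [::] x Ux.
  split; first by move=> x Ux v; have [_] := sf [::] x Ux.
  move=> v; apply: IH => vs x Ux.
  by have := sf (rcons vs v) x Ux; rewrite iterD_rcons.
move=> H vs; elim/last_ind: vs f H => [|vs v IH] f H x Ux.
  by have [cf [df _]] := H 1; split; [exact: cf|exact: df].
by rewrite iterD_rcons; apply: IH => // k; exact: Ck_D (H k.+1).
Qed.

Lemma smooth_eq U f g : open U -> (forall x, U x -> f x = g x) ->
  smooth_on U f -> smooth_on U g.
Proof.
move=> oU fg /smooth_Ck sf; apply/smooth_Ck => k; exact: Ck_eq oU fg (sf k).
Qed.

Lemma smooth_sub U U' f : U' `<=` U -> smooth_on U f -> smooth_on U' f.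
Proof. by move=> sU sf vs x /sU; exact: sf. Qed.

Lemma smooth_D U f v : smooth_on U f -> smooth_on U ('D_v f).
Proof. by move=> /smooth_Ck sf; apply/smooth_Ck => k; exact: Ck_D (sf k.+1). Qed.

Lemma smooth_cont U f x : smooth_on U f -> U x -> {for x, continuous f}.
Proof. by move=> sf Ux; have [] := sf [::] x Ux. Qed.

Lemma smooth_drv U f x v : smooth_on U f -> U x -> derivable f x v.
Proof. by move=> sf Ux; have [_] := sf [::] x Ux. Qed.

Lemma smooth_local U f : (forall x, U x -> exists B, [/\ open B, B x & smooth_on B f]) ->
  smooth_on U f.
Proof. by move=> H vs x Ux; have [B [oB Bx sf]] := H x Ux; exact: sf. Qed.

Lemma iterD_eq U f g vs x : open U -> (forall y, U y -> f y = g y) -> U x ->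
  Defs.iterD vs f x = Defs.iterD vs g x.
Proof.
move=> oU fg; elim: vs x => [|v vs IH] x Ux /=; first exact: fg.
apply: near_eq_derive; near=> y; apply: IH; near: y; exact: open_nbhs_nbhs.
Unshelve. all: by end_near. Qed.

Lemma Ck_cst k U (c : W) : Ck k U (fun=> c).
Proof.
elim: k c => [|k IH] c; first by split=> // x _; exact: cvg_cst.
split; first by move=> x _; exact: cvg_cst.
split; first by move=> x _ v; exact: derivable_cst.
move=> v; rewrite (_ : 'D_v _ = fun=> 0); first exact: IH.
by apply/funext => x; exact: derive_cst.
Qed.

Lemma CkD k U f g : open U -> Ck k U f -> Ck k U g -> Ck k U (fun x => f x + g x).
Proof.
move=> oU; elim: k f g => [|k IH] f g.
  by move=> [cf _] [cg _]; split=> // x Ux; apply: cvgD; [exact: cf|exact: cg].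
move=> /CkSP[cf df Df] /CkSP[cg dg Dg]; split.
  by move=> x Ux; apply: cvgD; [exact: cf|exact: cg].
split; first by move=> x Ux v; apply: derivableD; [exact: df|exact: dg].
move=> v; apply: Ck_eq (IH _ _ (Df v) (Dg v)) => // x Ux.
by rewrite -deriveD//; [exact: df|exact: dg].
Qed.

Lemma Ck_sum k U (I : Type) (r : seq I) (f : I -> V -> W) : open U ->
  (forall i, Ck k U (f i)) -> Ck k U (fun x => \sum_(i <- r) f i x).
Proof.
move=> oU Hf; elim: r => [|i r IH].
  rewrite (_ : (fun _ => _) = fun=> 0); first exact: Ck_cst.
  by apply/funext => x; rewrite big_nil.
rewrite (_ : (fun _ => _) = fun x => f i x + \sum_(j <- r) f j x); first exact: CkD.
by apply/funext => x; rewrite big_cons.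
Qed.

End CkGen.

Section CkScal.
Variables (R : realType) (V : normedModType R).
Implicit Types (f g : V -> R) (U : set V).

Lemma CkM k U f g : open U -> Ck k U f -> Ck k U g -> Ck k U (fun x => f x * g x).
Proof.
move=> oU; elim: k f g => [|k IH] f g.
  by move=> [cf _] [cg _]; split=> // x Ux; apply: cvgM; [exact: cf|exact: cg].
move=> Hf Hg; have /CkSP[cf df Df] := Hf; have /CkSP[cg dg Dg] := Hg; split.
  by move=> x Ux; apply: cvgM; [exact: cf|exact: cg].
split; first by move=> x Ux v; apply: derivableM; [exact: df|exact: dg].
move=> v; apply: (@Ck_eq _ _ _ _ _ (fun x => f x * 'D_v g x + g x * 'D_v f x)) => //.
  by move=> x Ux; rewrite -[LHS](@deriveM _ _ f g)//; [exact: df|exact: dg].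
by apply: CkD => //; apply: IH => //; exact: CkW.
Qed.

Lemma Ck_prod k U (I : Type) (r : seq I) (f : I -> V -> R) : open U ->
  (forall i, Ck k U (f i)) -> Ck k U (fun x => \prod_(i <- r) f i x).
Proof.
move=> oU Hf; elim: r => [|i r IH].
  rewrite (_ : (fun _ => _) = fun=> 1); first exact: Ck_cst.
  by apply/funext => x; rewrite big_nil.
rewrite (_ : (fun _ => _) = fun x => f i x * \prod_(j <- r) f j x); first exact: CkM.
by apply/funext => x; rewrite big_cons.
Qed.

Lemma CkV k U f : open U -> (forall x, U x -> f x != 0) -> Ck k U f ->
  Ck k U (fun x => (f x)^-1).
Proof.
move=> oU f0; elim: k f f0 => [|k IH] f f0.
  by move=> [cf _]; split=> // x Ux; apply: cvgV; [exact: f0|exact: cf].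
move=> Hf; have /CkSP[cf df Df] := Hf; split.
  by move=> x Ux; apply: cvgV; [exact: f0|exact: cf].
split; first by move=> x Ux v; apply: derivableV; [exact: f0|exact: df].
move=> v.
apply: (@Ck_eq _ _ _ _ _ (fun x => - 1 * (((f x)^-1 * (f x)^-1) * 'D_v f x))) => //.
  move=> x Ux; rewrite [RHS]deriveV ?f0//; last exact: df.
  by rewrite mulN1r scaleNr /GRing.scale/= -exprVn expr2.
apply: CkM => //; first exact: Ck_cst.
by apply: CkM => //; apply: CkM => //; apply: IH => //; exact: CkW.
Qed.

Lemma Ck_C1 k U (f : V -> R) : Ck k.+1 U f -> C1 U f.
Proof.
move=> /CkSP[cf df Df] x Ux v; split; first exact: df.
exact: Ck_cont (Df v) x Ux.
Qed.

End CkScal.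

Section Chain.
Variables (R : realType) (V V2 : normedModType R) (F : frame V) (F2 : frame V2).

Lemma frame_cont (f : V -> V2) x :
  (forall j, {for x, continuous (fco F2 j \o f)}) -> {for x, continuous f}.
Proof.
move=> cf; suff : f y @[y --> x] --> f x by [].
rewrite [X in _ --> X](fcoK F2) (_ : f = fun y => \sum_j fco F2 j (f y) *: fvec F2 j).
  apply: cvg_big => [|j _]; first exact: add_continuous.
  by rewrite -fcoK; apply: cvgZr_tmp; exact: cf.
by apply/funext => y; exact: fcoK.
Qed.

(** A vector valued map is recovered from its coordinates, so that only scalar
differentiability enters. *)
Lemma frame_derive (f : V -> V2) x v :
  (forall j, differentiable (fco F2 j \o f) x) -> differentiable f x /\
  'D_v f x = \sum_j 'D_v (fco F2 j \o f) x *: fvec F2 j.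
Proof.
move=> df.
have E : f = \sum_j (fun y => fco F2 j (f y) *: fvec F2 j).
  by apply/funext => y; rewrite fct_sumE; exact: fcoK.
have dj j : differentiable (fun y => fco F2 j (f y) *: fvec F2 j) x.
  exact: differentiableZl (df j).
have D : differentiable f x by rewrite E; apply: differentiable_sum.
split => //; rewrite [in LHS]E derive_sum; last by move=> j; apply: diff_derivable.
apply: eq_bigr => j _; rewrite !deriveE//.
exact: (congr1 (fun h => h v) (diffZl (fvec F2 j) (df j))).
Qed.

Lemma derive_comp (U2 : set V2) (g : V2 -> R) (f : V -> V2) x v :
  open U2 -> C1 U2 g -> U2 (f x) ->
  (forall j, differentiable (fco F2 j \o f) x) ->
  differentiable (g \o f) x /\
  'D_v (g \o f) x = \sum_j 'D_v (fco F2 j \o f) x * 'D_(fvec F2 j) g (f x).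
Proof.
move=> oU2 Cg Ufx df; have [Df E] := frame_derive v df.
have Dg := C1_differentiable F2 oU2 Cg Ufx.
split; first exact: differentiable_comp.
rewrite deriveE; last exact: differentiable_comp.
rewrite diff_comp//= -!deriveE// E (derive_sumdir _ _ oU2 Cg Ufx).
by [].
Qed.

Lemma Ck_comp k U U2 (g : V2 -> R) (f : V -> V2) : open U -> open U2 ->
  (forall x, U x -> U2 (f x)) -> Ck k U2 g ->
  (forall j, Ck k U (fco F2 j \o f)) -> Ck k U (g \o f).
Proof.
move=> oU oU2 fU; elim: k g => [|k IH] g Hg Hf.
  split=> // x Ux; apply: continuous_comp.
    by apply: frame_cont => j; exact: Ck_cont (Hf j) x Ux.
  exact: Ck_cont Hg _ (fU _ Ux).
have dj x : U x -> forall j, differentiable (fco F2 j \o f) x.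
  by move=> Ux j; apply: (C1_differentiable F oU (Ck_C1 (Hf j)) Ux).
have D x : U x -> forall v, differentiable (g \o f) x /\
  'D_v (g \o f) x = \sum_j 'D_v (fco F2 j \o f) x * 'D_(fvec F2 j) g (f x).
  by move=> Ux v; have [] := derive_comp v oU2 (Ck_C1 Hg) (fU _ Ux) (dj _ Ux).
split; first by move=> x Ux; apply: differentiable_continuous; have [] := D x Ux 0.
split; first by move=> x Ux v; apply: diff_derivable; have [] := D x Ux 0.
move=> v; apply: (@Ck_eq _ _ _ _ _ (fun x => \sum_j 'D_v (fco F2 j \o f) x *
   ('D_(fvec F2 j) g \o f) x)) => //.
  by move=> x Ux; have [_ ->] := D x Ux v.
apply: Ck_sum => // j; apply: CkM => //; first exact: Ck_D (Hf j).
by apply: IH => [|i]; [exact: Ck_D Hg|exact: CkW].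
Qed.

End Chain.

(** * Coordinates, composition, and symmetry of second derivatives *)

Section Frames.
Variable R : realType.

Lemma mx_coord_le (m n : nat) (A : 'M[R]_(m, n)) i j : `|A i j| <= `|A|.
Proof.
rewrite [leRHS]/Num.Def.normr/= mx_normrE.
exact: (le_bigmax _ (fun k : 'I_m * 'I_n => `|A k.1 k.2|) (i, j)).
Qed.

Lemma rV_norm_le (p : nat) (A : 'rV[R]_p) (e : R) : 0 <= e ->
  (forall j, `|A 0 j| <= e) -> `|A| <= e.
Proof.
move=> e0 H; rewrite [leLHS]/Num.Def.normr/= mx_normrE.
by apply: bigmax_le => // -[i j] _; rewrite (ord1 i).
Qed.

Definition frame_R : frame R.
Proof.
refine (@Frame R R 1 (fun=> 1) (fun _ x => x) _ _ _).
- by [].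
- by move=> x; rewrite big_ord1 [_%:A]mulr1.
- by exists 1 => _ x; rewrite mul1r.
Defined.

Definition frame_rV (p : nat) : frame 'rV[R]_p.
Proof.
refine (@Frame R 'rV[R]_p p (fun j => delta_mx 0 j) (fun j x => x 0 j) _ _ _).
- by move=> j a x y; rewrite !mxE.
- exact: row_sum_delta.
- by exists 1 => j x; rewrite mul1r mx_coord_le.
Defined.

Variables (V W : normedModType R) (F : frame V) (G : frame W).

Definition frame_pair : frame (V * W)%type.
Proof.
refine (@Frame R (V * W)%type (fdim F + fdim G)
  (fun j => match fintype.split j with inl i => (fvec F i, 0) | inr i => (0, fvec G i) end)
  (fun j x => match fintype.split j with inl i => fco F i x.1 | inr i => fco G i x.2 end) _ _ _).
- by move=> j a x y; case: (fintype.split j) => i; rewrite fcoP.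
- move=> [x y]; rewrite big_split_ord/=.
  under eq_bigr do rewrite (unsplitK (inl _)).
  under [X in _ = _ + X]eq_bigr do rewrite (unsplitK (inr _)).
  rewrite [RHS]surjective_pairing/= [in LHS](fcoK F x) [in LHS](fcoK G y).
  congr (_, _).
    rewrite raddf_sum/= [X in _ = _ + X]raddf_sum/= [X in _ = _ + X]big1 ?addr0//.
    by move=> i _; rewrite scaler0.
  rewrite [X in _ = X + _]raddf_sum/= raddf_sum/= [X in _ = X + _]big1 ?add0r//.
  by move=> i _; rewrite scaler0.
- have [C HC] := fco_bd F; have [D HD] := fco_bd G.
  exists (`|C| + `|D|) => j x; case: (fintype.split j) => i.
    apply: le_trans (HC _ _) _; apply: (@le_trans _ _ (`|C| * `|x.1|)).
      by rewrite ler_wpM2r// ler_norm.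
    apply: ler_pM => //; first by rewrite lerDl.
    by rewrite [leRHS]prod_normE le_max lexx.
  apply: le_trans (HD _ _) _; apply: (@le_trans _ _ (`|D| * `|x.2|)).
    by rewrite ler_wpM2r// ler_norm.
  apply: ler_pM => //; first by rewrite lerDr.
  by rewrite [leRHS]prod_normE le_max lexx orbT.
Defined.

End Frames.

Section SmoothAlg.
Variables (R : realType) (V : normedModType R).
Implicit Types (U : set V).

Lemma smooth_cst (W : normedModType R) U (c : W) : smooth_on U (fun _ : V => c).
Proof. by apply/smooth_Ck => k; exact: Ck_cst. Qed.

Lemma smoothD (W : normedModType R) U (f g : V -> W) : open U ->
  smooth_on U f -> smooth_on U g -> smooth_on U (fun x => f x + g x).
Proof.
by move=> oU /smooth_Ck sf /smooth_Ck sg; apply/smooth_Ck => k; exact: CkD.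
Qed.

Lemma smooth_sum (W : normedModType R) U (I : Type) (r : seq I) (f : I -> V -> W) :
  open U -> (forall i, smooth_on U (f i)) ->
  smooth_on U (fun x => \sum_(i <- r) f i x).
Proof.
move=> oU sf; apply/smooth_Ck => k; apply: Ck_sum => // i.
by move: k; apply/smooth_Ck.
Qed.

Lemma smoothM U (f g : V -> R) : open U ->
  smooth_on U f -> smooth_on U g -> smooth_on U (fun x => f x * g x).
Proof.
by move=> oU /smooth_Ck sf /smooth_Ck sg; apply/smooth_Ck => k; exact: CkM.
Qed.

Lemma smoothN U (f : V -> R) : open U ->
  smooth_on U f -> smooth_on U (fun x => - f x).
Proof.
move=> oU sf; apply: (@smooth_eq _ _ _ _ (fun x => - 1 * f x)) => //.
  by move=> x _; rewrite mulN1r.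
by apply: smoothM => //; exact: smooth_cst.
Qed.

Lemma smoothB U (f g : V -> R) : open U ->
  smooth_on U f -> smooth_on U g -> smooth_on U (fun x => f x - g x).
Proof. by move=> oU sf sg; exact: (smoothD oU sf (smoothN oU sg)). Qed.

Lemma smooth_prod U (I : Type) (r : seq I) (f : I -> V -> R) :
  open U -> (forall i, smooth_on U (f i)) ->
  smooth_on U (fun x => \prod_(i <- r) f i x).
Proof.
move=> oU sf; apply/smooth_Ck => k; apply: Ck_prod => // i.
by move: k; apply/smooth_Ck.
Qed.

Lemma smoothV U (f : V -> R) : open U -> (forall x, U x -> f x != 0) ->
  smooth_on U f -> smooth_on U (fun x => (f x)^-1).
Proof.
by move=> oU f0 /smooth_Ck sf; apply/smooth_Ck => k; exact: CkV.
Qed.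

Lemma smooth_linear U (l : V -> R) : continuous l ->
  (forall a x y, l (a *: x + y) = a * l x + l y) -> smooth_on U l.
Proof.
move=> cl lP.
have D x v h : h != 0 -> h^-1 *: ((l \o shift x) (h *: v) - l x) = l v.
  by move=> h0 /=; rewrite lP addrK scalerA mulVf// scale1r.
have d x v : ((fun h => h^-1 *: ((l \o shift x) (h *: v) - l x)) @ 0^' --> l v).
  apply: cvg_near_cst; near=> h; apply: D; near: h; exact: nbhs_dnbhs_neq.
apply/smooth_Ck => -[|k].
  by split=> // x _; exact: cl.
apply/CkSP; split; first by move=> x _; exact: cl.
  by move=> x _ v; apply/cvg_ex; exists (l v); exact: d.
move=> v; rewrite (_ : 'D_v l = fun=> l v); first exact: Ck_cst.
by apply/funext => x; apply: cvg_lim.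
Unshelve. all: by end_near. Qed.

Lemma derive_linear (l : V -> R) x v : continuous l ->
  (forall a x y, l (a *: x + y) = a * l x + l y) -> 'D_v l x = l v.
Proof.
move=> cl lP; apply: cvg_lim => //.
apply: cvg_near_cst; near=> h => /=.
rewrite lP addrK; rewrite [LHS]mulrA mulVf ?mul1r//.
near: h; exact: nbhs_dnbhs_neq.
Unshelve. all: by end_near. Qed.

Variables (p : nat).
Implicit Types f : V -> 'rV[R]_p.

Lemma derive_rV f x v j : derivable f x v -> ('D_v f x) 0 j = 'D_v (fun y => f y 0 j) x.
Proof. by move=> df; rewrite derive_mx// mxE. Qed.

Lemma cont_rV f x : {for x, continuous f} <-> forall j, {for x, continuous (fun y => f y 0 j)}.
Proof.
split=> H.
  move=> j.
  apply: (@continuous_comp _ _ _ f (fun z : 'rV[R]_p => z 0 j)) => //.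
  exact: (@fco_continuous R _ (frame_rV R p) j (f x)).
by apply: (frame_cont (F2 := frame_rV R p)) => j; exact: H.
Qed.

Lemma Ck_rV k U f : open U -> Ck k U f <-> forall j, Ck k U (fun y => f y 0 j).
Proof.
move=> oU; elim: k f => [|k IH] f.
  split=> [[cf _] j|H].
    by split=> // x Ux; have /cont_rV := cf _ Ux; exact.
  by split=> // x Ux; apply/cont_rV => j; have [cf _] := H j; exact: cf.
split=> [/CkSP[cf df Df] j|H].
  apply/CkSP; split.
  - by move=> x Ux; have /cont_rV := cf _ Ux; exact.
  - by move=> x Ux v; have /derivable_mxP := df _ Ux v; exact.
  - move=> v; have /(IH _)/(_ j) := Df v; apply: Ck_eq => // x Ux.
    by rewrite derive_rV//; exact: df.
have df x : U x -> forall v, derivable f x v.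
  move=> Ux v; apply/derivable_mxP => i j; rewrite (ord1 i).
  by have /CkSP[_ + _] := H j; exact.
apply/CkSP; split=> //.
  by move=> x Ux; apply/cont_rV => j; exact: Ck_cont (H j) _ Ux.
move=> v; apply/IH => j; have /(Ck_D v) := H j; apply: Ck_eq => // x Ux.
by rewrite derive_rV//; exact: df.
Qed.

Lemma smooth_rV U f : open U -> smooth_on U f <-> forall j, smooth_on U (fun y => f y 0 j).
Proof.
move=> oU; split=> [/smooth_Ck H j|H].
  by apply/smooth_Ck => k; have /(Ck_rV _ _ oU) := H k; exact.
by apply/smooth_Ck => k; apply/Ck_rV => // j; move: k; apply/smooth_Ck.
Qed.

Lemma iterD_rV U f vs x j : open U -> smooth_on U f -> U x ->
  Defs.iterD vs f x 0 j = Defs.iterD vs (fun y => f y 0 j) x.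
Proof.
move=> oU sf; elim: vs x => [|v vs IH] x Ux //=.
have [_ d] := sf vs x Ux.
rewrite derive_rV//; apply: near_eq_derive.
near=> y; apply: IH; near: y; exact: open_nbhs_nbhs.
Unshelve. all: by end_near. Qed.

End SmoothAlg.

Section SmoothComp.
Variables (R : realType) (V V2 : normedModType R) (F : frame V) (F2 : frame V2).

Lemma smooth_comp U U2 (g : V2 -> R) (f : V -> V2) : open U -> open U2 ->
  (forall x, U x -> U2 (f x)) -> smooth_on U2 g ->
  (forall j, smooth_on U (fco F2 j \o f)) -> smooth_on U (g \o f).
Proof.
move=> oU oU2 fU /smooth_Ck sg sf; apply/smooth_Ck => k.
by apply: (Ck_comp F (F2 := F2) oU oU2 fU) => // j; move: k; apply/smooth_Ck.
Qed.

Lemma smooth_diff U (f : V -> R) x : open U -> smooth_on U f -> U x -> differentiable f x.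
Proof.
move=> oU /smooth_Ck/(_ 1%N) sf Ux; refine (C1_differentiable F oU (Ck_C1 sf) Ux).
Qed.

Lemma smooth_derive_comp U U2 (g : V2 -> R) (f : V -> V2) x v : open U -> open U2 ->
  U x -> U2 (f x) -> smooth_on U2 g ->
  (forall j, smooth_on U (fco F2 j \o f)) ->
  'D_v (g \o f) x = \sum_j 'D_v (fco F2 j \o f) x * 'D_(fvec F2 j) g (f x).
Proof.
move=> oU oU2 Ux fU /smooth_Ck/(_ 1%N) sg sf.
have [] // := derive_comp v oU2 (Ck_C1 sg) fU (F2 := F2).
by move=> j; apply: smooth_diff Ux.
Qed.

End SmoothComp.

Section Schwarz.
Variables (R : realType) (V : normedModType R).

Lemma derive_shiftV (W : normedModType R) (f : V -> W) (c x v : V) :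
  derivable f (x + c) v ->
  derivable (fun y => f (y + c)) x v /\ 'D_v (fun y => f (y + c)) x = 'D_v f (x + c).
Proof.
have E : (fun h : R => h^-1 *: (((fun y => f (y + c)) \o shift x) (h *: v) - f (x + c))) =
  (fun h : R => h^-1 *: ((f \o shift (x + c)) (h *: v) - f (x + c))).
  by apply/funext => h /=; rewrite addrA.
by move=> d; split; rewrite /derivable /derive E.
Qed.

Opaque derive.

(** The mean value theorem twice. The left-hand side is symmetric in v and w, the
right-hand side is not: hence the symmetry of second derivatives. *)
Lemma second_difference U (f : V -> R) x v w (h r : R) : smooth_on U f ->
  ball x r `<=` U -> 0 < h -> h * (`|v| + `|w|) < r ->
  exists2 y, `|y - x| <= h * (`|v| + `|w|) &
  f (x + h *: v + h *: w) - f (x + h *: v) - f (x + h *: w) + f x =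
    h * (h * 'D_w ('D_v f) y).
Proof.
move=> sf sU h0 hr.
have B (s t : R) : 0 <= s <= h -> 0 <= t <= h ->
    `|x + s *: v + t *: w - x| <= h * (`|v| + `|w|).
  move=> /andP[s0 sh] /andP[t0 th].
  rewrite addrC -!addrA addrA addNr add0r mulrDr.
  apply: le_trans (ler_normD _ _) _; rewrite !normrZ !ger0_norm//.
  by apply: lerD; rewrite ler_wpM2r.
have BU (s t : R) : 0 <= s <= h -> 0 <= t <= h -> U (x + s *: v + t *: w).
  move=> sh th; apply: sU; rewrite -ball_normE/= distrC.
  exact: le_lt_trans (B _ _ sh th) hr.
have hh : 0 <= h <= h by rewrite lexx ltW.
have h00 : (0 : R) <= 0 <= h by rewrite lexx ltW.
pose phi y := f (y + h *: w) - f y.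
have d1 (s : R) : 0 <= s <= h -> derivable (fun y => f (y + h *: w)) (x + s *: v) v /\
    'D_v (fun y => f (y + h *: w)) (x + s *: v) = 'D_v f (x + s *: v + h *: w).
  by move=> sh; apply: derive_shiftV; apply: smooth_drv (BU _ _ sh hh).
have d2 (s : R) : 0 <= s <= h -> derivable f (x + s *: v) v.
  move=> sh; have := BU _ _ sh h00; rewrite scale0r addr0; exact: smooth_drv.
have [|s /andP[s0 sh] E1] := @MVT_line R V phi x v h h0.
  by move=> t th; apply: derivableB; [have [] := d1 _ th|exact: d2].
have {}sh : 0 <= s <= h by rewrite !ltW.
have [|t /andP[t0 th] E2] := @MVT_line R V ('D_v f) (x + s *: v) w h h0.
  move=> t th; apply: smooth_drv (BU _ _ sh th); exact: smooth_D.
have {}th : 0 <= t <= h by rewrite !ltW.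
exists (x + s *: v + t *: w); first exact: B.
rewrite -E2; have [d1s d1E] := d1 _ sh.
move: E1; rewrite [in X in _ = X -> _]/phi [in X in _ = X -> _](@deriveB _ _ _ (fun y => f (y + h *: w)) f _ _ d1s (d2 _ sh)) d1E => <-.
by rewrite /phi; ring.
Qed.

Lemma dist_common_approx (a b c d e : R) : `|a - c| <= e -> `|b - d| <= e -> c = d ->
  `|a - b| <= 2 * e.
Proof.
move=> ac bd cd; rewrite -(subrKA c) cd -[d - b]opprB mulr_natl mulr2n.
by apply: le_trans (ler_normB _ _) _; apply: lerD => //; rewrite -cd.
Qed.

Lemma schwarz U (f : V -> R) x v w : open U -> smooth_on U f -> U x ->
  'D_v ('D_w f) x = 'D_w ('D_v f) x.
Proof.
move=> oU sf Ux; apply/eqP; rewrite -subr_eq0; apply/eqP.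
apply: (@eps_eq0 _ _ 2) => // e e0.
have c1 : {for x, continuous ('D_v ('D_w f))} by apply: smooth_cont Ux; do 2 apply: smooth_D.
have c2 : {for x, continuous ('D_w ('D_v f))} by apply: smooth_cont Ux; do 2 apply: smooth_D.
have /cvgrPdist_le/(_ _ e0) c1' := c1.
have /cvgrPdist_le/(_ _ e0) c2' := c2.
have oU' : \forall y \near x, U y by exact: open_nbhs_nbhs.
have /nbhs_ballP[r1 /= r10 Hr1] : nbhs x [set y | `|'D_v ('D_w f) x - 'D_v ('D_w f) y| <= e] := c1'.
have /nbhs_ballP[r2 /= r20 Hr2] : nbhs x [set y | `|'D_w ('D_v f) x - 'D_w ('D_v f) y| <= e] := c2'.
have /nbhs_ballP[r3 /= r30 Hr3] : nbhs x U := oU'.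
pose r := Num.min r1 (Num.min r2 r3).
have r0 : 0 < r by rewrite !lt_min r10 r20.
have Hr y : ball x r y -> U y /\ (`|'D_v ('D_w f) x - 'D_v ('D_w f) y| <= e /\
     `|'D_w ('D_v f) x - 'D_w ('D_v f) y| <= e).
  move=> xy; split; [apply: Hr3|split; [apply: Hr1|apply: Hr2]];
    apply: le_ball xy; rewrite /r !ge_min lexx ?orbT//.
have vw : 0 < `|v| + `|w| + 1 by rewrite ltr_wpDl// addr_ge0.
pose h := r / (`|v| + `|w| + 1).
have h0 : 0 < h by rewrite divr_gt0.
have hr : h * (`|v| + `|w|) < r.
  by rewrite /h mulrAC ltr_pdivrMr// ltr_pM2l// ltrDl.
have sU : ball x r `<=` U by move=> y /Hr[].
have [y yx E1] := second_difference sf sU h0 hr.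
have hr' : h * (`|w| + `|v|) < r by rewrite (addrC `|w|).
have [z zx E2] := second_difference sf sU h0 hr'.
have [|_ [_ Hy]] := Hr y; first by rewrite -ball_normE/= distrC; exact: le_lt_trans hr.
have [|_ [Hz _]] := Hr z; first by rewrite -ball_normE/= distrC; exact: le_lt_trans hr'.
have E : 'D_w ('D_v f) y = 'D_v ('D_w f) z.
  apply: (mulfI (lt0r_neq0 h0)); apply: (mulfI (lt0r_neq0 h0)).
  apply: etrans (esym E1) (etrans _ E2).
  have -> : x + h *: v + h *: w = x + h *: w + h *: v by rewrite addrAC.
  move: (f _) (f (x + h *: v)) (f (x + h *: w)) => a b c.
  by congr (_ + _); rewrite addrAC.
exact: dist_common_approx Hz Hy (esym E).
Qed.

End Schwarz.

(** * Smooth functions of one variable *)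

Section OneVar.
Variable R : realType.

(** Any class of functions closed under differentiation consists of smooth
functions. *)
Lemma smooth_1d (S : (R -> R) -> Prop) :
  (forall f, S f -> exists2 g, S g & forall x, is_derive x (1 : R) f (g x)) ->
  forall f, S f -> smooth_on setT f.
Proof.
move=> HS f Sf; apply/smooth_Ck => k; elim: k f Sf => [|k IH] f Sf.
  have [g Sg d] := HS _ Sf; split=> // x _.
  by apply/differentiable_continuous/derivable1_diffP; have [] := d x.
have [g Sg d] := HS _ Sf.
have df x : differentiable f x by apply/derivable1_diffP; have [] := d x.
apply/CkSP; split.
- by move=> x _; exact: differentiable_continuous.
- by move=> x _ v; exact: diff_derivable.
- move=> v; rewrite (_ : 'D_v f = fun x => v * g x).
    by apply: CkM; [exact: openT|exact: Ck_cst|exact: IH].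
  apply/funext => x; have [_ <-] := d x.
  have v1 : v *: (1 : R) = v by exact: mulr1.
  have d1 : derivable f x 1 by have [] := d x.
  have d2 : derivable f x (v *: (1 : R)) by apply: diff_derivable.
  by have := deriveZdir d1 d2; rewrite v1.
Qed.

Lemma smooth_expR : smooth_on setT (@expR R).
Proof.
apply: (@smooth_1d (eq (@expR R))) => // f <-; exists expR => // x.
exact: is_derive_expR.
Qed.

Lemma smooth_trig : smooth_on setT (@cos R) /\ smooth_on setT (@sin R).
Proof.
pose S (f : R -> R) := exists a b, f = fun x => a * cos x + b * sin x.
have HS f : S f -> smooth_on setT f.
  apply: smooth_1d => {}f [a [b ->]].
  exists (fun x => b * cos x + (- a) * sin x); first by exists b, (- a).
  move=> x; apply: is_derive_eq.
  by rewrite /GRing.scale/=; ring.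
split; apply: HS; [exists 1, 0|exists 0, 1]; apply/funext => x; ring.
Qed.

(** The functions P(1/t) exp(-1/t) extended by 0: this class contains the standard
flat function and is closed under differentiation. *)
Definition flat (P : {poly R}) (t : R) : R :=
  if 0 < t then P.[t^-1] * expR (- t^-1) else 0.

(** Induction on the degree, each factor s being paid for with half of the exponent. *)
Lemma poly_le_exp (P : {poly R}) (a : R) : 0 < a -> exists2 C, 0 <= C &
  forall s, 0 <= s -> `|P.[s]| <= C * expR (a * s).
Proof.
elim/poly_ind: P a => [|P c IH] a a0.
  by exists 0 => // s _; rewrite horner0 normr0 mul0r.
have [C C0 HC] := IH (a / 2) (divr_gt0 a0 (ltr0Sn _ 1)).
exists (C * (2 / a) + `|c|) => [|s s0].
  by rewrite addr_ge0// mulr_ge0// divr_ge0// ltW.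
rewrite hornerMXaddC mulrDl; apply: le_trans (ler_normD _ _) _; apply: lerD.
  rewrite normrM (ger0_norm s0).
  have -> : a * s = a / 2 * s + a / 2 * s by field.
  rewrite expRD (_ : C * (2 / a) * _ = (C * expR (a / 2 * s)) * (2 / a * expR (a / 2 * s))); last first.
    by move: (expR _) => E; ring.
  apply: ler_pM => //; first exact: HC.
  rewrite -ler_pdivrMl ?divr_gt0// invf_div.
  apply: le_trans (expR_ge1Dx _); rewrite lerDr//.
rewrite ler_peMr//; apply: le_trans (expR_ge1Dx _).
by rewrite lerDl mulr_ge0// ltW.
Qed.

Lemma flat_bound (P : {poly R}) : exists2 C, 0 <= C &
  forall t, `|flat P t| <= C * t ^+ 2.
Proof.
have [C C0 HC] := poly_le_exp ('X ^+ 2 * P) ltr01.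
exists C => // t; rewrite /flat; case: ifPn => t0; last first.
  by rewrite normr0 mulr_ge0// sqr_ge0.
have ti : 0 <= t^-1 by rewrite invr_ge0 ltW.
have := HC _ ti; rewrite mul1r hornerM hornerXn expRN normrM.
rewrite (ger0_norm (sqr_ge0 _)) normrM.
rewrite (@gtr0_norm _ (expR _)^-1) ?invr_gt0 ?expR_gt0// => H.
rewrite ler_pdivrMr ?expR_gt0// mulrAC.
rewrite -(ler_pM2l (_ : 0 < t^-1 ^+ 2)) ?exprn_gt0 ?invr_gt0//.
apply: le_trans H _; rewrite mulrCA exprVn mulVf ?mulr1// expf_neq0//.
by rewrite gt_eqF.
Qed.

Lemma is_derive_flat (P : {poly R}) (t : R) :
  is_derive t (1 : R) (flat P) (flat ('X^2 * (P - P^`())) t).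
Proof.
have [t0|t0|->] := ltgtP t 0.
- rewrite {2}/flat ltNge (ltW t0)/=.
  have N : \forall s \near t, (cst 0 : R -> R) s = flat P s.
    near=> s; rewrite /flat ltNge (_ : s <= 0)//.
    by apply: ltW; near: s; exact: lt_nbhsl.
  exact: near_eq_is_derive N (is_derive_cst _ _ _).
- rewrite {2}/flat t0.
  have N : \forall s \near t, (fun t => P.[t^-1] * expR (- t^-1)) s = flat P s.
    near=> s; rewrite /flat (_ : 0 < s)//.
    by near: s; exact: lt_nbhsr.
  have tn0 : t != 0 by rewrite gt_eqF.
  have dV : is_derive t (1 : R) (fun t : R => t^-1) (- t ^- 2).
    split; first by apply: derivableV.
    by rewrite deriveV// derive_id scaleNr [_ *: _]mulr1.
  have d1 : is_derive t (1 : R) (fun t : R => P.[t^-1]) (- t ^- 2 * P^`().[t^-1]).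
    have := @is_derive1_comp _ (horner P) (fun t : R => t^-1) t _ _ (is_derive_poly P t^-1) dV.
    by rewrite mulrC.
  have d2 : is_derive t (1 : R) (fun t : R => expR (- t^-1)) (t ^- 2 * expR (- t^-1)).
    have dN : is_derive t (1 : R) (fun t : R => - t^-1) (t ^- 2).
      by apply: is_derive_eq; rewrite opprK.
    have := @is_derive1_comp _ (@expR R) (fun t : R => - t^-1) t _ _ (is_derive_expR _) dN.
    by rewrite mulrC.
  apply: near_eq_is_derive N _.
  apply: is_derive_eq; rewrite /GRing.scale/= hornerM hornerXn hornerD hornerN.
  move: (P.[_]) (P^`().[_]) (expR _) => a b c; rewrite -exprVn; ring.
- rewrite {2}/flat ltxx.
  have [C C0 HC] := flat_bound P.
  have C1 : 0 < C + 1 by rewrite ltr_wpDl.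
  have f0 : flat P 0 = 0 by rewrite /flat ltxx.
  have L : (fun h : R => h^-1 *: ((flat P \o shift 0) (h *: 1) - flat P 0)) @ 0^' --> (0 : R).
    apply/cvgrPdist_le => e e0; near=> h.
    rewrite sub0r normrN f0 subr0 /= addr0 [h%:A]mulr1.
    have h0 : h != 0 by near: h; exact: nbhs_dnbhs_neq.
    rewrite normrM normfV ler_pdivrMl ?normr_gt0//.
    apply: le_trans (HC h) _; rewrite -real_normK ?num_real// expr2 mulrA mulrC.
    rewrite ler_wpM2l//.
    apply: (@le_trans _ _ ((C + 1) * `|h|)); first by rewrite ler_wpM2r// lerDl.
    rewrite -ler_pdivlMl//; near: h; apply: dnbhs0_le; rewrite mulr_gt0// invr_gt0//.
  by split; [apply/cvg_ex; exists 0|apply: cvg_lim].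
Unshelve. all: by end_near. Qed.

Lemma smooth_flat (P : {poly R}) : smooth_on setT (flat P).
Proof.
apply: (@smooth_1d (fun f => exists P, f = flat P)); last by exists P.
move=> _ [Q ->]; exists (flat ('X^2 * (Q - Q^`()))); first by eexists.
exact: is_derive_flat.
Qed.

End OneVar.

(** * An interior gradient estimate for the Laplacian *)

Section Squares.
Variable R : realType.
Implicit Types (x y : R * R).

Definition square (x : R * R) (r : R) : set (R * R) := [set y | `|y - x| <= r].

Lemma squareE x r y : square x r y <-> `|y.1 - x.1| <= r /\ `|y.2 - x.2| <= r.
Proof.
rewrite /square/= [X in X <= _]prod_normE/= ge_max.
by split=> [/andP[]|[-> ->]].
Qed.

Lemma compact_square x r : compact (square x r).
Proof.
have -> : square x r = `[x.1 - r, x.1 + r] `*` `[x.2 - r, x.2 + r].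
  apply/seteqP; split=> y; rewrite /= ?in_itv/=.
    by move=> /squareE; rewrite !ler_distl => -[-> ->].
  by move=> [h1 h2]; apply/squareE; rewrite !ler_distl.
by apply: compact_setX; exact: segment_compact.
Qed.

Lemma square_center x r : 0 <= r -> square x r x.
Proof. by rewrite /square/= subrr normr0. Qed.

Lemma EVT_square x r (f : R * R -> R) : 0 <= r ->
  (forall y, square x r y -> {for y, continuous f}) ->
  exists2 c, square x r c & forall y, square x r y -> f y <= f c.
Proof.
move=> r0 cf.
have [||c] := @compact_EVT_max _ _ f (square x r) _ (@compact_square x r).
- by exists x; exact: square_center.
- by apply: continuous_in_subspaceT => y; rewrite inE; exact: cf.
by rewrite inE => cK H; exists c => // y Ky; apply: H; rewrite inE.
Qed.

Definition e1 : R * R := (1, 0).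
Definition e2 : R * R := (0, 1).
Definition lap (f : R * R -> R) (x : R * R) : R :=
  'D_e1 ('D_e1 f) x + 'D_e2 ('D_e2 f) x.

(** The symmetric second difference at x is the mixed one at x - h e with both
increments equal to h e. *)
Lemma second_diff_approx (V : normedModType R) (U : set V) (f : V -> R) (x e : V) (eps : R) :
  open U -> smooth_on U f -> U x -> 0 < eps ->
  exists2 r : R, 0 < r & forall h : R, 0 < h < r ->
   `|f (x + h *: e) + f (x - h *: e) - 2 * f x - h ^+ 2 * 'D_e ('D_e f) x|
     <= eps * h ^+ 2.
Proof.
move=> oU sf Ux eps0.
have c1 : {for x, continuous ('D_e ('D_e f))} by apply: smooth_cont Ux; do 2 apply: smooth_D.
have /cvgrPdist_le/(_ _ eps0) c1' := c1.
have /nbhs_ballP[r1 /= r10 Hr1] : nbhs x [set y | `|'D_e ('D_e f) x - 'D_e ('D_e f) y| <= eps] := c1'.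
have /nbhs_ballP[r2 /= r20 Hr2] : nbhs x U by exact: open_nbhs_nbhs.
pose r := Num.min r1 r2.
have r0 : 0 < r by rewrite lt_min r10.
have en : 0 < 4 * `|e| + 1 by rewrite ltr_wpDl// mulr_ge0.
exists (r / (4 * `|e| + 1)); first by rewrite divr_gt0.
move=> h /andP[h0]; rewrite ltr_pdivlMr// => hr.
have hr' : h * (4 * `|e|) < r by apply: le_lt_trans hr; rewrite ler_pM2l// lerDl.
have he : 0 <= h * `|e| by rewrite mulr_ge0// ltW.
have sU : ball (x - h *: e) (r - h * `|e|) `<=` U.
  move=> y; rewrite -ball_normE/= => xy; apply: Hr2; rewrite -ball_normE/=.
  rewrite (_ : x - y = (x - h *: e - y) + h *: e); last by rewrite addrAC subrK.
  apply: le_lt_trans (ler_normD _ _) _; rewrite normrZ (gtr0_norm h0).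
  have rr : r <= r2 by rewrite /r ge_min lexx orbT.
  by apply: lt_le_trans rr; rewrite -ltrBrDr.
have hr2 : h * (`|e| + `|e|) < r - h * `|e|.
  by rewrite ltrBrDr; apply: le_lt_trans hr'; move: he; nra.
have [y yx] := second_difference sf sU h0 hr2.
rewrite subrK => E.
have -> : f (x + h *: e) + f (x - h *: e) - 2 * f x = h * (h * 'D_e ('D_e f) y).
  rewrite -E; move: (f _) (f (x - _)) (f x) => a b c; ring.
rewrite mulrA -expr2 -mulrBr normrM ger0_norm ?sqr_ge0// mulrC.
rewrite ler_wpM2r ?sqr_ge0// distrC; apply: Hr1; rewrite -ball_normE/= distrC.
rewrite (_ : y - x = (y - (x - h *: e)) - h *: e); last by rewrite opprB addrA addrAC addrK.
apply: le_lt_trans (ler_normB _ _) _; rewrite normrZ (gtr0_norm h0).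
have rr : r <= r1 by rewrite /r ge_min lexx.
apply: lt_le_trans rr; apply: le_lt_trans hr'; move: yx he; nra.
Qed.

Lemma cont_affine (V : normedModType R) (x0 e e' : V) :
  continuous (fun z : R * R => x0 + z.1 *: e + z.2 *: e').
Proof.
move=> z; apply: cvgD; first apply: cvgD.
- exact: cvg_cst.
- by apply: cvgZr_tmp; exact: cvg_fst.
- by apply: cvgZr_tmp; exact: cvg_snd.
Qed.

Section HalfSquare.
Variables (U : set (R * R)) (u p q : R * R -> R) (x0 e e' : R * R) (d M F : R).
Hypothesis d0 : 0 < d.
Hypothesis cu : forall x, U x -> {for x, continuous u}.
Hypothesis up : forall x (eps : R), U x -> 0 < eps ->
  exists2 r : R, 0 < r & forall h : R, 0 < h < r ->
   `|u (x + h *: e) + u (x - h *: e) - 2 * u x - h ^+ 2 * p x| <= eps * h ^+ 2.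
Hypothesis uq : forall x (eps : R), U x -> 0 < eps ->
  exists2 r : R, 0 < r & forall h : R, 0 < h < r ->
   `|u (x + h *: e') + u (x - h *: e') - 2 * u x - h ^+ 2 * q x| <= eps * h ^+ 2.
Let A (s t : R) : R * R := x0 + s *: e + t *: e'.
Hypothesis AU : forall s t, `|s| <= d -> `|t| <= d -> U (A s t).
Hypothesis uM : forall s t, `|s| <= d -> `|t| <= d -> `|u (A s t)| <= M.
Hypothesis uF : forall s t, `|s| <= d -> `|t| <= d ->
  `|p (A s t) + q (A s t)| < F.

Let psi (s t : R) := M / d ^+ 2 * (s ^+ 2 + t * (2 * d - t)) + F / 2 * (t * (d - t)).
Let g (s t : R) := (u (A s t) - u (A s (- t))) / 2 - psi s t.

Let M0 : 0 <= M.
Proof. have n0 : `|0 : R| <= d by rewrite normr0 ltW.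
exact: le_trans (normr_ge0 _) (uM n0 n0). Qed.

Let F0 : 0 < F.
Proof. have n0 : `|0 : R| <= d by rewrite normr0 ltW.
exact: le_lt_trans (normr_ge0 _) (uF n0 n0). Qed.

Let diff_le s t : `|s| <= d -> `|t| <= d -> (u (A s t) - u (A s (- t))) / 2 <= M.
Proof.
move=> sd td; have h1 := uM sd td.
have h2 : `|u (A s (- t))| <= M by apply: uM => //; rewrite normrN.
rewrite ler_pdivrMr// mulrDr mulr1; move: h1 h2; rewrite !ler_norml.
move: (u _) (u _) => a b; lra.
Qed.

(** Here g is half the odd part of u in t minus a barrier with Laplacian -F, and
the odd part has Laplacian larger than -2 F: at an interior maximum the
increments of g in the four coordinate directions would be nonpositive, but for
small steps their sum is positive. *)
Lemma half_square_interior s t : `|s| < d -> 0 < t < d ->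
  ~ (forall s' t', `|s'| <= d -> 0 <= t' <= d -> g s' t' <= g s t).
Proof.
move=> sd /andP[t0 td] gmax.
have td' : `|t| <= d by rewrite gtr0_norm// ltW.
have ntd' : `|- t| <= d by rewrite normrN.
have sd' := ltW sd.
set P := A s t; set P' := A s (- t).
have L1 := uF sd' td'; have L2 := uF sd' ntd'.
rewrite -/P in L1; rewrite -/P' in L2.
(* The Laplacian of g is 4 eps, and the four approximations below change it by at
   most 2 eps. *)
pose eps := (p P + q P - (p P' + q P') + 2 * F) / 8.
have eps0 : 0 < eps.
  rewrite divr_gt0//; move: L1 L2; rewrite !ltr_norml.
  move: (p P + _) (p P' + _) => a b; lra.
have UP : U P by exact: AU.
have UP' : U P' by exact: AU.
have [r1 r10 H1] := up UP eps0.
have [r2 r20 H2] := uq UP eps0.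
have [r3 r30 H3] := up UP' eps0.
have [r4 r40 H4] := uq UP' eps0.
pose h := Num.min (Num.min (Num.min r1 r2) (Num.min r3 r4)) (Num.min (d - `|s|) (Num.min t (d - t))) / 2.
have m0 : 0 < Num.min (Num.min (Num.min r1 r2) (Num.min r3 r4)) (Num.min (d - `|s|) (Num.min t (d - t))).
  by rewrite !lt_min r10 r20 r30 r40 t0 !subr_gt0 sd td.
have h0 : 0 < h by rewrite divr_gt0.
have : h < Num.min (Num.min (Num.min r1 r2) (Num.min r3 r4)) (Num.min (d - `|s|) (Num.min t (d - t))).
  by rewrite /h ltr_pdivrMr// ltr_pMr// ltr1n.
rewrite !lt_min => /andP[/andP[/andP[hr1 hr2] /andP[hr3 hr4]] /andP[hs /andP[ht htd]]].
have {H1}H1 := H1 h; have {H2}H2 := H2 h; have {H3}H3 := H3 h; have {H4}H4 := H4 h.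
rewrite h0/= in H1 H2 H3 H4.
have {}H1 := H1 hr1; have {}H2 := H2 hr2; have {}H3 := H3 hr3; have {}H4 := H4 hr4.
have G1 : g (s + h) t <= g s t.
  apply: gmax; last by rewrite !ltW.
  by apply: le_trans (ler_normD _ _) _; rewrite (gtr0_norm h0) -lerBrDl ltW.
have G2 : g (s - h) t <= g s t.
  apply: gmax; last by rewrite !ltW.
  by apply: le_trans (ler_normB _ _) _; rewrite (gtr0_norm h0) -lerBrDl ltW.
have G3 : g s (t + h) <= g s t.
  by apply: gmax => //; apply/andP; split; lra.
have G4 : g s (t - h) <= g s t.
  by apply: gmax => //; apply/andP; split; lra.
have E1 : A (s + h) t = P + h *: e by rewrite /P /A scalerDl addrA (addrAC _ (h *: e)).
have E1' : A (s + h) (- t) = P' + h *: e by rewrite /P' /A scalerDl addrA (addrAC _ (h *: e)).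
have E2 : A (s - h) t = P - h *: e by rewrite /P /A scalerBl addrA (addrAC _ (- (h *: e))).
have E2' : A (s - h) (- t) = P' - h *: e by rewrite /P' /A scalerBl addrA (addrAC _ (- (h *: e))).
have E3 : A s (t + h) = P + h *: e' by rewrite /P /A scalerDl !addrA.
have E3' : A s (- (t + h)) = P' - h *: e' by rewrite /P' /A opprD scalerBl !addrA.
have E4 : A s (t - h) = P - h *: e' by rewrite /P /A scalerBl !addrA.
have E4' : A s (- (t - h)) = P' + h *: e' by rewrite /P' /A opprD opprK scalerDl !addrA.
move: G1 G2 G3 G4; rewrite /g E1 E1' E2 E2' E3 E3' E4 E4' -/P -/P'.
move: H1 H2 H3 H4 eps0; rewrite !ler_norml /eps.
move: (u P) (u P') (u (P + _)) (u (P - _)) (u (P + _)) (u (P - _)) (u (P' + _)) (u (P' - _)) (u (P' + _)) (u (P' - _)).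
move=> uP uP' a1 a2 a3 a4 b1 b2 b3 b4.
move: (p P) (q P) (p P') (q P') => D1 D2 D3 D4.
have Epsi : psi (s + h) t + psi (s - h) t + psi s (t + h) + psi s (t - h) = 4 * psi s t - F * h ^+ 2.
  by rewrite /psi; field; rewrite gt_eqF.
move: (psi (s + h) t) (psi (s - h) t) (psi s (t + h)) (psi s (t - h)) (psi s t) Epsi => p1 p2 p3 p4 p0 Epsi.
have hh : 0 < h ^+ 2 by rewrite exprn_gt0.
move: (h ^+ 2) hh Epsi => k k0 Epsi.
move=> /andP[H1 _] /andP[H2 _] /andP[_ H3] /andP[_ H4] eps0 G1 G2 G3 G4.
have := mulr_gt0 eps0 k0; nra.
Qed.

(** On the sides of the half square |s| <= d, 0 <= t <= d the barrier dominates half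
the odd part: on t = 0 the latter vanishes, and on the other sides the barrier
is at least M. *)
Lemma half_square t : 0 <= t <= d -> u (x0 + t *: e') - u (x0 - t *: e') <= 2 * psi 0 t.
Proof.
move=> tt.
pose K : set (R * R) := `[- d, d] `*` `[0, d].
have KP z : K z <-> `|z.1| <= d /\ 0 <= z.2 <= d.
  by rewrite /K /= !in_itv/= ler_norml.
have Kd z : K z -> `|z.1| <= d /\ `|z.2| <= d.
  by move=> /KP[-> /andP[z0 zd]]; rewrite ger0_norm.
pose G (z : R * R) := g z.1 z.2.
have cG z : K z -> {for z, continuous G}.
  move=> /Kd[z1 z2].
  have c1 : {for z, continuous (fun z : R * R => u (A z.1 z.2))}.
    apply: (@continuous_comp _ _ _ (fun z : R * R => A z.1 z.2)); first exact: cont_affine.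
    by apply: cu; exact: AU.
  have c2 : {for z, continuous (fun z : R * R => u (A z.1 (- z.2)))}.
    apply: (@continuous_comp _ _ _ (fun z : R * R => A z.1 (- z.2))).
      rewrite (_ : (fun z => _) = fun z : R * R => x0 + z.1 *: e + z.2 *: (- e')).
        exact: cont_affine.
      by apply/funext => y; rewrite /A scalerN scaleNr.
    by apply: cu; apply: AU => //; rewrite normrN.
  have cf : fst y @[y --> z] --> z.1 by exact: cvg_fst.
  have cs : snd y @[y --> z] --> z.2 by exact: cvg_snd.
  apply: cvgB; first by apply: cvgMr_tmp; apply: cvgB; [exact: c1|exact: c2].
  rewrite /psi; apply: cvgD; apply: cvgMl_tmp.
    apply: cvgD; first by rewrite expr2; apply: cvgM.
    by apply: cvgM => //; apply: cvgB => //; exact: cvg_cst.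
  by apply: cvgM => //; apply: cvgB => //; exact: cvg_cst.
have [|||c cK cmax] := @compact_EVT_max _ _ G K.
- by exists (0, 0); apply/KP; rewrite normr0 lexx ltW.
- by apply: compact_setX; exact: segment_compact.
- by apply: continuous_in_subspaceT => y; rewrite inE; exact: cG.
rewrite inE in cK; have /KP[c1 /andP[c20 c2d]] := cK.
suff Gc : G c <= 0.
  have Kt : K (0, t) by apply/KP; rewrite normr0 ltW.
  have := cmax (0, t); rewrite inE => /(_ Kt)/le_trans/(_ Gc).
  rewrite /G /g /= /A scale0r addr0 scaleNr subr_le0 ler_pdivrMr//.
  by rewrite mulrC.
rewrite leNgt; apply/negP => Gc.
have M1 := M0; have d2 : 0 < d ^+ 2 by rewrite exprn_gt0.
have F1 := F0.
have B1 : `|c.1| < d.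
  rewrite lt_neqAle c1 andbT; apply/eqP => E; move: Gc; apply/negP; rewrite -leNgt.
  have := @diff_le c.1 c.2; rewrite E lexx ger0_norm// => /(_ isT c2d).
  rewrite /G /g subr_le0 => /le_trans; apply; rewrite /psi.
  rewrite -[c.1 ^+ 2]real_normK ?num_real// E.
  have h1 : 0 <= c.2 * (2 * d - c.2) by nra.
  have h2 : 0 <= c.2 * (d - c.2) by nra.
  apply: (@le_trans _ _ (M / d ^+ 2 * (d ^+ 2 + 0) + 0)).
    by rewrite !addr0 divfK// gt_eqF.
  apply: lerD; last by rewrite mulr_ge0// divr_ge0// ltW.
  by rewrite ler_wpM2l ?lerD2l// divr_ge0// ltW.
have B2 : 0 < c.2.
  rewrite lt_neqAle c20 andbT; apply/eqP => E; move: Gc; apply/negP; rewrite -leNgt.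
  rewrite /G /g -E oppr0 subrr mul0r sub0r oppr_le0 /psi !mul0r mulr0 !addr0.
  by rewrite mulr_ge0 ?sqr_ge0// divr_ge0// ltW.
have B3 : c.2 < d.
  rewrite lt_neqAle c2d andbT; apply/eqP => E; move: Gc; apply/negP; rewrite -leNgt.
  have := @diff_le c.1 c.2; rewrite c1 ger0_norm// => /(_ isT c2d).
  rewrite /G /g subr_le0 => /le_trans; apply; rewrite /psi E subrr mulr0 mulr0 addr0.
  rewrite (_ : d * (2 * d - d) = d ^+ 2); last by ring.
  apply: (@le_trans _ _ (M / d ^+ 2 * (0 + d ^+ 2))); first by rewrite add0r divfK// gt_eqF.
  by rewrite ler_wpM2l ?lerD2r ?sqr_ge0// divr_ge0// ltW.
have B23 : 0 < c.2 < d by rewrite B2 B3.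
apply: (half_square_interior B1 B23) => s' t' s'd t'd.
have /cmax : (s', t') \in K by rewrite inE; apply/KP.
by [].
Qed.

End HalfSquare.

(** The comparison bounds the odd part by a function vanishing at t = 0; dividing
by t gives the derivative at the centre. *)
Lemma half_square_derive (U : set (R * R)) (u : R * R -> R) (x0 e e' : R * R) (d M F : R) :
  open U -> 0 < d -> smooth_on U u ->
  (forall s t : R, `|s| <= d -> `|t| <= d -> let y := x0 + s *: e + t *: e' in
    [/\ U y, `|u y| <= M & `|'D_e ('D_e u) y + 'D_e' ('D_e' u) y| < F]) ->
  'D_e' u x0 <= 2 / d * M + d / 2 * F.
Proof.
move=> oU d0 su H; have n0 : `|0 : R| <= d by rewrite normr0 ltW.
apply/ler_addgt0Pr => eps eps0.
have U0 : U x0.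
  by have [+ _ _] := H 0 0 n0 n0; rewrite !scale0r !addr0.
have /derivable_approx/(_ _ eps0) dv := smooth_drv (v := e') su U0.
have /nbhs_ballP[r /= r0 Hr] := dv.
pose h := Num.min (r / 2) d.
have h0 : 0 < h by rewrite lt_min d0 divr_gt0.
have hd : h <= d by rewrite ge_min lexx orbT.
have hr : h < r by rewrite gt_min ltr_pdivrMr// ltr_pMr// ltr1n.
have B1 : ball 0 r h by rewrite -ball_normE/= sub0r normrN gtr0_norm.
have B2 : ball 0 r (- h) by rewrite -ball_normE/= sub0r opprK gtr0_norm.
have := Hr _ B1; have := Hr _ B2 => /=.
have HS : u (x0 + h *: e') - u (x0 - h *: e') <=
    2 * (M / d ^+ 2 * (0 ^+ 2 + h * (2 * d - h)) + F / 2 * (h * (d - h))).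
  apply: (@half_square U u ('D_e ('D_e u)) ('D_e' ('D_e' u)) x0 e e' d M F d0).
  - by move=> x Ux; exact: smooth_cont su Ux.
  - by move=> x eps1 Ux; exact: second_diff_approx oU su Ux.
  - by move=> x eps1 Ux; exact: second_diff_approx oU su Ux.
  - by move=> s t sd td; have [] := H s t sd td.
  - by move=> s t sd td; have [] := H s t sd td.
  - by move=> s t sd td; have [] := H s t sd td.
  - by rewrite ltW.
move: HS.
rewrite scaleNr normrN (gtr0_norm h0) !ler_norml /GRing.scale/=.
move: (u _) (u (x0 - _)) (u x0) ('D_e' u x0) => a b c D.
rewrite expr0n/= add0r => H1 /andP[_ H2] /andP[H3 _].
have : 2 * h * D <= 2 * h * (2 / d * M + d / 2 * F + eps).
  have E : M / d ^+ 2 * (h * (2 * d - h)) + F / 2 * (h * (d - h)) =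
     h * (2 / d * M + d / 2 * F) - h ^+ 2 * (M / d ^+ 2 + F / 2).
    by field; rewrite gt_eqF.
  have M0 : 0 <= M by have [_ + _] := H 0 0 n0 n0; exact: le_trans.
  have F0 : 0 < F by have [_ _] := H 0 0 n0 n0; exact: le_lt_trans.
  have E2 : 0 <= h ^+ 2 * (M / d ^+ 2 + F / 2).
    by rewrite mulr_ge0 ?sqr_ge0// addr_ge0// divr_ge0// ?sqr_ge0// ltW.
  move: H1; rewrite E; move: (h ^+ 2 * _) (2 / d * M + d / 2 * F) E2 => k l; nra.
by rewrite ler_pM2l// mulr_gt0.
Qed.

End Squares.

(** * Gradient bounds under small quadratic growth *)

Section Gradient.
Variable R : realType.
Notation e1 := (e1 R).
Notation e2 := (e2 R).

Lemma square_cross (x0 : R * R) (d s t : R) : `|s| <= d -> `|t| <= d ->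
  square x0 d (x0 + s *: e1 + t *: e2).
Proof.
move=> sd td; apply/squareE => /=; rewrite !scaler0 !addr0 [s%:A]mulr1 [t%:A]mulr1.
by rewrite ![x0.1 + _]addrC ![x0.2 + _]addrC !addrK.
Qed.

Lemma derive2N (U : set (R * R)) (u : R * R -> R) v x : open U -> smooth_on U u -> U x ->
  'D_v (fun y => - u y) x = - 'D_v u x /\
  'D_v ('D_v (fun y => - u y)) x = - 'D_v ('D_v u) x.
Proof.
move=> oU su Ux.
have D y : U y -> 'D_v (fun y => - u y) y = - 'D_v u y.
  by move=> Uy; rewrite [LHS]deriveN//; exact: smooth_drv su Uy.
split; first exact: D.
have -> : 'D_v ('D_v (fun y => - u y)) x = 'D_v (fun y => - 'D_v u y) x.
  exact: (@iterD_eq _ _ _ U _ _ [:: v] x oU D Ux).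
by rewrite [LHS]deriveN//; apply: smooth_drv Ux; exact: smooth_D.
Qed.

Lemma gradient_estimate (U : set (R * R)) (u : R * R -> R) (x0 : R * R) (d M F : R) :
  open U -> 0 < d -> smooth_on U u -> square x0 d `<=` U ->
  (forall y, square x0 d y -> `|u y| <= M) ->
  (forall y, square x0 d y -> `|lap u y| < F) ->
  `|'D_e1 u x0| <= 2 / d * M + d / 2 * F /\ `|'D_e2 u x0| <= 2 / d * M + d / 2 * F.
Proof.
move=> oU d0 su sU uM uF.
have U0 : U x0 by apply: sU; apply: square_center; exact: ltW.
have C2 s t : `|s| <= d -> `|t| <= d -> square x0 d (x0 + s *: e2 + t *: e1).
  by move=> sd td; rewrite addrAC; exact: square_cross.
have sN := smoothN oU su.
have uMN y : square x0 d y -> `|- u y| <= M by rewrite normrN; exact: uM.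
have uFN y : square x0 d y -> `|lap (fun z => - u z) y| < F.
  move=> Qy; rewrite /lap; have [_ ->] := derive2N e1 oU su (sU _ Qy).
  by have [_ ->] := derive2N e2 oU su (sU _ Qy); rewrite -opprD normrN; exact: uF.
have H2 w : smooth_on U w -> (forall y, square x0 d y -> `|w y| <= M) ->
    (forall y, square x0 d y -> `|lap w y| < F) -> 'D_e2 w x0 <= 2 / d * M + d / 2 * F.
  move=> sw wM wF; apply: (half_square_derive (e := e1) oU d0 sw) => s t sd td y.
  by have Qy := square_cross x0 sd td; split; [exact: sU|exact: wM|exact: wF].
have H1 w : smooth_on U w -> (forall y, square x0 d y -> `|w y| <= M) ->
    (forall y, square x0 d y -> `|lap w y| < F) -> 'D_e1 w x0 <= 2 / d * M + d / 2 * F.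
  move=> sw wM wF; apply: (half_square_derive (e := e2) oU d0 sw) => s t sd td y.
  have Qy := C2 _ _ sd td; split; [exact: sU|exact: wM|].
  by rewrite addrC; exact: wF.
have [N1 _] := derive2N e1 oU su U0.
have [N2 _] := derive2N e2 oU su U0.
split; rewrite ler_norml; apply/andP; split.
- by rewrite lerNl -N1; exact: H1.
- exact: H1.
- by rewrite lerNl -N2; exact: H2.
- exact: H2.
Qed.

Definition grad_sum (J : finType) (W : J -> R * R -> R) (x : R * R) : R :=
  \sum_j (`|'D_e1 (W j) x| + `|'D_e2 (W j) x|).

Lemma grad_sum_ge0 (J : finType) (W : J -> R * R -> R) x : 0 <= grad_sum W x.
Proof. by apply: sumr_ge0 => j _; rewrite addr_ge0. Qed.

(** The gradient estimate on the scale r = (k / m) D has four contributions: that of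
the sup bound is at most m / 4 by the choice of k, that of the quadratic term at
most m / 4 by the smallness of eps, and the two others are each at most n k A. *)
Lemma rescaling_arith (n M A m D k eps : R) : 1 <= n -> 0 <= M -> 0 < A -> 0 < D -> D <= 1 ->
  0 <= eps -> k = 8 * n * (M + 1) -> eps * (8 * n * k * A) <= 1 -> 1 <= m -> 2 * k <= m ->
  let r := k / m * D in
  m / D <= n * (2 / r * M + r / 2 * (A * (2 + 2 * m / D + eps * (2 * m / D) ^+ 2))) ->
  m <= 4 * n * k * A.
Proof.
move=> n1 M0 A0 D0 D1 eps0 kE epsE m1 km r.
have k0 : 0 < k by rewrite kE; nra.
have m0 : 0 < m by apply: lt_le_trans m1.
rewrite ler_pdivrMr// => H.
have : m <= 2 * n * M / k * m + n * k * A * (D ^+ 2 / m + D + 2 * eps * m).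
  apply: le_trans H _; rewrite le_eqVlt; apply/orP; left; apply/eqP.
  by rewrite /r; field; rewrite !gt_eqF.
have h1 : 2 * n * M / k * m <= m / 4.
  rewrite mulrC [m / 4]mulrC (mulrC m) ler_wpM2r ?(ltW m0)// ler_pdivrMr// kE.
  nra.
have h2 : D ^+ 2 / m <= 1.
  by rewrite ler_pdivrMr// mul1r; apply: le_trans m1; rewrite expr_le1// ltW.
have h3 : n * k * A * (2 * eps * m) <= m / 4.
  rewrite (_ : _ * (2 * eps * m) = (eps * (8 * n * k * A)) * (m / 4)); last by field.
  by rewrite ler_piMl// divr_ge0// ltW.
have c0 : 0 <= n * k * A by rewrite !mulr_ge0 ?(ltW k0)// ?(ltW A0)// (le_trans _ n1).
rewrite 2!mulrDr.
have h4 : n * k * A * (D ^+ 2 / m) <= n * k * A by rewrite -[leRHS]mulr1 ler_wpM2l.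
have h5 : n * k * A * D <= n * k * A by rewrite -[leRHS]mulr1 ler_wpM2l.
rewrite (_ : 4 * n * k * A = 4 * (n * k * A)); last by ring.
move: (n * k * A * (D ^+ 2 / m)) (n * k * A * D) (n * k * A * (2 * eps * m)) (2 * n * M / k * m) (n * k * A) h1 h3 h4 h5.
move=> a b c d' e' h1 h3 h4 h5; lra.
Qed.

(** Let m be the maximum of (1 - |y - x0|) times the gradient, attained at y0 at
distance D from the boundary. On the square of radius D / 2 around y0 the
gradient at most doubles, so that the Laplacian is bounded there in terms of m;
the gradient estimate on a square whose radius is inversely proportional to m
then bounds m itself. *)
Lemma small_quadratic_gradient (J : finType) (M A : R) : 0 <= M -> 0 < A ->
  exists eps0 C : R, 0 < eps0 /\
  forall (U : set (R * R)) (W : J -> R * R -> R) (x0 : R * R) (eps : R),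
  open U -> square x0 1 `<=` U -> (forall j, smooth_on U (W j)) ->
  0 <= eps <= eps0 ->
  (forall j y, square x0 1 y -> `|W j y| <= M) ->
  (forall j y, square x0 1 y ->
     `|lap (W j) y| <= A * (1 + grad_sum W y + eps * grad_sum W y ^+ 2)) ->
  grad_sum W x0 <= C.
Proof.
move=> M0 A0.
(* The gradient sum has 2 #|J| terms, each bounded by the gradient estimate. *)
have [n nE] : exists n : R, n = 2 * #|J|%:R + 1 by eexists.
have n1 : 1 <= n by rewrite nE lerDr mulr_ge0.
have [k kE] : exists k : R, k = 8 * n * (M + 1) by eexists.
have k0 : 0 < k by rewrite kE; nra.
have n0 : 0 < n by apply: lt_le_trans n1.
have c0 : 0 < 8 * n * k * A by rewrite !mulr_gt0.
exists (8 * n * k * A)^-1, (1 + 2 * k + 4 * n * k * A).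
split; first by rewrite invr_gt0.
move=> U W x0 eps oU sU sW /andP[eps_ge0 epsE] WM WL.
pose dist y : R := 1 - `|y - x0|.
have cW j v y : square x0 1 y -> {for y, continuous ('D_v (W j))}.
  move=> /sU Uy; apply: smooth_cont Uy; exact: smooth_D.
have cT y : square x0 1 y -> {for y, continuous (fun y => dist y * grad_sum W y)}.
  move=> Qy; apply: cvgM.
    apply: cvgB; first exact: cvg_cst.
    by apply: cvg_norm; apply: cvgB; [exact: cvg_id|exact: cvg_cst].
  apply: cvg_big => [|j _]; first exact: add_continuous.
  by apply: cvgD; apply: cvg_norm; exact: cW.
have [y0 Qy0 ymax] := EVT_square ler01 cT.
pose D := dist y0; pose m := D * grad_sum W y0.
have Tm : grad_sum W x0 <= m.
  apply: le_trans (ymax x0 (square_center x0 ler01)).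
  by rewrite /dist subrr normr0 subr0 mul1r.
apply: le_trans Tm _.
have nkA : 0 <= 4 * n * k * A by rewrite !mulr_ge0// ?(ltW k0) ?(ltW A0)// (le_trans _ n1).
have [mk|mk] := leP m (1 + 2 * k); first by rewrite (le_trans mk)// lerDl.
have m1 : 1 <= m by apply: ltW; apply: le_lt_trans mk; rewrite lerDl mulr_ge0// ltW.
have m2k : 2 * k <= m by apply: ltW; apply: le_lt_trans mk; rewrite lerDr.
have m0 : 0 < m by apply: lt_le_trans m1.
have D0 : 0 < D.
  have Dge : 0 <= D by rewrite subr_ge0.
  rewrite lt_neqAle Dge andbT; apply/eqP => DE.
  by move: m0; rewrite /m -DE mul0r ltxx.
have D1 : D <= 1 by rewrite lerBlDr lerDl.
pose r := k / m * D.
have r0 : 0 < r by rewrite !mulr_gt0 ?invr_gt0.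
have rD : r <= D / 2.
  rewrite /r mulrC ler_wpM2l ?(ltW D0)// ler_pdivrMr// mulrC ler_pdivlMr//.
  by rewrite mulrC.
have near_y0 y : square y0 r y -> square x0 1 y /\ grad_sum W y <= 2 * m / D.
  rewrite /square/= => yr.
  have hy : `|y - x0| <= `|y0 - x0| + r.
    rewrite -(subrKA y0) addrC; apply: le_trans (ler_normD _ _) _.
    by rewrite lerD2l.
  have hD : D / 2 <= dist y.
    by rewrite /dist; move: hy rD; rewrite /D /dist; move: (`|y - x0|) (`|y0 - x0|) => a b; lra.
  have Qy : square x0 1 y.
    rewrite /square/=; move: hD; rewrite /dist; move: (`|y - x0|) => a; move: D0; lra.
  split => //; have := ymax _ Qy; rewrite -/m -/D => H.
  rewrite ler_pdivlMr//; apply: le_trans (_ : 2 * (dist y * grad_sum W y) <= _).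
    have := grad_sum_ge0 W y; move: (grad_sum W y) hD => T hD T0; nra.
  by rewrite ler_pM2l.
have F j y : square y0 r y -> `|lap (W j) y| < A * (2 + 2 * m / D + eps * (2 * m / D) ^+ 2).
  move=> /near_y0[Qy Ty]; apply: le_lt_trans (WL j _ Qy) _.
  rewrite ltr_pM2l//; apply: ltr_leD; last first.
    have T0 := grad_sum_ge0 W y; rewrite ler_wpM2l//.
    by rewrite ler_sqr ?nnegrE//; exact: le_trans T0 Ty.
  by rewrite ltr_leD// ltr1n.
have := @rescaling_arith n M A m D k eps n1 M0 A0 D0 D1 eps_ge0 kE.
have epsk : eps * (8 * n * k * A) <= 1 by rewrite -ler_pdivlMr// div1r.
move=> /(_ epsk m1 m2k)/= H.
apply: le_trans (H _) _; last by rewrite lerDr addr_ge0// mulr_ge0// ltW.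
have -> : m / D = grad_sum W y0 by rewrite /m mulrAC divff ?mul1r// gt_eqF.
set Q := _ + _.
have Q0 : 0 <= Q.
  have r20 := ltW r0; rewrite /Q -/r addr_ge0//; first by rewrite mulr_ge0// divr_ge0.
  rewrite mulr_ge0 ?divr_ge0// mulr_ge0 ?(ltW A0)// !addr_ge0//.
    by rewrite divr_ge0 ?(ltW D0)// mulr_ge0// (ltW m0).
  by rewrite mulr_ge0// sqr_ge0.
apply: (@le_trans _ _ (\sum_(j : J) (Q + Q))).
  apply: ler_sum => j _.
  have [||g1 g2] := gradient_estimate oU r0 (sW j) _ _ (F j) (M := M).
  - by move=> y /near_y0[/sU].
  - by move=> y /near_y0[Qy _]; exact: WM.
  by apply: lerD.
rewrite sumr_const -mulr_natl nE; move: Q Q0 => q q0.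
by rewrite -subr_ge0 (_ : _ - _ = q)//; ring.
Qed.

End Gradient.

(** * Families of functions with locally bounded derivatives *)

Section Families.
Variable R : realType.
Notation e1 := (e1 R).
Notation e2 := (e2 R).
Implicit Types (f g T : nat -> R * R -> R).

Definition open_square (r : R) : set (R * R) := [set x | `|x| < r].

Lemma open_open_square r : open (open_square r).
Proof.
have -> : open_square r = ball (0 : R * R) r.
  by apply/seteqP; split=> x; rewrite -ball_normE/= sub0r normrN.
exact: ball_open.
Qed.

(** Bounds are only required for i large, depending on the bounded set: the maps
under study satisfy their equation on domains that exhaust the plane. *)
Definition loc_bounded f := forall r : R, exists C : R, \forall i \near \oo, forall x, open_square r x -> `|f i x| <= C.
Definition ev_smooth f := forall r : R, \forall i \near \oo, smooth_on (open_square r) (f i).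
Definition controlled0 T f := forall r : R, exists C : R,
  \forall i \near \oo, forall x, open_square r x -> `|f i x| <= C * (1 + T i x).
Definition dir (b : bool) : R * R := if b then e2 else e1.
Definition dirD (b : bool) f : nat -> R * R -> R := fun i => 'D_(dir b) (f i).

(** The derivatives of order less than k are bounded, those of order k grow at most
linearly in the gauge T. With T = 0 all of them are bounded; in the induction on
the order, T is the sum of the derivatives of the next order, which are still to
be bounded. *)
Fixpoint controlled (k : nat) T f : Prop :=
  if k is k'.+1 then loc_bounded f /\ forall b, controlled k' T (dirD b f) else controlled0 T f.

Definition ev_eq f g := forall r : R, \forall i \near \oo, forall x, open_square r x -> f i x = g i x.

Lemma ev_eq_D f g b : ev_eq f g -> ev_eq (dirD b f) (dirD b g).
Proof.
move=> H r; have := H r; apply: filterS => i fg x Bx.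
exact: (@iterD_eq _ _ _ (open_square r) (f i) (g i) [:: dir b] x (@open_open_square r) fg Bx).
Qed.

Lemma loc_bounded_eq f g : ev_eq f g -> loc_bounded f -> loc_bounded g.
Proof.
move=> H Lf r; have [C HC] := Lf r; exists C.
by apply: filterS2 (H r) HC => i E HCi x Bx; rewrite -E// HCi.
Qed.

Lemma controlled_eq k T f g : ev_eq f g -> controlled k T f -> controlled k T g.
Proof.
elim: k f g => [|k IH] f g H /=.
  move=> Lf r; have [C HC] := Lf r; exists C.
  by apply: filterS2 (H r) HC => i E HCi x Bx; rewrite -E// HCi.
move=> [Lf Df]; split; first exact: loc_bounded_eq H Lf.
by move=> b; apply: IH (Df b); exact: ev_eq_D.
Qed.

Lemma ev_smooth_D f b : ev_smooth f -> ev_smooth (dirD b f).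
Proof. by move=> H r; have := H r; apply: filterS => i; exact: smooth_D. Qed.

Lemma ev_smooth_M f g : ev_smooth f -> ev_smooth g -> ev_smooth (fun i x => f i x * g i x).
Proof.
move=> Ef Eg r; apply: filterS2 (Ef r) (Eg r) => i sf sg.
exact: smoothM (@open_open_square r) sf sg.
Qed.

Lemma ev_smooth_Add f g : ev_smooth f -> ev_smooth g -> ev_smooth (fun i x => f i x + g i x).
Proof.
move=> Ef Eg r; apply: filterS2 (Ef r) (Eg r) => i sf sg.
exact: smoothD (@open_open_square r) sf sg.
Qed.

Lemma ev_smooth_cst (c : nat -> R) : ev_smooth (fun i _ => c i).
Proof. by move=> r; near=> i; exact: smooth_cst. Unshelve. all: by end_near. Qed.

Lemma ev_smooth_sum (I : Type) (s : seq I) (f : I -> nat -> R * R -> R) :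
  (forall j, ev_smooth (f j)) -> ev_smooth (fun i x => \sum_(j <- s) f j i x).
Proof.
move=> H; elim: s => [|j s IH].
  have -> : (fun i x => \sum_(j <- [::]) f j i x) = (fun _ _ => 0).
    by apply/funext => i; apply/funext => x; rewrite big_nil.
  exact: (ev_smooth_cst (fun=> 0)).
have -> : (fun i x => \sum_(k <- j :: s) f k i x) = (fun i x => f j i x + \sum_(j <- s) f j i x).
  by apply/funext => i; apply/funext => x; rewrite big_cons.
exact: (ev_smooth_Add (H j) IH).
Qed.

Variable T : nat -> R * R -> R.
Hypothesis T0 : forall i x, 0 <= T i x.

Lemma loc_bounded_controlled0 f : loc_bounded f -> controlled0 T f.
Proof.
move=> H r; have [C HC] := H r; exists `|C|.
apply: filterS HC => i HC x Bx; apply: le_trans (HC x Bx) _.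
by apply: le_trans (ler_norm _) _; rewrite ler_peMr// lerDl.
Qed.

Lemma controlled0_loc_bounded f : loc_bounded f <-> controlled0 (fun _ _ => 0) f.
Proof.
split=> H r; have [C HC] := H r; exists C; apply: filterS HC => i HC x Bx.
  by rewrite addr0 mulr1; exact: HC.
by have := HC x Bx; rewrite addr0 mulr1.
Qed.

Lemma controlled_D k f b : controlled k.+1 T f -> controlled k T (dirD b f). Proof. by case=> _; exact. Qed.

Lemma controlledW k f : controlled k.+1 T f -> controlled k T f.
Proof.
elim: k f => [|k IH] f [Lf Df]; first exact: loc_bounded_controlled0.
by split=> // b; exact: IH.
Qed.

Lemma loc_bounded_add f g : loc_bounded f -> loc_bounded g -> loc_bounded (fun i x => f i x + g i x).
Proof.
move=> Hf Hg r; have [C HC] := Hf r; have [D HD] := Hg r; exists (C + D).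
apply: filterS2 HC HD => i HCi HDi x Bx.
by apply: le_trans (ler_normD _ _) _; apply: lerD; [exact: HCi|exact: HDi].
Qed.

Lemma loc_bounded_mul f g : loc_bounded f -> loc_bounded g -> loc_bounded (fun i x => f i x * g i x).
Proof.
move=> Hf Hg r; have [C HC] := Hf r; have [D HD] := Hg r; exists (C * D).
apply: filterS2 HC HD => i HCi HDi x Bx.
by rewrite normrM; apply: ler_pM => //; [exact: HCi|exact: HDi].
Qed.

Lemma dirD_add f g b : ev_smooth f -> ev_smooth g ->
  ev_eq (fun i x => dirD b f i x + dirD b g i x) (dirD b (fun i x => f i x + g i x)).
Proof.
move=> Ef Eg r; apply: filterS2 (Ef r) (Eg r) => i sf sg x Bx.
by rewrite /dirD [RHS]deriveD//; [exact: smooth_drv sf Bx|exact: smooth_drv sg Bx].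
Qed.

Lemma dirD_mul f g b : ev_smooth f -> ev_smooth g ->
  ev_eq (fun i x => f i x * dirD b g i x + g i x * dirD b f i x) (dirD b (fun i x => f i x * g i x)).
Proof.
move=> Ef Eg r; apply: filterS2 (Ef r) (Eg r) => i sf sg x Bx.
by rewrite /dirD [RHS]deriveM//; [exact: smooth_drv sf Bx|exact: smooth_drv sg Bx].
Qed.

Lemma controlled_add k f g : ev_smooth f -> ev_smooth g -> controlled k T f -> controlled k T g ->
  controlled k T (fun i x => f i x + g i x).
Proof.
elim: k f g => [|k IH] f g Ef Eg.
  move=> Hf Hg r; have [C HC] := Hf r; have [D HD] := Hg r; exists (C + D).
  apply: filterS2 HC HD => i HCi HDi x Bx.
  apply: le_trans (ler_normD _ _) _; rewrite mulrDl.
  by apply: lerD; [exact: HCi|exact: HDi].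
move=> [Lf Df] [Lg Dg]; split; first exact: loc_bounded_add.
move=> b; apply: controlled_eq (dirD_add b Ef Eg) _.
by apply: IH; [exact: ev_smooth_D|exact: ev_smooth_D|exact: Df|exact: Dg].
Qed.

(** In the Leibniz formula each term has at most one factor with a top derivative,
and the other factors are bounded: the product stays linear in the gauge. *)
Lemma controlled_mul k f g : ev_smooth f -> ev_smooth g -> loc_bounded f -> controlled k T f -> controlled k T g ->
  controlled k T (fun i x => f i x * g i x).
Proof.
elim: k f g => [|k IH] f g Ef Eg Lf.
  move=> _ Hg r; have [C HC] := Lf r; have [D HD] := Hg r; exists (C * D).
  apply: filterS2 HC HD => i HCi HDi x Bx.
  rewrite normrM -mulrA; apply: ler_pM => //; [exact: HCi|exact: HDi].
move=> Hf Hg; have [_ Df] := Hf; have [Lg Dg] := Hg; split; first exact: loc_bounded_mul.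
move=> b; apply: controlled_eq (dirD_mul b Ef Eg) _.
have Ef' := ev_smooth_D b Ef; have Eg' := ev_smooth_D b Eg.
apply: controlled_add; [exact: ev_smooth_M|exact: ev_smooth_M| |].
  by apply: IH => //; [exact: controlledW|exact: Dg].
by apply: IH => //; [exact: controlledW|exact: Df].
Qed.

Lemma loc_bounded_cst (c : nat -> R) (C : R) : (\forall i \near \oo, `|c i| <= C) -> loc_bounded (fun i _ => c i).
Proof. by move=> H r; exists C; apply: filterS H => i H x _. Qed.

Lemma controlled_cst k (c : nat -> R) (C : R) : (\forall i \near \oo, `|c i| <= C) ->
  controlled k T (fun i _ => c i).
Proof.
elim: k c C => [|k IH] c C H; first by apply: loc_bounded_controlled0; exact: loc_bounded_cst H.
split; first exact: loc_bounded_cst H.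
move=> b; apply: (@controlled_eq _ _ (fun _ _ => 0)).
  by move=> r; near=> i => x _; rewrite /dirD derive_cst.
by apply: (IH (fun=> 0) 0); near=> i; rewrite normr0.
Unshelve. all: by end_near. Qed.

Lemma controlled_sum k (I : Type) (s : seq I) (f : I -> nat -> R * R -> R) :
  (forall j, ev_smooth (f j)) -> (forall j, controlled k T (f j)) ->
  controlled k T (fun i x => \sum_(j <- s) f j i x).
Proof.
move=> H Hc; elim: s => [|j s IH].
  apply: (@controlled_eq _ _ (fun _ _ => 0)).
    by move=> r; near=> i => x _; rewrite big_nil.
  by apply: (@controlled_cst _ (fun=> 0) 0); near=> i; rewrite normr0.
apply: (@controlled_eq _ _ (fun i x => f j i x + \sum_(j <- s) f j i x)).
  by move=> r; near=> i => x _; rewrite big_cons.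
by apply: controlled_add => //; exact: ev_smooth_sum.
Unshelve. all: by end_near. Qed.

Section Compose.
Variables (p : nat) (O : set 'rV[R]_p) (pinf : 'rV[R]_p) (Uv : nat -> R * R -> 'rV[R]_p).
Hypotheses (oO : open O) (Opinf : O pinf).
Hypothesis Uv_cvg : forall r e : R, 0 < e ->
  \forall i \near \oo, forall x, open_square r x -> `|Uv i x - pinf| < e.
Hypothesis UvES : forall l, ev_smooth (fun i x => Uv i x 0 l).

Lemma Uv_in (N : set 'rV[R]_p) : nbhs pinf N -> forall r : R,
  \forall i \near \oo, forall x, open_square r x -> N (Uv i x).
Proof.
move=> /nbhs_ballP[e /= e0 He] r; have := Uv_cvg r e0; apply: filterS => i H x Bx.
by apply: He; rewrite -ball_normE/= distrC; exact: H.
Qed.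

Lemma ev_smooth_comp (Th : 'rV[R]_p -> R) : smooth_on O Th -> ev_smooth (fun i x => Th (Uv i x)).
Proof.
move=> sT r; have HO := Uv_in (open_nbhs_nbhs (conj oO Opinf)) r.
have HS : \forall i \near \oo, forall l, smooth_on (open_square r) (fun x => Uv i x 0 l).
  by apply: filter_forall => l; exact: UvES.
apply: filterS2 HO HS => i Oi si.
apply: (@smooth_comp R _ _ (frame_pair (frame_R R) (frame_R R)) (frame_rV R p) (open_square r) O Th (Uv i)) => //.
exact: open_open_square.
Qed.

Lemma loc_bounded_comp (Th : 'rV[R]_p -> R) : smooth_on O Th -> loc_bounded (fun i x => Th (Uv i x)).
Proof.
move=> sT r; exists (`|Th pinf| + 1).
have cT : {for pinf, continuous Th} by exact: smooth_cont sT Opinf.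
have N : nbhs pinf [set y | `|Th pinf - Th y| <= 1].
  by move/cvgrPdist_le : cT => /(_ _ ltr01).
have := Uv_in N r; apply: filterS => i H x Bx.
have /= := H x Bx; rewrite distrC => H1.
rewrite -(subrK (Th pinf) (Th (Uv i x))) addrC.
by apply: le_trans (ler_normD _ _) _; rewrite lerD2l.
Qed.

(** The derivatives of Th are evaluated close to pinf, where they are bounded, so
that only the inner derivatives matter, and these enter as in a product. *)
Lemma controlled_comp k (Th : 'rV[R]_p -> R) : smooth_on O Th ->
  (forall l, controlled k T (fun i x => Uv i x 0 l)) -> controlled k T (fun i x => Th (Uv i x)).
Proof.
elim: k Th => [|k IH] Th sT HU; first by apply: loc_bounded_controlled0; exact: loc_bounded_comp.
split; first exact: loc_bounded_comp.
move=> b.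
apply: (@controlled_eq _ _ (fun i x => \sum_l 'D_(delta_mx 0 l) Th (Uv i x) * dirD b (fun i x => Uv i x 0 l) i x)).
  move=> r; have HO := Uv_in (open_nbhs_nbhs (conj oO Opinf)) r.
  have HS : \forall i \near \oo, forall l, smooth_on (open_square r) (fun x => Uv i x 0 l).
    by apply: filter_forall => l; exact: UvES.
  apply: filterS2 HO HS => i Oi si x Bx.
  have := @smooth_derive_comp R _ _ (frame_pair (frame_R R) (frame_R R)) (frame_rV R p)
    (open_square r) O Th (Uv i) x (dir b) (@open_open_square r) oO Bx (Oi _ Bx) sT si.
  by rewrite /dirD => ->; apply: eq_bigr => l _; rewrite mulrC.
have sD l : smooth_on O ('D_(delta_mx 0 l) Th) by exact: smooth_D.
apply: controlled_sum => l.
  by apply: ev_smooth_M; [exact: (ev_smooth_comp (sD l))|apply: ev_smooth_D; exact: UvES].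
apply: controlled_mul.
- exact: (ev_smooth_comp (sD l)).
- by apply: ev_smooth_D; exact: UvES.
- exact: (loc_bounded_comp (sD l)).
- by apply: (IH _ (sD l)) => j; exact: controlledW.
- exact: (controlled_D b (HU l)).
Qed.

End Compose.

End Families.

Section Words.
Variable R : realType.
Implicit Types (f : nat -> R * R -> R) (T : nat -> R * R -> R).

Fixpoint wordD (w : seq bool) (f : R * R -> R) : R * R -> R :=
  if w is b :: w' then wordD w' ('D_(@dir R b) f) else f.

Lemma wordD_rcons w c (f : R * R -> R) : wordD (rcons w c) f = 'D_(@dir R c) (wordD w f).
Proof. by elim: w f => //= b w IH f; rewrite IH. Qed.

Lemma wordD_smooth U w (f : R * R -> R) : smooth_on U f -> smooth_on U (wordD w f).
Proof.
elim: w f => [//|b w IH] f sf; apply: (IH ('D_(dir R b) f)); exact: smooth_D sf.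
Qed.

Lemma wordD_eq U w (f g : R * R -> R) x : open U -> (forall y, U y -> f y = g y) -> U x ->
  wordD w f x = wordD w g x.
Proof.
move=> oU; elim: w f g => [|b w IH] f g fg Ux /=; first exact: fg.
apply: IH => // y Uy.
exact: (@iterD_eq _ _ _ U f g [:: dir R b] y oU fg Uy).
Qed.

Lemma D2_comm U (f : R * R -> R) v w x : open U -> smooth_on U f -> U x ->
  'D_v ('D_v ('D_w f)) x = 'D_w ('D_v ('D_v f)) x.
Proof.
move=> oU sf Ux.
apply: etrans (@schwarz R _ U ('D_v f) x v w oU (smooth_D v sf) Ux).
apply: (@iterD_eq _ _ _ U ('D_v ('D_w f)) ('D_w ('D_v f)) [:: v] x oU _ Ux).
by move=> y Uy; exact: schwarz oU sf Uy.
Qed.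

Lemma lap_wordD U w (f : R * R -> R) x : open U -> smooth_on U f -> U x ->
  lap (wordD w f) x = wordD w (lap f) x.
Proof.
move=> oU; elim: w f => [//|b w IH] f sf Ux /=.
rewrite IH//; last exact: smooth_D.
apply: (wordD_eq w oU _ Ux) => y Uy.
apply: etrans (congr2 +%R (D2_comm (e1 R) (dir R b) oU sf Uy) (D2_comm (e2 R) (dir R b) oU sf Uy)) _.
have s1 : smooth_on U ('D_(e1 R) ('D_(e1 R) f)) by exact: smooth_D _ (smooth_D _ sf).
have s2 : smooth_on U ('D_(e2 R) ('D_(e2 R) f)) by exact: smooth_D _ (smooth_D _ sf).
exact: (esym (deriveD (smooth_drv (v := dir R b) s1 Uy) (smooth_drv (v := dir R b) s2 Uy))).
Qed.

Lemma controlledP k T f : controlled k T f <->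
  (forall w, (size w < k)%N -> loc_bounded (fun i => wordD w (f i))) /\
  (forall w, size w = k -> controlled0 T (fun i => wordD w (f i))).
Proof.
elim: k f => [|k IH] f /=.
  split=> [H|[_ /(_ [::] erefl)]//]; split=> // w /size0nil ->//.
split=> [[Lf Df]|[H1 H2]].
  split=> -[|b w]//= wk.
    by have [H _] := (IH _).1 (Df b); exact: (H w).
  by have [_ H] := (IH _).1 (Df b); apply: (H w); case: wk.
split; first exact: (H1 [::]).
move=> b; apply/IH; split=> w wk; first exact: (H1 (b :: w)).
by apply: (H2 (b :: w)); rewrite /= wk.
Qed.

Definition no_gauge : nat -> R * R -> R := fun _ _ => 0.

Lemma controlled_no_gauge_loc_bounded k f : controlled k no_gauge f -> loc_bounded f.
Proof. by case: k => [/controlled0_loc_bounded|k []]. Qed.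

Lemma controlled_no_gauge k T f : (forall i x, 0 <= T i x) -> controlled k no_gauge f -> controlled k T f.
Proof.
move=> Tge0; elim: k f => [|k IH] f; first by move=> /controlled0_loc_bounded; exact: loc_bounded_controlled0.
by move=> [Lf Df]; split=> // b; exact: (IH _ (Df b)).
Qed.

Lemma derive_e12 U (f : R * R -> R) v x : open U -> smooth_on U f -> U x ->
  'D_v f x = v.1 * 'D_(e1 R) f x + v.2 * 'D_(e2 R) f x.
Proof.
move=> oU sf Ux.
have df := smooth_diff (frame_pair (frame_R R) (frame_R R)) oU sf Ux.
have vE : v = v.1 *: e1 R + v.2 *: e2 R.
  by case: v => a b; congr (_, _); rewrite /= ?scaler0 ?addr0 ?add0r [_%:A]mulr1.
by rewrite !deriveE// [in LHS]vE linearD !linearZ.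
Qed.

Lemma finite_bound (J : finType) (Q : J -> R -> nat -> Prop) :
  (forall j C D i, C <= D -> Q j C i -> Q j D i) ->
  (forall j, exists C, \forall i \near \oo, Q j C i) ->
  exists2 C, 0 < C & \forall i \near \oo, forall j, Q j C i.
Proof.
move=> Qm H; pose C j := sval (cid (H j)).
exists (1 + \sum_j `|C j|); first by rewrite ltr_pwDl// sumr_ge0.
apply: filter_forall => j; have := svalP (cid (H j)); apply: filterS => i.
apply: Qm; rewrite -/(C j) (bigD1 j)//= addrCA; apply: le_trans (ler_norm _) _.
by rewrite lerDl addr_ge0// sumr_ge0.
Qed.

Lemma loc_bounded_iterD f vs : ev_smooth f -> (forall k, controlled k no_gauge f) -> loc_bounded (fun i => Defs.iterD vs (f i)).
Proof.
elim/last_ind: vs f => [|vs v IH] f Ef Hf; first exact: controlled_no_gauge_loc_bounded (Hf 0%N).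
have -> : (fun i => Defs.iterD (rcons vs v) (f i)) = (fun i => Defs.iterD vs ('D_v (f i))).
  by apply/funext => i; rewrite iterD_rcons.
have no_gauge_ge0 (i : nat) (x : R * R) : 0 <= no_gauge i x by [].
have Ev : ev_eq (fun i x => v.1 * dirD false f i x + v.2 * dirD true f i x) (fun i => 'D_v (f i)).
  move=> r; have := Ef r; apply: filterS => i sf x Bx.
  by rewrite (derive_e12 v (@open_open_square R r) sf Bx).
apply: (IH (fun i => 'D_v (f i))).
  by move=> r; have := Ef r; apply: filterS => i; exact: smooth_D.
move=> k; apply: controlled_eq Ev _.
have c1 (c : R) : \forall i \near \oo, `|(fun=> c) i| <= `|c| by near=> i.
have E b : ev_smooth (dirD b f) by exact: ev_smooth_D.
have L b : controlled k no_gauge (dirD b f) by exact: controlled_D (Hf k.+1).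
have E1 b (c : R) : ev_smooth (fun i x => c * dirD b f i x) by exact: (ev_smooth_M (ev_smooth_cst (fun=> c)) (E b)).
have M1 b (c : R) : controlled k no_gauge (fun i x => c * dirD b f i x).
  exact: (controlled_mul no_gauge_ge0 (ev_smooth_cst (fun=> c)) (E b) (loc_bounded_cst (c1 c)) (controlled_cst no_gauge_ge0 k (c1 c)) (L b)).
exact: (controlled_add (E1 false v.1) (E1 true v.2) (M1 false v.1) (M1 true v.2)).
Unshelve. all: by end_near. Qed.

End Words.

(** * Uniform bounds for all derivatives *)

Section Bootstrap.
Variables (R : realType) (p : nat) (O : set 'rV[R]_p) (pinf : 'rV[R]_p).
Variables (V : nat -> R * R -> 'rV[R]_p) (P : nat -> 'rV[R]_p) (eps : nat -> R).
Variable A : 'I_p -> 'I_p -> 'I_p -> 'rV[R]_p -> R.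
Notation e1 := (e1 R).
Notation e2 := (e2 R).
Notation no_gauge := (@no_gauge R).

Let Vc l (i : nat) (x : R * R) : R := V i x 0 l.
Let U i x := P i + eps i *: V i x.

Hypotheses (oO : open O) (Opinf : O pinf).
Hypothesis sA : forall l j m, smooth_on O (A l j m).
Hypothesis VES : forall l, ev_smooth (Vc l).
Hypothesis VLB : forall l, loc_bounded (Vc l).
Hypothesis eps0 : forall i, 0 <= eps i.
Hypothesis epsc : eps @ \oo --> (0 : R).
Hypothesis Pc : P @ \oo --> pinf.

Definition pde_rhs (l : 'I_p) (i : nat) (x : R * R) : R :=
  \sum_j \sum_m A l j m (U i x) *
    (dirD false (Vc j) i x * dirD false (Vc m) i x + dirD true (Vc j) i x * dirD true (Vc m) i x).

Hypothesis PDE : forall r : R, \forall i \near \oo, forall x, open_square r x -> forall l,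
  lap (Vc l i) x = eps i * pde_rhs l i x.

Lemma eps_le (e : R) : 0 < e -> \forall i \near \oo, eps i <= e.
Proof.
move=> e0; move/cvgrPdist_le : epsc => /(_ _ e0); apply: filterS => i.
by rewrite sub0r normrN ger0_norm.
Qed.

Lemma U_cvg (r e : R) : 0 < e ->
  \forall i \near \oo, forall x, open_square r x -> `|U i x - pinf| < e.
Proof.
move=> e0.
have [C C0 HC] : exists2 C : R, 0 < C & \forall i \near \oo, forall l, forall x, open_square r x -> `|Vc l i x| <= C.
  apply: (@finite_bound R _ (fun l C i => forall x, open_square r x -> `|Vc l i x| <= C)).
    by move=> j C D i CD H x Bx; apply: le_trans (H x Bx) CD.
  by move=> l; exact: VLB.
have e4 : 0 < e / 4 / C by rewrite !divr_gt0.
have e2 : 0 < e / 4 by rewrite divr_gt0.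
have P2 : \forall i \near \oo, `|pinf - P i| <= e / 4.
  by move/cvgrPdist_le : Pc; apply.
apply: filterS3 HC (eps_le e4) P2 => i HCi Hei HPi x Bx.
rewrite /U addrAC.
apply: le_lt_trans (ler_normD _ _) _; rewrite distrC normrZ (ger0_norm (eps0 i)).
have V_le : `|V i x| <= C.
  by apply: rV_norm_le => [|l]; [exact: ltW|exact: HCi].
have h : eps i * `|V i x| <= e / 4.
  apply: le_trans (ler_pM (eps0 i) (normr_ge0 _) Hei V_le) _.
  by rewrite divfK// gt_eqF.
by move: HPi h e0; move: (`|_|) (eps i * _) => a b; lra.
Qed.

Lemma U_ev_smooth l : ev_smooth (fun i x => U i x 0 l).
Proof.
have := ev_smooth_Add (ev_smooth_cst (fun i => P i 0 l)) (ev_smooth_M (ev_smooth_cst eps) (VES l)).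
move=> H r; have := H r; apply: filterS => i.
apply: smooth_eq; first exact: open_open_square.
by move=> x _; rewrite /U !mxE.
Qed.

Lemma eps_loc_bounded : \forall i \near \oo, `|eps i| <= 1.
Proof. by have := eps_le ltr01; apply: filterS => i; rewrite ger0_norm. Qed.

Lemma U_controlled k T : (forall i x, 0 <= T i x) -> (forall l, controlled k T (Vc l)) ->
  forall l, controlled k T (fun i x => U i x 0 l).
Proof.
move=> T_ge0 HV l.
have E : ev_eq (fun i x => P i 0 l + eps i * Vc l i x) (fun i x => U i x 0 l).
  by move=> r; near=> i => x _; rewrite /U !mxE.
apply: controlled_eq E _; apply: controlled_add.
- exact: (ev_smooth_cst (fun i => P i 0 l)).
- exact: (ev_smooth_M (ev_smooth_cst eps) (VES l)).
- apply: (@controlled_cst _ _ T_ge0 _ (fun i => P i 0 l) (`|pinf| + 1)).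
  have P2 : \forall i \near \oo, `|pinf - P i| <= 1 by move/cvgrPdist_le : Pc; apply.
  apply: filterS P2 => i Pi; apply: le_trans (mx_coord_le _ _ _) _.
  rewrite -(subrK pinf (P i)) addrC.
  by apply: le_trans (ler_normD _ _) _; rewrite lerD2l distrC.
- exact: (controlled_mul T_ge0 (ev_smooth_cst eps) (VES l) (loc_bounded_cst eps_loc_bounded) (controlled_cst T_ge0 k eps_loc_bounded) (HV l)).
Unshelve. all: by end_near. Qed.

Lemma gradient_bounded (J : finType) (W : nat -> J -> R * R -> R) (ep : nat -> R) :
  (forall j, ev_smooth (fun i => W i j)) -> (forall j, loc_bounded (fun i => W i j)) ->
  (forall i, 0 <= ep i) -> ep @ \oo --> (0 : R) ->
  (forall j (r : R), exists C, \forall i \near \oo, forall x, open_square r x ->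
     `|lap (W i j) x| <= C * (1 + grad_sum (W i) x + ep i * grad_sum (W i) x ^+ 2)) ->
  loc_bounded (fun i => grad_sum (W i)).
Proof.
move=> WES WLB ep0 epc WL r.
have [M M0 HM] : exists2 C : R, 0 < C & \forall i \near \oo, forall j, forall x, open_square (r + 2) x -> `|W i j x| <= C.
  apply: (@finite_bound R _ (fun l C i => forall x, open_square (r + 2) x -> `|W i l x| <= C)).
    by move=> j C D i CD H x Bx; apply: le_trans (H x Bx) CD.
  by move=> l; exact: WLB.
have [B B0 HB] : exists2 C : R, 0 < C & \forall i \near \oo, forall j, forall x, open_square (r + 2) x ->
    `|lap (W i j) x| <= C * (1 + grad_sum (W i) x + ep i * grad_sum (W i) x ^+ 2).
  apply: (@finite_bound R _ (fun j C i => forall x, open_square (r + 2) x ->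
    `|lap (W i j) x| <= C * (1 + grad_sum (W i) x + ep i * grad_sum (W i) x ^+ 2))).
    move=> j C D i CD H x Bx; apply: le_trans (H x Bx) _; rewrite ler_wpM2r//.
    by rewrite !addr_ge0 ?grad_sum_ge0// mulr_ge0// sqr_ge0.
  by move=> l; exact: WL.
have [ee [C [ee0 HG]]] := @small_quadratic_gradient R J M B (ltW M0) B0.
exists C.
have HE : \forall i \near \oo, ep i <= ee.
  move/cvgrPdist_le : epc => /(_ _ ee0); apply: filterS => i.
  by rewrite sub0r normrN ger0_norm.
have HS : \forall i \near \oo, forall j, smooth_on (open_square (r + 2)) (W i j).
  by apply: filter_forall => j; exact: WES.
near=> i => x Bx.
have sB : square x 1 `<=` open_square (r + 2).
  move=> y; rewrite /square /open_square/= => xy; rewrite -(subrK x y).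
  apply: le_lt_trans (ler_normD _ _) _; move: xy Bx; rewrite /open_square/=.
  by move: (`|y - x|) (`|x|) => a b; lra.
rewrite ger0_norm ?grad_sum_ge0//.
apply: (HG (open_square (r + 2)) (W i) x (ep i)) => //.
- exact: open_open_square.
- by near: i.
- by rewrite ep0/=; near: i.
- by move=> j y /sB By; apply: (near HM i _).
- by move=> j y /sB By; apply: (near HB i _).
Unshelve. all: by end_near. Qed.

Lemma dirD_le_grad_sum (J : finType) (W : J -> R * R -> R) j b x : `|'D_(dir R b) (W j) x| <= grad_sum W x.
Proof.
rewrite /grad_sum (bigD1 j)//=.
have h : `|'D_(dir R b) (W j) x| <= `|'D_e1 (W j) x| + `|'D_e2 (W j) x|.
  have [d1 d2] := (normr_ge0 ('D_e1 (W j) x), normr_ge0 ('D_e2 (W j) x)).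
  by case: b; [rewrite -[leLHS]add0r lerD2r|rewrite -[leLHS]addr0 lerD2l].
by apply: le_trans h _; rewrite lerDl sumr_ge0// => k _; rewrite addr_ge0.
Qed.

Lemma no_gauge_ge0 (i : nat) (x : R * R) : 0 <= no_gauge i x. Proof. by []. Qed.

Lemma A_loc_bounded l j m : loc_bounded (fun i x => A l j m (U i x)).
Proof. exact: (loc_bounded_comp Opinf U_cvg (sA l j m)). Qed.

Lemma A_ev_smooth l j m : ev_smooth (fun i x => A l j m (U i x)).
Proof. exact: (ev_smooth_comp oO Opinf U_cvg U_ev_smooth (sA l j m)). Qed.

(** The right-hand side is eps times a quadratic expression in the gradient, with
bounded coefficients. *)
Lemma bootstrap_start l : controlled 1 no_gauge (Vc l).
Proof.
have HT : loc_bounded (fun i => grad_sum (fun l => Vc l i)).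
  apply: (@gradient_bounded _ (fun i l => Vc l i) eps) => // {}l r.
  have [C C0 HC] : exists2 C : R, 0 < C & \forall i \near \oo, forall jm : 'I_p * 'I_p,
      forall x, open_square r x -> `|A l jm.1 jm.2 (U i x)| <= C.
    apply: (@finite_bound R _ (fun jm C i => forall x, open_square r x -> `|A l jm.1 jm.2 (U i x)| <= C)).
      by move=> j C D i CD H x Bx; apply: le_trans (H x Bx) CD.
    by move=> [j m]; exact: A_loc_bounded.
  exists (\sum_(j < p) \sum_(m < p) C * 2).
  apply: filterS2 HC (PDE r) => i HCi Hi x Bx.
  rewrite Hi// normrM (ger0_norm (eps0 i)).
  set T := grad_sum _ x; have T_ge0 : 0 <= T by exact: grad_sum_ge0.
  have S0 : 0 <= \sum_(j < p) \sum_(m < p) C * 2.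
    by do 2 (apply: sumr_ge0 => ? _); rewrite mulr_ge0// ltW.
  apply: (@le_trans _ _ ((\sum_(j < p) \sum_(m < p) C * 2) * (eps i * T ^+ 2))); last first.
    by rewrite ler_wpM2l// lerDr addr_ge0.
  rewrite [leRHS]mulrCA ler_wpM2l// /pde_rhs.
  rewrite mulr_suml; apply: le_trans (ler_norm_sum _ _ _) _; apply: ler_sum => j _.
  rewrite mulr_suml; apply: le_trans (ler_norm_sum _ _ _) _; apply: ler_sum => m _.
  rewrite normrM -mulrA; apply: ler_pM => //; first exact: (HCi (j, m)).
  apply: le_trans (ler_normD _ _) _; rewrite !normrM mulr_natl mulr2n expr2.
  by apply: lerD; apply: ler_pM => //; exact: (dirD_le_grad_sum (fun l => Vc l i)).
split; first exact: VLB.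
move=> b; apply/controlled0_loc_bounded => r; have [C HC] := HT r; exists C.
apply: filterS HC => i HC x Bx; apply: le_trans (HC x Bx).
by rewrite (ger0_norm (grad_sum_ge0 _ _)); exact: (dirD_le_grad_sum (fun l => Vc l i)).
Qed.

(** The derivatives W of order k + 1 are bounded and their Laplacians are the same
derivatives of the right-hand side. Derivatives of order k + 2 occur in them at
most linearly, so that the Laplacians are controlled by the gradient of W. *)
Lemma bootstrap_step k : (forall l, controlled k.+1 no_gauge (Vc l)) -> forall l, controlled k.+2 no_gauge (Vc l).
Proof.
move=> H.
pose J := ('I_p * k.+1.-tuple bool)%type.
pose W (i : nat) (j : J) := wordD j.2 (Vc j.1 i).
(* The gauge contains every derivative of order k + 2. *)
pose T i := grad_sum (W i).
have Tge0 i x : 0 <= T i x by exact: grad_sum_ge0.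
have VT l : controlled k.+1 T (Vc l) by exact: controlled_no_gauge.
have DLB b l : loc_bounded (dirD b (Vc l)) by have [_ D] := H l; exact: controlled_no_gauge_loc_bounded (D b).
have DT b l : controlled k.+1 T (dirD b (Vc l)).
  apply/controlledP; split=> w wk.
    by have [_ Hw] := (controlledP _ _ _).1 (controlled_D b (H l)); have [Hs _] := (controlledP _ _ _).1 (H l);
       have := wk; rewrite ltnS leq_eqVlt => /orP[/eqP wk'|wk']; [apply/controlled0_loc_bounded; exact: Hw|exact: (Hs (b :: w))].
  have [c [w' [bw wE]]] : exists c (w' : k.+1.-tuple bool), b :: w = rcons w' c /\ True.
    move: wk; case/lastP: w => [//|w c]; rewrite size_rcons => -[wk].
    have sw : size (b :: w) == k.+1 by rewrite /= wk.
    by exists c, (Tuple sw).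
  move=> r; exists 1; near=> i => x _.
  have -> : wordD w (dirD b (Vc l) i) = 'D_(dir R c) (W i (l, w')).
    by rewrite /W/= -wordD_rcons -bw.
  by rewrite mul1r; apply: le_trans (dirD_le_grad_sum _ _ _ _) _; rewrite lerDr.
have DES b l : ev_smooth (dirD b (Vc l)) by exact: ev_smooth_D.
pose q l j m i x := A l j m (U i x) *
  (dirD false (Vc j) i x * dirD false (Vc m) i x + dirD true (Vc j) i x * dirD true (Vc m) i x).
have bES b j m : ev_smooth (fun i x => dirD b (Vc j) i x * dirD b (Vc m) i x).
  exact: (ev_smooth_M (DES b j) (DES b m)).
have bT b j m : controlled k.+1 T (fun i x => dirD b (Vc j) i x * dirD b (Vc m) i x).
  exact: (controlled_mul Tge0 (DES b j) (DES b m) (DLB b j) (DT b j) (DT b m)).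
have qES l j m : ev_smooth (q l j m).
  exact: (ev_smooth_M (A_ev_smooth l j m) (ev_smooth_Add (bES false j m) (bES true j m))).
have AT l j m : controlled k.+1 T (fun i x => A l j m (U i x)).
  exact: (controlled_comp Tge0 oO Opinf U_cvg U_ev_smooth (sA l j m) (U_controlled Tge0 VT)).
have qT l j m : controlled k.+1 T (q l j m).
  apply: (controlled_mul Tge0 (A_ev_smooth l j m) (ev_smooth_Add (bES false j m) (bES true j m)) (A_loc_bounded l j m) (AT l j m)).
  exact: (controlled_add (bES false j m) (bES true j m) (bT false j m) (bT true j m)).
have GES l : ev_smooth (pde_rhs l).
  apply: (@ev_smooth_sum R _ (index_enum _) (fun j i x => \sum_m q l j m i x)) => j.
  exact (@ev_smooth_sum R _ (index_enum _) (q l j) (qES l j)).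
have GT l : controlled k.+1 T (pde_rhs l).
  apply: (@controlled_sum R T Tge0 k.+1 _ (index_enum _) (fun j i x => \sum_m q l j m i x)) => j.
    exact (@ev_smooth_sum R _ (index_enum _) (q l j) (qES l j)).
  exact (@controlled_sum R T Tge0 k.+1 _ (index_enum _) (q l j) (qES l j) (qT l j)).
have eGT l : controlled k.+1 T (fun i x => eps i * pde_rhs l i x).
  exact: (controlled_mul Tge0 (ev_smooth_cst eps) (GES l) (loc_bounded_cst eps_loc_bounded) (controlled_cst Tge0 _ eps_loc_bounded) (GT l)).
have WLB : forall j : J, loc_bounded (fun i => W i j).
  move=> [l w]; have [_ Hw] := (controlledP _ _ _).1 (H l).
  by apply/controlled0_loc_bounded; apply: Hw; rewrite size_tuple.
have HT : loc_bounded T.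
  apply: (@gradient_bounded J W (fun=> 0)) => //.
  - by move=> [l w] r; have := VES l r; apply: filterS => i; exact: wordD_smooth.
  - exact: cvg_cst.
  move=> [l w] r; have [_ /(_ w (size_tuple w) r)[C HC]] := (controlledP _ _ _).1 (eGT l).
  exists C; apply: filterS3 HC (PDE r) (VES l r) => i HCi Pi si x Bx.
  rewrite mul0r addr0 /W/= (lap_wordD _ (@open_open_square R r) si Bx).
  rewrite (wordD_eq w (@open_open_square R r) (fun y By => Pi y By l) Bx).
  exact: HCi.
move=> l; apply/controlledP; have [Hs Hw] := (controlledP _ _ _).1 (H l); split=> w wk.
  have := wk; rewrite ltnS leq_eqVlt => /orP[/eqP wk'|wk'].
    by apply/controlled0_loc_bounded; exact: Hw.
  exact: Hs.
move: wk; case/lastP: w => [//|w c]; rewrite size_rcons => -[/eqP wk].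
apply/controlled0_loc_bounded => r; have [C HC] := HT r; exists C.
apply: filterS HC => i HC x Bx; apply: le_trans (HC x Bx).
rewrite (ger0_norm (Tge0 _ _)) wordD_rcons.
exact: (@dirD_le_grad_sum J (W i) (l, Tuple wk)).
Unshelve. all: by end_near. Qed.

Theorem all_derivatives_bounded l vs : loc_bounded (fun i => Defs.iterD vs (Vc l i)).
Proof.
have H k : forall l, controlled k.+1 no_gauge (Vc l).
  by elim: k => [|k IH]; [exact: bootstrap_start|exact: bootstrap_step].
apply: loc_bounded_iterD; first exact: VES.
by move=> k; apply: controlledW; [exact: no_gauge_ge0|exact: H].
Qed.

End Bootstrap.

(** * Interpolation of derivatives *)

Section Interp.
Variable R : realType.

(** Some derivative on the segment is a difference quotient, and the bound on the
second derivative moves it to the end point. *)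
Lemma derive_interp (U : set (R * R)) (g : R * R -> R) x v (h C d : R) :
  smooth_on U g -> 0 < h ->
  (forall t, 0 <= t <= h -> U (x + t *: v) /\ `|'D_v ('D_v g) (x + t *: v)| <= C) ->
  `|g (x + h *: v)| <= d -> `|g x| <= d ->
  `|'D_v g x| <= 2 * d / h + h * C.
Proof.
move=> sg h0 HU gd1 gd2.
have [|t /andP[t0 th] E1] := @MVT_line R _ g x v h h0.
  by move=> t /HU[Ut _]; exact: smooth_drv sg Ut.
have [|s /andP[s0 st] E2] := @MVT_line R _ ('D_v g) x v t t0.
  move=> s /andP[s0 st]; have [|Us _] := HU s; first by rewrite s0 (le_trans st)// ltW.
  by apply: smooth_drv Us; exact: smooth_D.
have [|_ Hs] := HU s; first by rewrite (ltW s0) (le_trans (ltW st))// ltW.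
have C0 : 0 <= C by apply: le_trans Hs.
have B1 : `|'D_v g (x + t *: v)| <= 2 * d / h.
  have E1' : 'D_v g (x + t *: v) = (g (x + h *: v) - g x) / h.
    by rewrite E1 mulrC mulKf// gt_eqF.
  rewrite E1' normrM normfV (gtr0_norm h0) ler_pM2r ?invr_gt0//.
  by apply: le_trans (ler_normB _ _) _; rewrite mulr_natl mulr2n lerD.
have B2 : `|'D_v g (x + t *: v) - 'D_v g x| <= h * C.
  by rewrite E2 normrM (gtr0_norm t0); apply: ler_pM => //; rewrite ltW.
rewrite -(subKr ('D_v g (x + t *: v)) ('D_v g x)).
by apply: le_trans (ler_normB _ _) _; exact: lerD.
Qed.

(** Interpolation between the order below, which tends to 0, and the order above,
which is bounded; the step is chosen in terms of that bound. *)
Lemma cvg_all_derivatives (f : nat -> R * R -> R) : ev_smooth f ->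
  (forall vs, loc_bounded (fun i => Defs.iterD vs (f i))) ->
  (forall r e : R, 0 < e -> \forall i \near \oo, forall x, open_square r x -> `|f i x| <= e) ->
  forall vs (r e : R), 0 < e ->
   \forall i \near \oo, forall x, open_square r x -> `|Defs.iterD vs (f i) x| <= e.
Proof.
move=> Ef Lf Cf; elim=> [|v vs IH] r e e0; first exact: Cf.
have [C HC] := Lf [:: v, v & vs] (r + 1).
pose C1 := `|C| + 1.
have C10 : 0 < C1 by rewrite ltr_wpDl.
have v10 : 0 < `|v| + 1 by rewrite ltr_wpDl.
(* The step is at most e / (2 C1), and short enough not to leave the larger square. *)
pose h := Num.min (e / 2 / C1) (1 / (`|v| + 1)).
have h0 : 0 < h by rewrite lt_min !divr_gt0.
have hC : h * C1 <= e / 2 by rewrite -ler_pdivlMr// ge_min lexx.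
have hv : h * `|v| < 1.
  have : h * (`|v| + 1) <= 1 by rewrite -ler_pdivlMr// ge_min lexx orbT.
  by apply: lt_le_trans; rewrite ltr_pM2l// ltrDl.
pose d := e * h / 4.
have d0 : 0 < d by rewrite divr_gt0// mulr_gt0.
apply: filterS3 HC (IH (r + 1) d d0) (Ef (r + 1)) => i HCi Hi si x Bx.
have sg : smooth_on (open_square (r + 1)) (Defs.iterD vs (f i)).
  move=> ws; have := si (ws ++ vs).
  suff -> : Defs.iterD (ws ++ vs) (f i) = Defs.iterD ws (Defs.iterD vs (f i)) by [].
  by elim: ws => //= w ws ->.
have B t : 0 <= t <= h -> open_square (r + 1) (x + t *: v).
  move=> /andP[t0 th]; apply: le_lt_trans (ler_normD _ _) _.
  rewrite normrZ (ger0_norm t0); apply: ltrD => //.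
  by apply: le_lt_trans hv; rewrite ler_wpM2r.
have BU t : 0 <= t <= h -> open_square (r + 1) (x + t *: v) /\
    `|'D_v ('D_v (Defs.iterD vs (f i))) (x + t *: v)| <= C1.
  move=> th; split; first exact: B.
  apply: le_trans (HCi _ (B _ th)) _; apply: le_trans (ler_norm _) _; by rewrite lerDl.
have hh : 0 <= h <= h by rewrite lexx ltW.
have h00 : 0 <= (0 : R) <= h by rewrite lexx ltW.
have g1 := Hi _ (B _ hh).
have g2 : `|Defs.iterD vs (f i) x| <= d by have := Hi _ (B _ h00); rewrite scale0r addr0.
have := derive_interp sg h0 BU g1 g2 => /= H; apply: le_trans H _.
apply: le_trans (lerD (lexx _) hC) _.
have -> : 2 * d / h = e / 2 by rewrite /d; field; rewrite gt_eqF.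
by rewrite -mulrDl -mulr2n -[e *+ 2]mulr_natr mulfK.
Qed.

End Interp.

(** * Integration over squares *)

Section PlaneIntegral.
Variable R : realType.
Notation mu := (@lebesgue_measure R \x @lebesgue_measure R)%E.
Implicit Types (f : R * R -> R).

Lemma measurable_square (c : R * R) (r : R) : measurable (square c r).
Proof.
have -> : square c r = `[c.1 - r, c.1 + r] `*` `[c.2 - r, c.2 + r].
  apply/seteqP; split=> y; rewrite /= ?in_itv/=.
    by move=> /squareE; rewrite !ler_distl => -[-> ->].
  by move=> [h1 h2]; apply/squareE; rewrite !ler_distl.
by apply: measurableX; exact: measurable_itv.
Qed.

Lemma mu_square_lty (c : R * R) (r : R) : (mu (square c r) < +oo)%E.
Proof.
have -> : square c r = `[c.1 - r, c.1 + r] `*` `[c.2 - r, c.2 + r].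
  apply/seteqP; split=> y; rewrite /= ?in_itv/=.
    by move=> /squareE; rewrite !ler_distl => -[-> ->].
  by move=> [h1 h2]; apply/squareE; rewrite !ler_distl.
rewrite product_measure1E//=; apply: lte_mul_pinfty => //.
  by rewrite ge0_fin_numE// lebesgue_measure_itv/= lte_fin; case: ifP => // _; rewrite -EFinB ltry.
by rewrite lebesgue_measure_itv/= lte_fin; case: ifP => // _; rewrite -EFinB ltry.
Qed.

Lemma mu_square_gt0 (c : R * R) (s : R) : 0 < s -> (0 < mu (square c s))%E.
Proof.
move=> s0; have -> : square c s = `[c.1 - s, c.1 + s] `*` `[c.2 - s, c.2 + s].
  apply/seteqP; split=> y; rewrite /= ?in_itv/=.
    by move=> /squareE; rewrite !ler_distl => -[-> ->].
  by move=> [h1 h2]; apply/squareE; rewrite !ler_distl.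
have h a : a - s < a + s by rewrite ltrBlDr -addrA ltrDl addr_gt0.
rewrite product_measure1E//= mule_gt0// lebesgue_measure_itv/= lte_fin h -EFinB lte_fin.
  by rewrite subr_gt0.
by rewrite subr_gt0.
Qed.

(** A planar open set is a countable union of rational squares. *)
Lemma open_measurable2 (G : set (R * R)) : open G -> measurable G.
Proof.
move=> oG.
pose box (q : rat * rat * rat) : set (R * R) :=
  `]ratr q.1.1 - ratr q.2, ratr q.1.1 + ratr q.2[ `*` `]ratr q.1.2 - ratr q.2, ratr q.1.2 + ratr q.2[.
have -> : G = \bigcup_(q in [set q | box q `<=` G]) box q.
  apply/seteqP; split=> [z Gz|z [q /= qG qz]]; last exact: qG.
  have /nbhs_ballP[e /= e0 He] : nbhs z G by exact: open_nbhs_nbhs.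
  have [s] := @rat_in_itvoo R 0 (e / 2) (divr_gt0 e0 (ltr0Sn _ 1)).
  rewrite in_itv/= => /andP[s0 se].
  have lt_s (t : R) : t - ratr s < t + ratr s by lra.
  have [a] := @rat_in_itvoo R _ _ (lt_s z.1).
  rewrite in_itv/= => /andP[a1 a2].
  have [b] := @rat_in_itvoo R _ _ (lt_s z.2).
  rewrite in_itv/= => /andP[b1 b2].
  exists (a, b, s); last by split; rewrite /= in_itv/=; apply/andP; split; lra.
  move=> w [/=]; rewrite !in_itv/= => /andP[w1 w2] /andP[w3 w4].
  apply: He; rewrite -ball_normE/= prod_normE/= gt_max; apply/andP.
  by split; rewrite ltr_norml; apply/andP; split; lra.
rewrite bigcup_mkcond; apply: countable_bigcupT_measurable => [|q].
  exact: countableP.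
by case: ifP => // _; apply: measurableX; exact: measurable_itv.
Qed.

Lemma continuous_integrable_square (f : R * R -> R) c r : 0 <= r ->
  (forall x, square c r x -> {for x, continuous f}) ->
  mu.-integrable (square c r) (EFin \o f).
Proof.
move=> r0 cf; apply: measurable_bounded_integrable.
- exact: measurable_square.
- exact: mu_square_lty.
- apply: (measurability _ (measurable_realfun.RGenOpens.measurableE R)).
  move=> _ [_ [a [b ->] <-]].
  have -> : square c r `&` f @^-1` `]a, b[ = square c r `&` (f @^-1` `]a, b[)^°.
    apply/seteqP; split=> x [Qx fx]; split=> //; last exact: (@interior_subset _ (f @^-1` `]a, b[)).
    by apply: (cf _ Qx); apply: open_nbhs_nbhs; split=> //; exact: interval_open.
  by apply: measurableI; [exact: measurable_square|apply: open_measurable2; exact: open_interior].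
- have [M _ HM] := EVT_square r0 cf.
  have cfN x : square c r x -> {for x, continuous (fun y => - f y)} by move=> Qx; apply: cvgN; exact: cf.
  have [m _ Hm] := EVT_square r0 cfN.
  exists (`|f M| + `|f m|); split; first exact: num_real.
  move=> B HB x Qx /=; apply: le_trans (ltW HB).
  rewrite ler_norml; apply/andP; split.
    rewrite lerNl; apply: le_trans (Hm _ Qx) _; apply: le_trans (ler_norm _) _.
    by rewrite normrN lerDr.
  apply: le_trans (HM _ Qx) _; apply: le_trans (ler_norm _) _.
  by rewrite lerDl.
Qed.

Lemma integral_pos_square (f : R * R -> R) c r : 0 < r ->
  (forall x, square c r x -> {for x, continuous f}) ->
  (forall x, square c r x -> 0 <= f x) -> 0 < f c ->
  (0 < \int[mu]_(x in square c r) (f x)%:E)%E.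
Proof.
move=> r0 cf f0 fc.
have Qc : square c r c by apply: square_center; exact: ltW.
have fc2 : 0 < f c / 2 by rewrite divr_gt0.
have /nbhs_ballP[d /= d0 Hd] : nbhs c [set x | `|f c - f x| <= f c / 2].
  by move/cvgrPdist_le : (cf _ Qc) => /(_ _ fc2).
pose s := Num.min r (d / 2).
have s0 : 0 < s by rewrite lt_min r0 divr_gt0.
have sQ : square c s `<=` square c r.
  by move=> x; rewrite /square/= => /le_trans; apply; rewrite ge_min lexx.
have /measurable_int mf := continuous_integrable_square (ltW r0) cf.
apply: (@lt_le_trans _ _ (\int[mu]_(x in square c s) (f x)%:E)%E); last first.
  by apply: ge0_subset_integral => //; exact: measurable_square.
apply: (@lt_le_trans _ _ (\int[mu]_(x in square c s) (f c / 2)%:E)%E); last first.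
  apply: ge0_le_integral => //.
  - exact: measurable_square.
  - by move=> x _; rewrite lee_fin ltW.
  - exact: (measurable_funS (@measurable_square _ _) sQ mf).
  - move=> x Qx; rewrite lee_fin.
    have /Hd/= : ball c d x.
      rewrite -ball_normE/= distrC; apply: le_lt_trans Qx _.
      by rewrite /s gt_min; apply/orP; right; rewrite ltr_pdivrMr// ltr_pMr// ltr1n.
    by rewrite ler_norml => /andP[_]; lra.
rewrite integral_cst; last exact: measurable_square.
rewrite mule_gt0// ?lte_fin//.
exact: mu_square_gt0.
Qed.

Lemma line_e1 (x y : R) : ((0, y) : R * R) + x *: e1 R = (x, y).
Proof. by congr (_, _); rewrite /= ?add0r ?scaler0 ?addr0// [_%:A]mulr1. Qed.

Lemma line_e2 (x y : R) : ((x, 0) : R * R) + y *: e2 R = (x, y).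
Proof. by congr (_, _); rewrite /= ?add0r ?scaler0 ?addr0// [_%:A]mulr1. Qed.

Lemma FTC_vanish (F f : R -> R) (a b : R) : a < b ->
  (forall x, x \in `[a, b] -> is_derive x (1 : R) F (f x)) ->
  (forall x, x \in `[a, b] -> {for x, continuous f}) ->
  F a = 0 -> F b = 0 ->
  (\int[@lebesgue_measure R]_(x in `[a, b]) (f x)%:E = 0)%E.
Proof.
move=> ab dF cf Fa Fb.
have cF x : x \in `[a, b] -> {for x, continuous F}.
  by move=> /dF[d _]; apply/differentiable_continuous/derivable1_diffP.
rewrite (@continuous_FTC2 _ f F a b ab).
- by rewrite Fa Fb subee.
- by apply: continuous_in_subspaceT => x; rewrite inE => xab; exact: cf.
- split.
  + by move=> x xab; have [] := dF x (subset_itvW _ _ (lexx a) (lexx b) xab).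
  + by apply: cvg_at_right_filter; apply: cF; rewrite in_itv/= lexx ltW.
  + by apply: cvg_at_left_filter; apply: cF; rewrite in_itv/= lexx ltW.
- by move=> x xab; rewrite derive1E; have [_ ->] := dF x (subset_itvW _ _ (lexx a) (lexx b) xab).
Qed.

(** Integrate first along the direction of the derivative. *)
Lemma integral_D_square (U : set (R * R)) (Y : R * R -> R) c r b : open U -> smooth_on U Y ->
  0 < r -> square c r `<=` U ->
  (forall z, square c r z -> `|z - c| = r -> Y z = 0) ->
  (\int[mu]_(x in square c r) ('D_(dir R b) Y x)%:E = 0)%E.
Proof.
move=> oU sY r0 sU Y0.
have cD x : square c r x -> {for x, continuous ('D_(dir R b) Y)}.
  by move=> /sU Ux; apply: smooth_cont Ux; exact: smooth_D.
have intD := continuous_integrable_square (ltW r0) cD.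
have lr (a : R) : a - r < a + r by lra.
have nm (a : R) : `|a - r - a| = r by rewrite addrAC subrr sub0r normrN gtr0_norm.
have np (a : R) : `|a + r - a| = r by rewrite addrAC subrr add0r gtr0_norm.
rewrite integral_mkcond.
have int' : mu.-integrable setT ((EFin \o 'D_(dir R b) Y) \_ (square c r)).
  by apply/integrable_restrict => //; [exact: measurable_square|rewrite setTI].
case: b cD intD int' => cD intD int'.
- rewrite -(integral12_prod_meas1 int'); apply: integral0_eq => x _.
  rewrite /=.
  have [xc|xc] := pselect (`|x - c.1| <= r); last first.
    apply: integral0_eq => y _; rewrite patchE; case: ifPn => //; rewrite inE => /squareE[/= h _].
    by case: xc.
  transitivity (\int[@lebesgue_measure R]_(y in `[(c.2 - r)%R, (c.2 + r)%R]) ('D_(e2 R) Y (x, y))%:E)%E.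
    rewrite [RHS]integral_mkcond; apply: eq_integral => y _; rewrite !patchE.
    have -> : ((x, y) \in square c r) = (y \in `[(c.2 - r)%R, (c.2 + r)%R]%classic).
      apply/idP/idP; rewrite !inE/= in_itv/= -ler_distl; first by move=> /squareE[].
      by move=> yc; apply/squareE.
    by [].
  apply: (@FTC_vanish (fun y => Y (x, y))) => //.
  + move=> y; rewrite in_itv/= -ler_distl => yc.
    have Q : square c r (x, y) by apply/squareE.
    have := @is_derive_line R _ _ Y (x, 0) (e2 R) y; rewrite line_e2.
    have -> : (fun s : R => Y ((x, 0) + s *: e2 R)) = (fun y => Y (x, y)).
      by apply/funext => s; rewrite line_e2.
    by apply; exact: smooth_drv sY (sU _ Q).
  + move=> y; rewrite in_itv/= -ler_distl => yc.
    have Q : square c r (x, y) by apply/squareE.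
    apply: (@continuous_comp _ _ _ (fun y => (x, y)) ('D_(e2 R) Y)); last exact: cD.
    suff : (fun z : R => (x, z)) z0 @[z0 --> y] --> (x, y) by [].
    exact: (@cvg_pair _ _ _ (nbhs (y : R)) (nbhs (x : R)) (nbhs (y : R)) _ _ _ (fun=> x) id (cvg_cst x) cvg_id).
  + have Q : square c r (x, c.2 - r) by apply/squareE; rewrite /= nm.
    apply: Y0 => //; apply/eqP; rewrite eq_le Q/= prod_normE/= le_max; apply/orP; right.
    by rewrite nm.
  + have Q : square c r (x, c.2 + r) by apply/squareE; rewrite /= np.
    apply: Y0 => //; apply/eqP; rewrite eq_le Q/= prod_normE/= le_max; apply/orP; right.
    by rewrite np.
- rewrite -(integral21_prod_meas1 int'); apply: integral0_eq => y _.
  rewrite /=.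
  have [yc|yc] := pselect (`|y - c.2| <= r); last first.
    apply: integral0_eq => x _; rewrite patchE; case: ifPn => //; rewrite inE => /squareE[/= _ h].
    by case: yc.
  transitivity (\int[@lebesgue_measure R]_(x in `[(c.1 - r)%R, (c.1 + r)%R]) ('D_(e1 R) Y (x, y))%:E)%E.
    rewrite [RHS]integral_mkcond; apply: eq_integral => x _; rewrite !patchE.
    have -> : ((x, y) \in square c r) = (x \in `[(c.1 - r)%R, (c.1 + r)%R]%classic).
      apply/idP/idP; rewrite !inE/= in_itv/= -ler_distl; first by move=> /squareE[].
      by move=> xc; apply/squareE.
    by [].
  apply: (@FTC_vanish (fun x => Y (x, y))) => //.
  + move=> x; rewrite in_itv/= -ler_distl => xc.
    have Q : square c r (x, y) by apply/squareE.
    have := @is_derive_line R _ _ Y (0, y) (e1 R) x; rewrite line_e1.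
    have -> : (fun s : R => Y ((0, y) + s *: e1 R)) = (fun x => Y (x, y)).
      by apply/funext => s; rewrite line_e1.
    by apply; exact: smooth_drv sY (sU _ Q).
  + move=> x; rewrite in_itv/= -ler_distl => xc.
    have Q : square c r (x, y) by apply/squareE.
    apply: (@continuous_comp _ _ _ (fun x => (x, y)) ('D_(e1 R) Y)); last exact: cD.
    suff : (fun z : R => (z, y)) z0 @[z0 --> x] --> (x, y) by [].
    exact: (@cvg_pair _ _ _ (nbhs (x : R)) (nbhs (x : R)) (nbhs (y : R)) _ _ _ id (fun=> y) cvg_id (cvg_cst y)).
  + have Q : square c r (c.1 - r, y) by apply/squareE; rewrite /= nm.
    apply: Y0 => //; apply/eqP; rewrite eq_le Q/= prod_normE/= le_max; apply/orP; left.
    by rewrite nm.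
  + have Q : square c r (c.1 + r, y) by apply/squareE; rewrite /= np.
    apply: Y0 => //; apply/eqP; rewrite eq_le Q/= prod_normE/= le_max; apply/orP; left.
    by rewrite np.
Qed.

End PlaneIntegral.

Section FirstVariation.
Variable R : realType.
Local Notation mu := (@lebesgue_measure R \x @lebesgue_measure R)%E.
Local Notation ds := ((1, 0) : R * (R * R)).

Definition slab (e : R) (D : set (R * R)) : set (R * (R * R)) :=
  [set z | `|z.1| < e /\ D z.2].

Lemma open_slab e D : open D -> open (slab e D).
Proof.
move=> oD; have -> : slab e D = (fun z : R * (R * R) => `|z.1|) @^-1` [set x | x < e] `&` snd @^-1` D.
  by apply/seteqP; split=> z.
apply: openI; apply: open_comp => //.
- move=> z _; apply: (@continuous_comp _ _ _ fst (fun x : R => `|x|)); [exact: cvg_fst|exact: norm_continuous].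
- by move=> z _; exact: cvg_snd.
Qed.

Lemma cont_slice (W : normedModType R) (g : R * (R * R) -> W) (s : R) x :
  {for (s, x), continuous g} -> {for x, continuous (fun y => g (s, y))}.
Proof.
move=> cg; apply: (@continuous_comp _ _ _ (fun y => (s, y)) g) => //.
exact: (@cvg_pair _ _ _ (nbhs x) (nbhs s) (nbhs x) _ _ _ (fun=> s) id (cvg_cst s) cvg_id).
Qed.

Lemma line_ds (s : R) (x : R * R) (h : R) : (s, x) + h *: ds = (s + h, x).
Proof.
by rewrite [LHS]surjective_pairing/= scaler0 addr0 [_ *: _]mulr1.
Qed.

Lemma bounded_on_compact (V : normedModType R) (K : set V) (f : V -> R) : compact K ->
  (forall x, K x -> {for x, continuous f}) -> exists2 C, 0 < C & forall x, K x -> `|f x| <= C.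
Proof.
move=> cK cf.
have : compact (f @` K).
  apply: continuous_compact => //.
  by apply: continuous_in_subspaceT => x; rewrite inE; exact: cf.
move=> /compact_bounded [M [_ H]]; exists (`|M| + 1); first by rewrite ltr_pwDr.
move=> x Kx; apply: (H (`|M| + 1)); last by exists x.
by apply: le_lt_trans (ler_norm M) _; rewrite ltrDl.
Qed.

Lemma quadratic_bound (h t X C : R) : 0 < h -> 0 < t -> t < h -> 0 <= X -> X <= C ->
  h * (t * X) <= C * h ^+ 2.
Proof.
move=> h0 t0 th X0 XC; have -> : C * h ^+ 2 = h * (h * C) by ring.
by rewrite ler_pM2l// ler_pM// ltW.
Qed.

Definition continuous_square (c : R * R) (r : R) (f : R * R -> R) := forall x, square c r x -> {for x, continuous f}.

Definition integral_sq (c : R * R) (r : R) (f : R * R -> R) : R := \int[mu]_(x in square c r) f x.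

Lemma energy_integral_sq p c r (u : R * R -> 'rV[R]_p) :
  fine (energy (square c r) u) = integral_sq c r (fun x => 2^-1 * grad_sq u x).
Proof. by []. Qed.

Lemma integral_sq_eq c r f g : (forall x, square c r x -> f x = g x) -> integral_sq c r f = integral_sq c r g.
Proof. by move=> fg; apply: eq_Rintegral => x; rewrite inE => /fg. Qed.

Section Linear.
Variables (c : R * R) (r : R) (f g : R * R -> R).
Hypothesis r0 : 0 < r.
Hypothesis cf : continuous_square c r f.
Hypothesis cg : continuous_square c r g.

Let fi := continuous_integrable_square (ltW r0) cf.
Let gi := continuous_integrable_square (ltW r0) cg.

Lemma continuous_squareD : continuous_square c r (fun x => f x + g x).
Proof. by move=> x Qx; apply: (@continuousD _ _ _ f g); [exact: cf|exact: cg]. Qed.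

Lemma continuous_squareB : continuous_square c r (fun x => f x - g x).
Proof. by move=> x Qx; apply: (@continuousB _ _ _ f g); [exact: cf|exact: cg]. Qed.

Lemma continuous_squareZ k : continuous_square c r (fun x => k * f x).
Proof.
by move=> x Qx; apply: (@continuousM _ _ (fun=> k) f); [exact: cst_continuous|exact: cf].
Qed.

Lemma integral_sqD : integral_sq c r (fun x => f x + g x) = integral_sq c r f + integral_sq c r g.
Proof. by apply: RintegralD fi gi; exact: measurable_square. Qed.

Lemma integral_sqB : integral_sq c r (fun x => f x - g x) = integral_sq c r f - integral_sq c r g.
Proof. by apply: RintegralB fi gi; exact: measurable_square. Qed.

Lemma integral_sqZ k : integral_sq c r (fun x => k * f x) = k * integral_sq c r f.
Proof. by apply: RintegralZl fi; exact: measurable_square. Qed.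

Lemma integral_sq_bound C : (forall x, square c r x -> `|f x| <= C) ->
  `|integral_sq c r f| <= C * fine (mu (square c r)).
Proof.
move=> fC; apply: le_trans (le_normr_Rintegral _ fi) _; first exact: measurable_square.
rewrite -Rintegral_cst; last exact: measurable_square.
apply: le_Rintegral => //.
- exact: measurable_square.
- exact: (integrable_norm fi).
- apply: continuous_integrable_square; first exact: ltW.
  by move=> x _; exact: cst_continuous.
Qed.

Lemma integral_sq_gt0 : (forall x, square c r x -> 0 <= f x) -> 0 < f c -> 0 < integral_sq c r f.
Proof.
move=> f0 fc; apply: fine_gt0; rewrite (integral_pos_square r0 cf f0 fc)/=.
have F : (\int[mu]_(x in square c r) (f x)%:E)%E \is a fin_num.
  by apply: integrable_fin_num fi; exact: measurable_square.
by rewrite ltey_eq F.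
Qed.

End Linear.

Lemma integral_sq_divergence (U : set (R * R)) (Y : R * R -> R) c r b : open U -> smooth_on U Y ->
  0 < r -> square c r `<=` U -> (forall z, square c r z -> `|z - c| = r -> Y z = 0) ->
  integral_sq c r ('D_(dir R b) Y) = 0.
Proof. by move=> oU sY r0 sU Y0; rewrite /integral_sq /Rintegral (integral_D_square b oU sY r0 sU Y0). Qed.

(** Taylor expansion of the integrand to second order, uniform because the second
derivative in time is bounded on a compact set. *)
Lemma integral_expansion (e r : R) (D : set (R * R)) (c : R * R) (g : R * (R * R) -> R) :
  0 < e -> 0 < r -> open D -> square c r `<=` D -> smooth_on (slab e D) g ->
  exists2 C, 0 < C & forall h, 0 < h < e / 2 ->
  `|integral_sq c r (fun x => g (h, x)) - integral_sq c r (fun x => g (0, x))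
    - h * integral_sq c r (fun x => 'D_ds g (0, x))| <= C * h ^+ 2.
Proof.
move=> e0 r0 oD QD sg.
have sDg := smooth_D ds sg; have sDDg := smooth_D ds sDg.
have [C C0 HC] : exists2 C, 0 < C & forall z, (`[- (e / 2), e / 2] `*` square c r) z ->
    `|'D_ds ('D_ds g) z| <= C.
  apply: bounded_on_compact.
    by apply: compact_setX; [exact: segment_compact|exact: compact_square].
  move=> [s x] [/=]; rewrite in_itv/= => s1 /QD Dx; apply: smooth_cont sDDg _.
  split=> //=; rewrite ltr_norml; lra.
have cQ (s : R) (f : R * (R * R) -> R) : `|s| < e -> smooth_on (slab e D) f ->
    continuous_square c r (fun x => f (s, x)).
  by move=> se sf x /QD Dx; apply: cont_slice; exact: smooth_cont sf _.
have n0 : `|0 : R| < e by rewrite normr0.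
exists (C * (fine (mu (square c r)) + 1)).
  by rewrite mulr_gt0// ltr_pwDr// fine_ge0.
move=> h /andP[h0 he].
have nh : `|h| < e by rewrite gtr0_norm//; lra.
have c1 := cQ _ _ nh sg; have c0 := cQ _ _ n0 sg; have cD := cQ _ _ n0 sDg.
have c10 := continuous_squareB c1 c0; have cZ := continuous_squareZ (k := h) cD.
rewrite -(integral_sqZ r0 cD) -(integral_sqB r0 c1 c0) -(integral_sqB r0 c10 cZ).
apply: (@le_trans _ _ ((C * h ^+ 2) * fine (mu (square c r)))); last first.
  by rewrite mulrAC ler_wpM2r ?sqr_ge0// ler_wpM2l ?lerDl// ltW.
apply: (integral_sq_bound r0 (continuous_squareB c10 cZ)).
move=> x Qx; have Dx := QD _ Qx.
have inS (t : R) : 0 <= t <= h -> slab e D ((0, x) + t *: ds).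
  by move=> th; rewrite line_ds add0r; split=> //=; rewrite ger0_norm; lra.
have [||t th E] := @MVT_line R _ g (0, x) ds h => //.
  by move=> t th; apply: smooth_drv sg _; exact: inS.
have [||t' t'h E'] := @MVT_line R _ ('D_ds g) (0, x) ds t; first by lra.
  by move=> t'' th'; apply: smooth_drv sDg _; apply: inS; lra.
rewrite line_ds add0r in E.
have -> : g (h, x) - g (0, x) - h * 'D_ds g (0, x) =
    h * (t * 'D_ds ('D_ds g) ((0, x) + t' *: ds)).
  by rewrite E -E'; move: ('D__ _ _) ('D__ _ _) => a b; ring.
have /andP[t0 tlh] := th.
rewrite normrM normrM (gtr0_norm h0) (gtr0_norm t0).
have /HC : (`[- (e / 2), e / 2] `*` square c r) ((0, x) + t' *: ds).
  by rewrite line_ds add0r; split=> //=; rewrite in_itv/=; lra.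
move: (`| _ |) (normr_ge0 ('D_ds ('D_ds g) ((0, x) + t' *: ds))) => X X0 XC.
exact: quadratic_bound.
Qed.

(** A derivative known to exist is determined by increments h > 0 alone. *)
Lemma derivative_under_integral (e r : R) (D : set (R * R)) (c : R * R) (g : R * (R * R) -> R)
    (G : R * R -> R) : (forall x, square c r x -> G x = 'D_ds g (0, x)) ->
  0 < e -> 0 < r -> open D -> square c r `<=` D -> smooth_on (slab e D) g ->
  is_derive (0 : R) 1 (fun s : R => integral_sq c r (fun x => g (s, x))) 0 ->
  integral_sq c r G = 0.
Proof.
move=> GE e0 r0 oD QD sg [dE DE0].
have [C C0 HC] := integral_expansion e0 r0 oD QD sg.
have -> : integral_sq c r G = integral_sq c r (fun x => 'D_ds g (0, x)).
  exact: integral_sq_eq.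
apply: (@eps_eq0 _ _ 2) => // d d0.
have /nbhs_ballP[k /= k0 Hk] := derivable_approx dE d0.
have [h [h0 he hk hC]] : exists h, [/\ 0 < h, h < e / 2, h < k & C * h <= d].
  exists (Num.min (e / 4) (Num.min (k / 2) (d / C))).
  have dC : 0 < d / C by rewrite divr_gt0.
  split.
  - by rewrite !lt_min dC/=; apply/andP; split; lra.
  - by rewrite gt_min; apply/orP; left; lra.
  - by rewrite !gt_min; apply/orP; right; apply/orP; left; lra.
  - by rewrite mulrC -ler_pdivlMr// !ge_min lexx !orbT.
have := Hk h; rewrite -ball_normE/= sub0r normrN gtr0_norm// => /(_ hk).
rewrite DE0 scaler0 subr0 add0r [h *: 1]mulr1 => H1.
have := HC h; rewrite h0 he => /(_ isT) H2.
move: H1 H2; move: (integral_sq c r (fun x => g (h, x))) (integral_sq c r (fun x => g (0, x)))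
  (integral_sq c r (fun x => 'D_ds g (0, x))) => a b i H1 H2.
rewrite -(ler_pM2l h0) -{1}(gtr0_norm h0) -normrM.
have -> : h * i = (a - b) - (a - b - h * i) by ring.
apply: le_trans (ler_normB _ _) _.
have : C * h ^+ 2 <= d * h by rewrite expr2 mulrA ler_wpM2r// ltW.
lra.
Qed.

End FirstVariation.

(** * The first variation of the energy *)

Section Slices.
Variable R : realType.

Transparent derive.
Lemma derive_slice (W : normedModType R) (f : R * (R * R) -> W) s x v :
  'D_v (fun y => f (s, y)) x = 'D_(0, v) f (s, x) /\
  (derivable f (s, x) (0, v) -> derivable (fun y => f (s, y)) x v).
Proof.
have E : (fun h : R => h^-1 *: (((fun y => f (s, y)) \o shift x) (h *: v) - f (s, x))) =
    (fun h : R => h^-1 *: ((f \o shift (s, x)) (h *: (0, v)) - f (s, x))).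
  apply/funext => h /=; congr (_ *: (f _ - _)).
  by rewrite [RHS]surjective_pairing/= scaler0 add0r.
by rewrite /derive /derivable E.
Qed.
Opaque derive.

Lemma iterD_slice (W : normedModType R) (f : R * (R * R) -> W) s vs :
  Defs.iterD vs (fun y => f (s, y)) =
  (fun y => Defs.iterD [seq (0, v) | v <- vs] f (s, y)).
Proof.
elim: vs => //= v vs IH; apply/funext => y; rewrite IH.
by have [-> _] := derive_slice (Defs.iterD [seq (0, v) | v <- vs] f) s y v.
Qed.

Lemma smooth_slice (W : normedModType R) (f : R * (R * R) -> W) (e : R) D s : `|s| < e ->
  smooth_on (slab e D) f -> smooth_on D (fun y => f (s, y)).
Proof.
move=> se sf vs y Dy; rewrite iterD_slice.
have Sy : slab e D (s, y) by [].
have [cf df] := sf [seq (0, v) | v <- vs] _ Sy.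
split; first exact: cont_slice.
move=> v; have [_] := derive_slice (Defs.iterD [seq (0, v) | v <- vs] f) s y v.
exact.
Qed.

Lemma derive_sum_mul (V : normedModType R) p (a b : 'I_p -> V -> R) x v :
  (forall l, derivable (a l) x v) -> (forall l, derivable (b l) x v) ->
  derivable (fun y => \sum_l a l y * b l y) x v /\
  'D_v (fun y => \sum_l a l y * b l y) x = \sum_l ('D_v (a l) x * b l x + a l x * 'D_v (b l) x).
Proof.
move=> da db.
have dm l : is_derive x v (a l * b l) ('D_v (a l) x * b l x + a l x * 'D_v (b l) x).
  split; first exact: derivableM.
  rewrite deriveM// addrC /GRing.scale/= mulrC; congr (_ + _).
have -> : (fun y => \sum_l a l y * b l y) = \sum_l (a l * b l).
  by apply/funext => y; rewrite fct_sumE.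
have := is_derive_sum dm => -[? ?]; by split.
Qed.

End Slices.

Section Variation.
Variables (R : realType) (p : nat).
Local Notation ds := ((1, 0) : R * (R * R)).
Variables (D : set (R * R)) (c : R * R) (r e : R) (F : R * (R * R) -> 'rV[R]_p).
Hypothesis oD : open D.
Hypothesis r0 : 0 < r.
Hypothesis e0 : 0 < e.
Hypothesis QD : square c r `<=` D.
Hypothesis sF : smooth_on (slab e D) F.
Hypothesis bF : forall s x, `|s| < e -> square c r x -> `|x - c| = r -> F (s, x) = F (0, x).
Hypothesis crit : is_derive (0 : R) 1 (fun s : R => fine (energy (square c r) (fun x => F (s, x)))) 0.

Definition slab_dir (b : bool) : R * (R * R) := (0, dir R b).
Definition var_co l (z : R * (R * R)) : R := F z 0 l.
Definition base_co l (y : R * R) : R := F (0, y) 0 l.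
Definition velocity l (y : R * R) : R := 'D_ds (var_co l) (0, y).
Definition var_grad b l (z : R * (R * R)) : R := ('D_(slab_dir b) F z) 0 l.
Lemma zero_lt_width : `|0 : R| < e. Proof. by rewrite normr0. Qed.
Lemma open_domain : open (slab e D). Proof. exact: open_slab. Qed.

Lemma base_in_slab y : D y -> slab e D (0, y). Proof. by move=> Dy; split => //=; exact: zero_lt_width. Qed.

Lemma smooth_var_co l : smooth_on (slab e D) (var_co l).
Proof. by have [h _] := @smooth_rV R _ p (slab e D) F open_domain; exact: (h sF l). Qed.

Lemma smooth_var_grad b l : smooth_on (slab e D) (var_grad b l).
Proof.
by have [h _] := @smooth_rV R _ p (slab e D) ('D_(slab_dir b) F) open_domain; exact: (h (smooth_D (slab_dir b) sF) l).
Qed.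

Lemma smooth_velocity l : smooth_on D (velocity l).
Proof. exact: (@smooth_slice R _ ('D_ds (var_co l)) e D 0 zero_lt_width (smooth_D ds (smooth_var_co l))). Qed.

Lemma smooth_base_co l : smooth_on D (base_co l).
Proof. by apply: (@smooth_slice R _ (var_co l) e D 0 zero_lt_width); exact: smooth_var_co. Qed.

Lemma var_gradE b l z : slab e D z -> var_grad b l z = 'D_(slab_dir b) (var_co l) z.
Proof. by move=> Sz; rewrite /var_grad; apply: derive_rV; exact: smooth_drv sF Sz. Qed.

Lemma var_grad0 b l y : D y -> var_grad b l (0, y) = 'D_(dir R b) (base_co l) y.
Proof.
move=> Dy; rewrite var_gradE; last exact: base_in_slab.
by have [-> _] := derive_slice (var_co l) 0 y (dir R b).
Qed.

(** Symmetry of the second derivatives in time and space. *)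
Lemma derive_var_grad b l y : D y -> 'D_ds (var_grad b l) (0, y) = 'D_(dir R b) (velocity l) y.
Proof.
move=> Dy; have S0 := base_in_slab Dy.
have -> : 'D_ds (var_grad b l) (0, y) = 'D_ds ('D_(slab_dir b) (var_co l)) (0, y).
  by apply: (iterD_eq [:: ds] open_domain _ S0) => z; exact: var_gradE.
rewrite (schwarz _ _ open_domain (smooth_var_co l) S0).
by have [-> _] := derive_slice ('D_ds (var_co l)) 0 y (dir R b).
Qed.

Definition grad_norm2 b (z : R * (R * R)) : R := \sum_l var_grad b l z * var_grad b l z.
Definition density (z : R * (R * R)) : R := 2^-1 * (grad_norm2 false z + grad_norm2 true z).
Definition grad_pairing b (y : R * R) : R := \sum_l 'D_(dir R b) (base_co l) y * 'D_(dir R b) (velocity l) y.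

Lemma smooth_grad_norm2 b : smooth_on (slab e D) (grad_norm2 b).
Proof.
by apply: (smooth_sum _ open_domain) => l; exact: (@smoothM R _ _ _ _ open_domain (smooth_var_grad b l) (smooth_var_grad b l)).
Qed.

Lemma smooth_density : smooth_on (slab e D) density.
Proof.
apply: (@smoothM R _ (slab e D) (fun=> 2^-1) _ open_domain); first exact: smooth_cst.
exact: (@smoothD _ _ R _ _ _ open_domain (smooth_grad_norm2 false) (smooth_grad_norm2 true)).
Qed.

Lemma smooth_grad_pairing b : smooth_on D (grad_pairing b).
Proof.
apply: (smooth_sum _ oD) => l.
exact: (@smoothM R _ D _ _ oD (smooth_D (dir R b) (smooth_base_co l)) (smooth_D (dir R b) (smooth_velocity l))).
Qed.

Lemma derive_grad_norm2 b y : D y -> 'D_ds (grad_norm2 b) (0, y) = 2 * grad_pairing b y.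
Proof.
move=> Dy; have S0 := base_in_slab Dy.
have dA l : derivable (var_grad b l) (0, y) ds by exact: smooth_drv (smooth_var_grad b l) S0.
have [_ E1] := derive_sum_mul dA dA.
have -> : 'D_ds (grad_norm2 b) (0, y) = 'D_ds (fun z => \sum_l var_grad b l z * var_grad b l z) (0, y) by [].
rewrite E1 /grad_pairing mulr_sumr; apply: eq_bigr => l _.
rewrite (derive_var_grad b l Dy) (var_grad0 b l Dy).
move: ('D_(dir R b) (base_co l) y) ('D_(dir R b) (velocity l) y) => u v; ring.
Qed.

Lemma derive_density y : D y -> 'D_ds density (0, y) = grad_pairing false y + grad_pairing true y.
Proof.
move=> Dy; have S0 := base_in_slab Dy.
have d b : derivable (grad_norm2 b) (0, y) ds by exact: smooth_drv (smooth_grad_norm2 b) S0.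
have E1 := @deriveZ R _ R _ 2^-1 (0, y) ds (derivableD (d false) (d true)).
have E2 := deriveD (d false) (d true).
have -> : 'D_ds density (0, y) = 'D_ds (2^-1 \*: (grad_norm2 false + grad_norm2 true)) (0, y) by [].
have E := etrans E1 (congr1 (fun z => 2^-1 *: z) (etrans E2 (congr2 +%R (derive_grad_norm2 false Dy) (derive_grad_norm2 true Dy)))).
apply: (etrans E).
move: (grad_pairing false y) (grad_pairing true y) => u v; rewrite /GRing.scale/=; by field.
Qed.

(** The vector field whose divergence, minus the Laplacian paired with the
velocity, is the time derivative of the energy density. *)
Definition flux b (y : R * R) : R := \sum_l 'D_(dir R b) (base_co l) y * velocity l y.

Lemma smooth_flux b : smooth_on D (flux b).
Proof.
apply: (smooth_sum _ oD) => l.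
exact: (@smoothM R _ D _ _ oD (smooth_D (dir R b) (smooth_base_co l)) (smooth_velocity l)).
Qed.

Lemma velocity_boundary l y : square c r y -> `|y - c| = r -> velocity l y = 0.
Proof.
move=> Qy yr; have S0 := base_in_slab (QD Qy).
apply: (@eps_eq0 _ _ 1) => // d d0.
have /nbhs_ballP[k /= k0 Hk] := derivable_approx (smooth_drv (v := ds) (smooth_var_co l) S0) d0.
pose h := Num.min (k / 2) (e / 2).
have h0 : 0 < h by rewrite lt_min !divr_gt0.
have he : h < e by rewrite gt_min [Q in _ || Q]ltr_pdivrMr// ltr_pMr// ltr1n orbT.
have hk : h < k by rewrite gt_min ltr_pdivrMr// ltr_pMr// ltr1n.
have := Hk h; rewrite -ball_normE/= sub0r normrN gtr0_norm// => /(_ hk).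
have -> : var_co l ((0, y) + h *: ds) = var_co l (0, y).
  by rewrite line_ds add0r /var_co bF ?gtr0_norm.
rewrite subrr sub0r normrN normrM (gtr0_norm h0) mulrC ler_pM2r// => H.
by rewrite mul1r.
Qed.

Definition div_flux b : R * R -> R := 'D_(dir R b) (flux b).

Lemma div_fluxE b x : D x -> div_flux b x = \sum_l ('D_(dir R b) ('D_(dir R b) (base_co l)) x * velocity l x
       + 'D_(dir R b) (base_co l) x * 'D_(dir R b) (velocity l) x).
Proof.
move=> Dx.
have d1 l : derivable ('D_(dir R b) (base_co l)) x (dir R b).
  exact: smooth_drv (smooth_D (dir R b) (smooth_base_co l)) Dx.
have d2 l : derivable (velocity l) x (dir R b) by exact: smooth_drv (smooth_velocity l) Dx.
by have [_ E] := derive_sum_mul d1 d2; exact: E.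
Qed.

(** The time derivative of the energy density is div Y - (Lap u, X) with X the
velocity; the flux Y vanishes with X on the boundary of the square, so that its
divergence integrates to 0. *)
Lemma first_variation :
  integral_sq c r (fun x => \sum_l lap (fun y => F (0, y) 0 l) x * 'D_ds (fun z => F z 0 l) (0, x)) = 0.
Proof.
have Ig : integral_sq c r (fun x => grad_pairing false x + grad_pairing true x) = 0.
  have GE x : square c r x -> grad_pairing false x + grad_pairing true x = 'D_ds density (0, x).
    by move=> /QD Dx; rewrite derive_density.
  have EE : (fun s : R => fine (energy (square c r) (fun x => F (s, x)))) =
      (fun s : R => integral_sq c r (fun x => density (s, x))).
    apply/funext => s; rewrite energy_integral_sq; apply: integral_sq_eq => x _.
    rewrite /density /grad_norm2 /grad_sq /dotp.
    have [-> _] := derive_slice F s x (1, 0).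
    by have [-> _] := derive_slice F s x (0, 1).
  have crit' := crit; rewrite EE in crit'.
  exact: (derivative_under_integral GE e0 r0 oD QD smooth_density crit').
have IY b : integral_sq c r (div_flux b) = 0.
  apply: (integral_sq_divergence b oD (smooth_flux b) r0 QD) => z Qz zr.
  by rewrite /flux big1// => l _; rewrite velocity_boundary// mulr0.
have cY b : continuous_square c r (div_flux b).
  by move=> x /QD Dx; exact: smooth_cont (smooth_D (dir R b) (smooth_flux b)) Dx.
have cZ b : continuous_square c r (grad_pairing b).
  by move=> x /QD Dx; exact: smooth_cont (smooth_grad_pairing b) Dx.
transitivity (integral_sq c r (fun x => (div_flux false x + div_flux true x) - (grad_pairing false x + grad_pairing true x))).
  apply: integral_sq_eq => x /QD Dx.
  rewrite !div_fluxE// -!big_split/= -sumrB; apply: eq_bigr => l _; rewrite /lap.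
  have alg (a1 a2 x0 b1 b2 d1 d2 : R) : (a1 + a2) * x0 =
    a1 * x0 + b1 * d1 + (a2 * x0 + b2 * d2) - (b1 * d1 + b2 * d2) by ring.
  exact: alg.
rewrite (integral_sqB r0 (continuous_squareD (cY false) (cY true)) (continuous_squareD (cZ false) (cZ true))).
have alg (x a b z : R) : x = a + b -> a = 0 -> b = 0 -> z = 0 -> x - z = 0.
  by move=> -> -> -> ->; rewrite addr0 subr0.
exact: (alg _ _ _ _ (integral_sqD r0 (cY false) (cY true)) (IY false) (IY true) Ig).
Qed.

End Variation.

(** * The Euler-Lagrange equation in a slice chart *)

Section Bump.
Variable R : realType.

Lemma flat1_ge0 (t : R) : 0 <= flat 1 t.
Proof. by rewrite /flat; case: ifP => // _; rewrite hornerC mul1r expR_ge0. Qed.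

Lemma flat1_le1 (t : R) : flat 1 t <= 1.
Proof.
rewrite /flat; case: ifP => // t0; rewrite hornerC mul1r -expR0 ler_expR oppr_le0.
by rewrite invr_ge0 ltW.
Qed.

Lemma flat1_gt0 (t : R) : 0 < t -> 0 < flat 1 t.
Proof. by move=> t0; rewrite /flat t0 hornerC mul1r expR_gt0. Qed.

Lemma flat1_eq0 (t : R) : t <= 0 -> flat 1 t = 0.
Proof. by move=> t0; rewrite /flat ltNge t0. Qed.

Lemma smooth_fst : smooth_on [set: R * R] (fst : R * R -> R).
Proof. by apply: smooth_linear => // x; exact: cvg_fst. Qed.

Lemma smooth_snd : smooth_on [set: R * R] (snd : R * R -> R).
Proof. by apply: smooth_linear => // x; exact: cvg_snd. Qed.

Lemma smooth_comp_R (V : normedModType R) (U : set V) (g : R -> R) (f : V -> R) : frame V -> open U ->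
  smooth_on setT g -> smooth_on U f -> smooth_on U (g \o f).
Proof.
move=> FV oU sg sf; apply: (@smooth_comp R V R FV (frame_R R) U setT) => //.
  exact: openT.
Qed.

Lemma bump (c : R * R) (r : R) : 0 < r -> exists phi : R * R -> R,
  [/\ smooth_on setT phi, forall x, 0 <= phi x <= 1,
      forall x, r <= `|x - c| -> phi x = 0 & 0 < phi c].
Proof.
move=> r0.
pose b (l : R * R -> R) (x : R * R) := flat 1 (r ^+ 2 - (l x - l c) * (l x - l c)).
have sb l : smooth_on setT l -> smooth_on setT (b l).
  move=> sl; have F2 := frame_pair (frame_R R) (frame_R R).
  apply: (@smooth_comp_R _ setT (flat 1) (fun x => r ^+ 2 - (l x - l c) * (l x - l c)) F2 openT).
    exact: smooth_flat.
  have sd : smooth_on setT (fun x => l x - l c).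
    by apply: smoothB => //; [exact: openT|exact: smooth_cst].
  apply: (@smoothB _ _ _ (fun=> r ^+ 2)); [exact: openT|exact: smooth_cst|].
  exact: (@smoothM R _ setT _ _ openT sd sd).
exists (fun x => b fst x * b snd x); split.
- by apply: smoothM; [exact: openT|exact: sb smooth_fst|exact: sb smooth_snd].
- move=> x; rewrite mulr_ge0 ?flat1_ge0//=.
  by rewrite -[leRHS]mul1r ler_pM ?flat1_ge0 ?flat1_le1.
- move=> x; rewrite prod_normE/= le_max => /orP[] h; [rewrite [b fst x]flat1_eq0 ?mul0r//|rewrite [b snd x]flat1_eq0 ?mulr0//];
  by rewrite subr_le0 -expr2 -[leRHS]real_normK ?num_real// lerXn2r ?nnegrE// ltW.
- by rewrite mulr_gt0// /b; apply: flat1_gt0; rewrite subrr mulr0 subr0 exprn_gt0.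
Qed.

End Bump.

Section Products.
Variable R : realType.

Transparent derive.
Lemma derive_along (V V' W : normedModType R) (f : V -> W) (g : V' -> W) z v y w :
  (forall h : R, f (z + h *: v) = g (y + h *: w)) -> 'D_v f z = 'D_w g y.
Proof.
move=> E.
have E0 : f z = g y by have := E 0; rewrite !scale0r !addr0.
have Eq : (fun h : R => h^-1 *: ((f \o shift z) (h *: v) - f z)) =
    (fun h : R => h^-1 *: ((g \o shift y) (h *: w) - g y)).
  by apply/funext => h /=; rewrite (addrC (h *: v)) (addrC (h *: w)) E E0.
by rewrite /derive Eq.
Qed.
Opaque derive.

Lemma iterD_comp_snd (W : normedModType R) (f : R * R -> W) vs :
  Defs.iterD vs (fun z : R * (R * R) => f z.2) =
  (fun z => Defs.iterD [seq v.2 | v <- vs] f z.2).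
Proof.
elim: vs => //= v vs IH; apply/funext => z; rewrite IH.
exact: derive_along.
Qed.

Lemma smooth_comp_snd (W : normedModType R) (f : R * R -> W) (e : R) D :
  smooth_on D f -> smooth_on (slab e D) (fun z => f z.2).
Proof.
move=> sf vs z [_ Dz]; rewrite iterD_comp_snd.
have [cf df] := sf [seq v.2 | v <- vs] _ Dz.
move: (Defs.iterD _ f) cf df => G cf df; split.
  by apply: (@continuous_comp _ _ _ snd G); [exact: cvg_snd|exact: cf].
by move=> v; exact: (df v.2).
Qed.

End Products.

Definition tangent (R : realType) (p : nat) (Phi Psi : 'rV[R]_p -> 'rV[R]_p) (k : 'I_p)
  (y : 'rV[R]_p) : 'rV[R]_p := 'D_(delta_mx 0 k) Psi (Phi y).

Section EulerLagrange.
Variables (R : realType) (n p : nat) (N U V : set 'rV[R]_p) (Phi Psi : 'rV[R]_p -> 'rV[R]_p).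
Local Notation ds := ((1, 0) : R * (R * R)).
Hypothesis oU : open U.
Hypothesis oV : open V.
Hypothesis sPhi : smooth_on U Phi.
Hypothesis sPsi : smooth_on V Psi.
Hypothesis PhiK : forall y, U y -> V (Phi y) /\ Psi (Phi y) = y.
Hypothesis PsiK : forall z, V z -> U (Psi z) /\ Phi (Psi z) = z.
Hypothesis slice : forall y, U y -> (N y <-> forall j : 'I_p, (n <= j)%N -> Phi y 0 j = 0).

Local Notation tau := (tangent Phi Psi).

Section Variation.
Variables (D : set (R * R)) (u : R * R -> 'rV[R]_p) (k : 'I_p).
Hypothesis kn : (k < n)%N.
Variables (x0 : R * R) (rb rho r : R) (phi : R * R -> R).
Hypothesis oD : open D.
Hypothesis su : smooth_on D u.
Hypothesis Nu : forall x, D x -> N (u x).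
Hypothesis rho0 : 0 < rho.
Hypothesis r0 : 0 < r.
Hypothesis rrb : r < rb.
Hypothesis ballx : forall x, ball x0 rb x ->
  [/\ D x, U (u x) & forall w, `|w| < rho -> V (Phi (u x) + w)].
Hypothesis sphi : smooth_on setT phi.
Hypothesis phi01 : forall x, 0 <= phi x <= 1.
Hypothesis phi0 : forall x, r <= `|x - x0| -> phi x = 0.

Let ek : 'rV[R]_p := delta_mx 0 k.

Definition bumped (z : R * (R * R)) : 'rV[R]_p := Phi (u z.2) + (z.1 * phi z.2) *: ek.
(** The point u(x) is moved along the k-th coordinate line of the chart, by s times
the bump. Since the bump vanishes off the square, the first branch also gives u
there as long as u stays in the chart, and the variation is smooth across the
boundary of the square. *)
Definition varF (z : R * (R * R)) : 'rV[R]_p :=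
  if `|z.2 - x0| <= r then Psi (bumped z) else u z.2.

Lemma ek_norm : `|ek| <= 1.
Proof.
apply: rV_norm_le => // j; rewrite mxE eqxx/=.
by case: eqP => _; rewrite ?normr1 ?normr0.
Qed.

Lemma bumped_in z : `|z.1| < rho -> ball x0 rb z.2 -> V (bumped z).
Proof.
move=> z1 /ballx[_ _]; apply; rewrite normrZ normrM.
apply: le_lt_trans z1; rewrite -[leRHS]mulr1 -mulrA ler_wpM2l//.
have /andP[p0 p1] := phi01 z.2.
by rewrite -[leRHS]mulr1 ler_pM ?ger0_norm// ek_norm.
Qed.

Lemma square_in_ball : square x0 r `<=` ball x0 rb.
Proof. by move=> x xr; rewrite -ball_normE/= distrC; exact: le_lt_trans rrb. Qed.

Lemma varF_near z : ball x0 rb z.2 -> varF z = Psi (bumped z).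
Proof.
move=> /ballx[_ Uz _]; rewrite /varF; case: ifPn => // zr.
rewrite /bumped phi0; last by rewrite ltW// ltNge.
by rewrite mulr0 scale0r addr0; have [_ ->] := PhiK Uz.
Qed.

Lemma varF_far z : r < `|z.2 - x0| -> varF z = u z.2.
Proof. by move=> zr; rewrite /varF leNgt zr. Qed.

Let sv := frame_pair (frame_R R) (frame_pair (frame_R R) (frame_R R)).
Let s2 := frame_pair (frame_R R) (frame_R R).

Lemma smooth_bumped : smooth_on (slab rho (ball x0 rb)) (Psi \o bumped).
Proof.
have oB : open (ball x0 rb) by exact: ball_open.
have oS := @open_slab R rho _ oB.
apply/(smooth_rV _ oS) => l.
have sPl : smooth_on V (fun y => Psi y 0 l).
  by have [h _] := smooth_rV Psi oV; exact: (h sPsi l).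
apply: (@smooth_comp R _ _ sv (frame_rV R p) _ V (fun y => Psi y 0 l) bumped oS oV _ sPl).
  by move=> z [z1 z2]; exact: bumped_in.
move=> j.
have sPu : smooth_on (ball x0 rb) (fun x => Phi (u x) 0 j).
  apply: (@smooth_comp R _ _ s2 (frame_rV R p) _ U (fun y => Phi y 0 j) u oB oU).
  - by move=> x /ballx[].
  - by have [h _] := smooth_rV Phi oU; exact: (h sPhi j).
  - move=> i; have [h _] := smooth_rV u oD; apply: smooth_sub (h su i).
    by move=> x /ballx[].
have s1 : smooth_on (slab rho (ball x0 rb)) (fun z : R * (R * R) => z.1).
  by apply: smooth_linear => // z; exact: cvg_fst.
have sp : smooth_on (slab rho (ball x0 rb)) (fun z : R * (R * R) => phi z.2).
  by apply: smooth_comp_snd; apply: smooth_sub sphi.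
have se : smooth_on (slab rho (ball x0 rb)) (fun z : R * (R * R) => ek 0 j) by exact: smooth_cst.
have := smoothD oS (smooth_comp_snd (e := rho) sPu) (smoothM oS (smoothM oS s1 sp) se).
apply: smooth_eq => // z _.
by rewrite /bumped /= !mxE.
Qed.

Lemma smooth_varF : smooth_on (slab rho D) varF.
Proof.
apply: smooth_local => z [z1 Dz].
have [zb|zb] := pselect (ball x0 rb z.2).
  exists (slab rho (ball x0 rb)); split=> //.
    by apply: open_slab; exact: ball_open.
  apply: smooth_eq smooth_bumped; first by apply: open_slab; exact: ball_open.
  by move=> w [_ wb]; rewrite varF_near.
have zr : rb <= `|z.2 - x0|.
  by rewrite leNgt; apply/negP => h; apply: zb; rewrite -ball_normE/= distrC.
have oE : open (D `&` [set x | r < `|x - x0|]).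
  apply: openI => //; rewrite openE => x /= xr.
  apply/nbhs_ballP; exists (`|x - x0| - r); rewrite /= ?subr_gt0// => y.
  rewrite -ball_normE/= => xy.
  have := ler_distD y x x0; lra.
exists (slab rho (D `&` [set x | r < `|x - x0|])); split.
- exact: open_slab.
- by split=> //; split=> //=; exact: lt_le_trans zr.
- have sE : smooth_on (D `&` [set x | r < `|x - x0|]) u by apply: smooth_sub su => x [].
  apply: smooth_eq (smooth_comp_snd (e := rho) sE); first exact: open_slab.
  by move=> w [_ [_ wr]]; rewrite varF_far.
Qed.

(** In the chart N is the coordinate subspace of the first n coordinates, and k is
one of them. *)
Lemma varF_N s x : `|s| < rho -> D x -> N (varF (s, x)).
Proof.
move=> sr Dx; rewrite /varF /=; case: ifP => xr; last exact: Nu.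
have xb := square_in_ball xr; have [_ Ux _] := ballx xb.
have [UF PF] := PsiK (@bumped_in (s, x) sr xb).
apply/(slice UF) => j nj; rewrite PF /bumped /= !mxE.
have /(slice Ux) -> // := Nu Dx.
by rewrite eqxx/= [j == k]eq_sym -val_eqE/= ltn_eqF ?mulr0 ?addr0//; exact: leq_trans nj.
Qed.

Lemma varF_0 x : D x -> varF (0, x) = u x.
Proof.
move=> Dx; rewrite /varF/=; case: ifP => // xr.
have [_ Ux _] := ballx (square_in_ball xr).
by rewrite /bumped/= mul0r scale0r addr0; have [_ ->] := PhiK Ux.
Qed.

Lemma varF_velocity x l : square x0 r x ->
  'D_ds (fun z => varF z 0 l) (0, x) = phi x * tau k (u x) 0 l.
Proof.
move=> xr; have [Dx Ux _] := ballx (square_in_ball xr).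
have [VP _] := PhiK Ux.
have sPl : smooth_on V (fun y => Psi y 0 l).
  by have [h _] := smooth_rV Psi oV; exact: (h sPsi l).
rewrite (@derive_along _ _ _ _ _ (fun y => Psi y 0 l) (0, x) ds (Phi (u x)) (phi x *: ek)); last first.
  by move=> h; rewrite line_ds add0r /varF/= xr /bumped/= scalerA.
rewrite deriveZdir; try exact: smooth_drv sPl VP.
by rewrite /tangent (derive_rV l (smooth_drv (v := ek) sPsi VP)).
Qed.

Lemma weak_euler_lagrange : harmonic_map D N u ->
  integral_sq x0 r (fun x => phi x * \sum_l lap (fun y => u y 0 l) x * tau k (u x) 0 l) = 0.
Proof.
move=> [_ _ crit].
have QD : square x0 r `<=` D by move=> x /square_in_ball /ballx[].
have far s x : `|s| < rho -> D x -> ~ square x0 r x -> varF (s, x) = u x.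
  by move=> _ _ nK; apply: varF_far; rewrite ltNge; apply/negP.
have C := crit rho (square x0 r) varF rho0 (@compact_square R x0 r) QD smooth_varF varF_N varF_0 far.
have bF s x : `|s| < rho -> square x0 r x -> `|x - x0| = r -> varF (s, x) = varF (0, x).
  move=> _ Qx xr; rewrite !varF_near/=; try exact: square_in_ball.
  by rewrite /bumped /= phi0 ?xr// !mulr0.
apply: etrans; last exact: (first_variation oD r0 rho0 QD smooth_varF bF C).
apply: integral_sq_eq => x Qx; rewrite mulr_sumr; apply: eq_bigr => l _.
have E : forall y, D y -> varF (0, y) 0 l = u y 0 l by move=> y Dy; rewrite varF_0.
have EL : lap (fun y => varF (0, y) 0 l) x = lap (fun y => u y 0 l) x.
  exact: (congr2 +%R (iterD_eq [:: e1 R; e1 R] oD E (QD _ Qx)) (iterD_eq [:: e2 R; e2 R] oD E (QD _ Qx))).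
have alg (a b t b' d : R) : b' = b -> d = a * t -> a * (b * t) = b' * d.
  by move=> -> ->; rewrite mulrCA.
exact: (alg _ _ _ _ _ EL (varF_velocity l Qx)).
Qed.

End Variation.

(** If the sum were not 0 at x0, it would keep its sign on a small square; tested
against a bump supported there, the weak equation gives a contradiction. *)
Theorem euler_lagrange D u x0 (k : 'I_p) : open D -> harmonic_map D N u -> (k < n)%N ->
  D x0 -> U (u x0) -> \sum_l lap (fun y => u y 0 l) x0 * tau k (u x0) 0 l = 0.
Proof.
move=> oD hu kn Dx0 Ux0; have [su Nu _] := hu.
pose h x := \sum_l lap (fun y => u y 0 l) x * tau k (u x) 0 l.
have sul l : smooth_on D (fun y => u y 0 l).
  by have [H _] := smooth_rV u oD; exact: (H su l).
have ch x : D x -> U (u x) -> {for x, continuous h}.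
  move=> Dx Ux; have [VP _] := PhiK Ux.
  have cl l : {for x, continuous (fun x => lap (fun y => u y 0 l) x * tau k (u x) 0 l)}.
    apply: (@continuousM _ _ (lap (fun y => u y 0 l)) (fun x => tau k (u x) 0 l)).
      apply: (@continuousD _ _ _ ('D_(e1 R) ('D_(e1 R) (fun y => u y 0 l))) ('D_(e2 R) ('D_(e2 R) (fun y => u y 0 l)))).
        exact: smooth_cont (smooth_D (e1 R) (smooth_D (e1 R) (sul l))) Dx.
      exact: smooth_cont (smooth_D (e2 R) (smooth_D (e2 R) (sul l))) Dx.
    have [H _] := cont_rV (fun x => tau k (u x)) x.
    move: l; apply: H.
    have cu : {for x, continuous u} := smooth_cont su Dx.
    have cP : {for u x, continuous Phi} := smooth_cont sPhi Ux.
    have cD : {for Phi (u x), continuous ('D_(delta_mx 0 k) Psi)}.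
      exact: smooth_cont (smooth_D (delta_mx 0 k) sPsi) VP.
    refine (@continuous_comp _ _ _ u (tau k) x cu _).
    exact: (@continuous_comp _ _ _ Phi ('D_(delta_mx 0 k) Psi) (u x) cP cD).
  by apply: (@cvg_big _ _ +%R 0 predT add_continuous _ (nbhs x)) => l _; exact: cl.
apply/eqP; apply/negPn/negP => hn0.
(* Multiplication by the value at x0 makes the function positive near x0. *)
have [sg [sgh sgn]] : exists sg : R, 0 < sg * h x0 /\ sg != 0.
  by exists (h x0); split=> //; rewrite lt_def mulf_neq0//= -expr2 sqr_ge0.
have [VP _] := PhiK Ux0.
have /nbhs_ballP[d /= d0 dV] : nbhs (Phi (u x0)) V by exact: open_nbhs_nbhs.
have cu : {for x0, continuous u} := smooth_cont su Dx0.
have cPu : {for x0, continuous (Phi \o u)}.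
  by apply: continuous_comp => //; exact: smooth_cont sPhi Ux0.
have nD : nbhs x0 D by exact: open_nbhs_nbhs.
have nU : nbhs x0 [set x | U (u x)] by apply: cu; exact: open_nbhs_nbhs.
have nP : nbhs x0 [set x | ball (Phi (u x0)) (d / 2) (Phi (u x))].
  by apply: cPu; apply: nbhsx_ballx; rewrite divr_gt0.
have nh : nbhs x0 [set x | 0 < sg * h x].
  have c1 : {for x0, continuous (fun x => sg * h x)}.
    by apply: (@continuousM _ _ (fun=> sg) h); [exact: cst_continuous|exact: ch].
  exact: (c1 _ (lt_nbhsr sgh)).
have /nbhs_ballP[rb /= rb0 Hrb] : nbhs x0 (D `&` [set x | U (u x)] `&`
    [set x | ball (Phi (u x0)) (d / 2) (Phi (u x))] `&` [set x | 0 < sg * h x]).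
  by do 3 (apply: filterI => //).
have ballx x : ball x0 rb x -> [/\ D x, U (u x) & forall w, `|w| < d / 2 -> V (Phi (u x) + w)].
  move=> /Hrb[[[Dx Ux] Px] _]; split=> // w wd; apply: dV.
  move: Px; rewrite -!ball_normE/= => Px; rewrite opprD addrA.
  apply: le_lt_trans (ler_normB _ _) _; rewrite [ltRHS](splitr d).
  exact: ltrD.
have r0 : 0 < rb / 2 by rewrite divr_gt0.
have rrb : rb / 2 < rb by rewrite ltr_pdivrMr// ltr_pMr// ltr1n.
have dd0 : 0 < d / 2 by rewrite divr_gt0.
have [phi [sphi phi01 phi0 phic]] := @bump R x0 (rb / 2) r0.
have W := weak_euler_lagrange kn oD su Nu dd0 r0 rrb ballx sphi phi01 phi0 hu.
have Qb := @square_in_ball x0 rb (rb / 2) rrb.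
have cph : continuous_square x0 (rb / 2) (fun x => phi x * h x).
  move=> x Qx; have [Dx Ux _] := ballx _ (Qb _ Qx).
  apply: (@continuousM _ _ phi h); last exact: ch.
  exact: smooth_cont sphi I.
have := integral_sqZ r0 cph sg; rewrite W mulr0 => W0.
have : 0 < integral_sq x0 (rb / 2) (fun x => sg * (phi x * h x)).
  apply: integral_sq_gt0 => //.
  - exact: continuous_squareZ.
  - move=> x /Qb /Hrb[_ /= hx]; rewrite mulrCA.
    have /andP[p0 _] := phi01 x; exact: mulr_ge0 p0 (ltW hx).
  - by rewrite mulrCA mulr_gt0.
by rewrite W0 ltxx.
Qed.

End EulerLagrange.

(** * Harmonic maps as solutions of a quadratic system *)

Section SmoothMatrix.
Variables (R : realType) (V : normedModType R) (U : set V).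
Hypothesis oU : open U.

Lemma smooth_det q (M : V -> 'M[R]_q) : (forall i j, smooth_on U (fun y => M y i j)) ->
  smooth_on U (fun y => \det (M y)).
Proof.
move=> sM; rewrite /determinant; apply: (smooth_sum _ oU) => s.
apply: (@smoothM R V U (fun=> (-1) ^+ s) (fun y => \prod_i M y i (s i)) oU).
  exact: smooth_cst.
by apply: smooth_prod.
Qed.

Lemma smooth_invmx q (M : V -> 'M[R]_q) i j : (forall i j, smooth_on U (fun y => M y i j)) ->
  (forall y, U y -> M y \in unitmx) -> smooth_on U (fun y => invmx (M y) i j).
Proof.
move=> sM uM.
have sV : smooth_on U (fun y => (\det (M y))^-1).
  apply: smoothV => //; last exact: smooth_det.
  by move=> y /uM; rewrite unitmxE unitfE.
have sA : smooth_on U (fun y => (-1) ^+ (j + i) * \det (row' j (col' i (M y)))).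
  apply: (@smoothM R V U (fun=> (-1) ^+ (j + i)) _ oU); first exact: smooth_cst.
  apply: (@smooth_det _ (fun y => row' j (col' i (M y)))) => a b.
  by apply: smooth_eq (sM (lift j a) (lift i b)) => // y _; rewrite !mxE.
apply: smooth_eq (smoothM oU sV sA) => // y Uy.
by rewrite /invmx uM// !mxE.
Qed.

End SmoothMatrix.

Section ChainRules.
Variable R : realType.

Lemma derive_comp_rV p (D : set (R * R)) (U : set 'rV[R]_p) (g : 'rV[R]_p -> R)
    (w : R * R -> 'rV[R]_p) x v : open D -> open U -> D x -> (forall y, D y -> U (w y)) ->
  smooth_on U g -> smooth_on D w ->
  'D_v (fun y => g (w y)) x = \sum_j 'D_v (fun y => w y 0 j) x * 'D_(delta_mx 0 j) g (w x).
Proof.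
move=> oD oU Dx DU sg sw.
have F := frame_pair (frame_R R) (frame_R R).
have [h _] := smooth_rV w oD.
by have := @smooth_derive_comp R _ _ F (frame_rV R p) D U g w x v oD oU Dx (DU _ Dx) sg (h sw).
Qed.

Lemma smooth_comp_rV p (D : set (R * R)) (U : set 'rV[R]_p) (g : 'rV[R]_p -> R)
    (w : R * R -> 'rV[R]_p) : open D -> open U -> (forall y, D y -> U (w y)) ->
  smooth_on U g -> smooth_on D w -> smooth_on D (fun y => g (w y)).
Proof.
move=> oD oU DU sg sw.
have F := frame_pair (frame_R R) (frame_R R).
have [h _] := smooth_rV w oD.
exact: (@smooth_comp R _ _ F (frame_rV R p) D U g w oD oU DU sg (h sw)).
Qed.

Lemma smooth_comp2 (D E : set (R * R)) (g : R * R -> R) (f : R * R -> R * R) :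
  open D -> open E -> (forall y, D y -> E (f y)) -> smooth_on E g ->
  smooth_on D (fun y => (f y).1) -> smooth_on D (fun y => (f y).2) ->
  smooth_on D (fun y => g (f y)).
Proof.
move=> oD oE DE sg s1 s2.
have F := frame_pair (frame_R R) (frame_R R).
apply: (@smooth_comp R _ _ F (frame_pair (frame_R R) (frame_R R)) D E g f oD oE DE sg) => j.
rewrite /frame_pair/=; case: (fintype.split j) => i.
  exact: smooth_eq s1.
exact: smooth_eq s2.
Qed.

Lemma derive_comp2 (D E : set (R * R)) (g : R * R -> R) (f : R * R -> R * R) x v :
  open D -> open E -> D x -> (forall y, D y -> E (f y)) -> smooth_on E g ->
  smooth_on D (fun y => (f y).1) -> smooth_on D (fun y => (f y).2) ->
  'D_v (fun y => g (f y)) x = 'D_v (fun y => (f y).1) x * 'D_(e1 R) g (f x)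
    + 'D_v (fun y => (f y).2) x * 'D_(e2 R) g (f x).
Proof.
move=> oD oE Dx DE sg s1 s2.
pose F := frame_pair (frame_R R) (frame_R R).
have sf j : smooth_on D (fco F j \o f).
  rewrite /F /frame_pair/=; case: (fintype.split j) => i.
    exact: smooth_eq s1.
  exact: smooth_eq s2.
rewrite (@smooth_derive_comp R _ _ F F D E g f x v oD oE Dx (DE _ Dx) sg sf).
rewrite (@big_split_ord _ _ _ 1 1)/= !big_ord1.
by rewrite (unsplitK (inl _)) (unsplitK (inr _)).
Qed.

End ChainRules.

Section NormalForm.
Variables (R : realType) (n p : nat) (N U V : set 'rV[R]_p) (Phi Psi : 'rV[R]_p -> 'rV[R]_p).
Hypothesis oU : open U.
Hypothesis oV : open V.
Hypothesis sPhi : smooth_on U Phi.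
Hypothesis sPsi : smooth_on V Psi.
Hypothesis PhiK : forall y, U y -> V (Phi y) /\ Psi (Phi y) = y.
Hypothesis slice : forall y, U y -> (N y <-> forall j : 'I_p, (n <= j)%N -> Phi y 0 j = 0).

Local Notation tangent := (tangent Phi Psi).

Definition phi_co (k : 'I_p) (y : 'rV[R]_p) : R := Phi y 0 k.

(** Its columns are the tangent vectors to N and the differentials of the
constraints: the products with these columns are what is known about the
Laplacian of a harmonic map. *)
Definition frame_mx (y : 'rV[R]_p) : 'M[R]_p := \matrix_(l, k)
  if (k < n)%N then tangent k y 0 l else 'D_(delta_mx 0 l) (phi_co k) y.

Lemma smooth_phi_co k : smooth_on U (phi_co k).
Proof. by have [h _] := smooth_rV Phi oU; exact: (h sPhi k). Qed.

Lemma smooth_psi_co k : smooth_on V (fun y => Psi y 0 k).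
Proof. by have [h _] := smooth_rV Psi oV; exact: (h sPsi k). Qed.

Lemma smooth_tangent k l : smooth_on U (fun y => tangent k y 0 l).
Proof.
have sD : smooth_on V (fun z => ('D_(delta_mx 0 k) Psi z) 0 l).
  by have [h _] := smooth_rV ('D_(delta_mx 0 k) Psi) oV; exact: (h (smooth_D _ sPsi) l).
apply: (@smooth_comp R _ _ (frame_rV R p) (frame_rV R p) U V _ Phi oU oV _ sD).
  by move=> y /PhiK[].
exact: smooth_phi_co.
Qed.

(** The differential of the identity Psi o Phi. *)
Lemma chart_jacobian y l m : U y ->
  \sum_k 'D_(delta_mx 0 l) (phi_co k) y * tangent k y 0 m = (l == m)%:R.
Proof.
move=> Uy; have [VP _] := PhiK Uy.
have E := @smooth_derive_comp R _ _ (frame_rV R p) (frame_rV R p) U V (fun z => Psi z 0 m) Phi y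
  (delta_mx 0 l) oU oV Uy VP (smooth_psi_co m) (fun k => @smooth_phi_co k).
have E2 : 'D_(delta_mx 0 l) ((fun z => Psi z 0 m) \o Phi) y = (l == m)%:R.
  have -> : 'D_(delta_mx 0 l) ((fun z => Psi z 0 m) \o Phi) y =
      'D_(delta_mx 0 l) (fun z : 'rV[R]_p => z 0 m) y.
    by apply: (iterD_eq [:: delta_mx 0 l] oU _ Uy) => z /PhiK[_ /=] ->.
  rewrite (@derive_linear R _ (fun z : 'rV[R]_p => z 0 m)).
  - by rewrite mxE eqxx eq_sym.
  - exact: coord_continuous.
  - by move=> a z z'; rewrite !mxE.
rewrite -E2 E; apply: eq_bigr => k _; congr (_ * _).
by rewrite /tangent (derive_rV m (smooth_drv (v := delta_mx 0 k) sPsi VP)).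
Qed.

(** A vector v killed by the differentials of the constraints is a combination of
the first n tangent vectors, because v is the image of its chart coordinates;
if it is also orthogonal to these, it is orthogonal to itself. *)
Lemma frame_mx_unit y : U y -> frame_mx y \in unitmx.
Proof.
move=> Uy; rewrite -row_free_unit; apply: inj_row_free => v vM.
have vk k : \sum_l v 0 l * frame_mx y l k = 0.
  by have := congr1 (fun w : 'rV_p => w 0 k) vM; rewrite !mxE.
pose c k := \sum_l v 0 l * 'D_(delta_mx 0 l) (phi_co k) y.
have vE m : v 0 m = \sum_k c k * tangent k y 0 m.
  transitivity (\sum_l v 0 l * (l == m)%:R).
    by rewrite (bigD1 m)//= eqxx mulr1 big1 ?addr0// => l /negbTE ->; rewrite mulr0.
  transitivity (\sum_l \sum_k v 0 l * 'D_(delta_mx 0 l) (phi_co k) y * tangent k y 0 m).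
    apply: eq_bigr => l _; rewrite -(chart_jacobian l m Uy) mulr_sumr.
    by apply: eq_bigr => k _; rewrite mulrA.
  by rewrite exchange_big; apply: eq_bigr => k _; rewrite mulr_suml.
have sq0 : \sum_m v 0 m ^+ 2 = 0.
  transitivity (\sum_m \sum_k c k * (v 0 m * tangent k y 0 m)).
    apply: eq_bigr => m _; rewrite expr2 {2}vE mulr_sumr.
    by apply: eq_bigr => k _; rewrite mulrCA.
  rewrite exchange_big/= big1// => k _; rewrite -mulr_sumr.
  have := vk k; case: (ltnP k n) => kn vk0.
    rewrite [X in _ * X](_ : _ = 0) ?mulr0// -[RHS]vk0.
    by apply: eq_bigr => l _; rewrite mxE kn.
  rewrite (_ : c k = 0) ?mul0r// -[RHS]vk0.
  by apply: eq_bigr => l _; rewrite mxE ltnNge kn.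
apply/rowP => m; rewrite mxE; apply/eqP; rewrite -sqrf_eq0; apply/eqP.
have /psumr_eq0P : forall i : 'I_p, true -> 0 <= v 0 i ^+ 2 by move=> i _; exact: sqr_ge0.
by move=> /(_ sq0 m); apply.
Qed.

(** The second derivatives of the constraints, multiplied by the inverse of the
frame: on tangent vectors this is, up to sign, the second fundamental form of N. *)
Definition second_ff (l j m : 'I_p) (y : 'rV[R]_p) : R :=
  \sum_(k : 'I_p | (n <= k)%N)
    - ('D_(delta_mx 0 m) ('D_(delta_mx 0 j) (phi_co k)) y * invmx (frame_mx y) k l).

Lemma smooth_second_ff l j m : smooth_on U (second_ff l j m).
Proof.
have sk (k : 'I_p) : smooth_on U (fun y => if (n <= k)%N then
    - ('D_(delta_mx 0 m) ('D_(delta_mx 0 j) (phi_co k)) y * invmx (frame_mx y) k l) else 0).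
  case: (n <= k)%N; last exact: smooth_cst.
  apply: (smoothN oU).
  apply: (@smoothM R _ U _ _ oU (smooth_D _ (smooth_D _ (@smooth_phi_co k)))).
  apply: smooth_invmx => //; last exact: frame_mx_unit.
  move=> a b; have [ab|ab] := boolP (b < n)%N.
    by apply: smooth_eq (@smooth_tangent b a) => // y _; rewrite mxE ab.
  by apply: smooth_eq (smooth_D (delta_mx 0 a) (@smooth_phi_co b)) => // y _; rewrite mxE (negbTE ab).
apply: smooth_eq (smooth_sum (index_enum _) oU sk) => // y _.
by rewrite /second_ff [RHS]big_mkcond.
Qed.

Section Map.
Variables (D : set (R * R)) (w : R * R -> 'rV[R]_p).
Hypothesis oD : open D.
Hypothesis sw : smooth_on D w.
Hypothesis wN : forall x, D x -> N (w x) /\ U (w x).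

Lemma smooth_w_co j : smooth_on D (fun y => w y 0 j).
Proof. by have [h _] := smooth_rV w oD; exact: (h sw j). Qed.

(** The k-th constraint vanishes along w; it is differentiated twice along v. *)
Lemma constraint_second (k : 'I_p) x v : (n <= k)%N -> D x ->
  \sum_l 'D_v ('D_v (fun y => w y 0 l)) x * 'D_(delta_mx 0 l) (phi_co k) (w x) =
  - \sum_j \sum_m 'D_(delta_mx 0 m) ('D_(delta_mx 0 j) (phi_co k)) (w x) *
      ('D_v (fun y => w y 0 j) x * 'D_v (fun y => w y 0 m) x).
Proof.
move=> nk Dx.
have DU y : D y -> U (w y) by move=> /wN[].
pose G j y := 'D_(delta_mx 0 j) (phi_co k) (w y).
pose W j := 'D_v (fun y => w y 0 j).
have sG j : smooth_on D (G j).
  exact: smooth_comp_rV oD oU DU (smooth_D (delta_mx 0 j) (@smooth_phi_co k)) sw.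
have first y : D y -> \sum_j W j y * G j y = 0.
  move=> Dy; rewrite -(derive_comp_rV v oD oU Dy DU (@smooth_phi_co k) sw).
  have -> : 'D_v (fun z => phi_co k (w z)) y = 'D_v (fun=> 0 : R) y.
    apply: (iterD_eq [:: v] oD _ Dy) => z Dz.
    by have [Nz Uz] := wN Dz; have [H _] := slice Uz; exact: H.
  by rewrite derive_cst.
have d1 j : derivable (W j) x v by exact: smooth_drv (smooth_D v (smooth_w_co j)) Dx.
have d2 j : derivable (G j) x v by exact: smooth_drv (sG j) Dx.
have [_ E] := derive_sum_mul d1 d2.
have E0 : 'D_v (fun y => \sum_j W j y * G j y) x = 0.
  have -> : 'D_v (fun y => \sum_j W j y * G j y) x = 'D_v (fun=> 0 : R) x.
    exact: (iterD_eq [:: v] oD first Dx).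
  by rewrite derive_cst.
move: E; rewrite E0 big_split/= => /esym/eqP; rewrite addr_eq0 => /eqP ->.
congr (- _); apply: eq_bigr => j _.
rewrite (derive_comp_rV v oD oU Dx DU (smooth_D (delta_mx 0 j) (@smooth_phi_co k)) sw).
rewrite mulr_sumr; apply: eq_bigr => m _; rewrite mulrCA mulrA mulrC.
by rewrite mulrC -mulrA mulrCA mulrA mulrC.
Qed.

Theorem harmonic_normal_form x l : D x ->
  (forall k : 'I_p, (k < n)%N -> \sum_l lap (fun y => w y 0 l) x * tangent k (w x) 0 l = 0) ->
  lap (fun y => w y 0 l) x = \sum_j \sum_m second_ff l j m (w x) *
    ('D_(e1 R) (fun y => w y 0 j) x * 'D_(e1 R) (fun y => w y 0 m) x +
     'D_(e2 R) (fun y => w y 0 j) x * 'D_(e2 R) (fun y => w y 0 m) x).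
Proof.
move=> Dx EL; have [_ Ux] := wN Dx.
pose Q j m := 'D_(e1 R) (fun y => w y 0 j) x * 'D_(e1 R) (fun y => w y 0 m) x +
     'D_(e2 R) (fun y => w y 0 j) x * 'D_(e2 R) (fun y => w y 0 m) x.
pose L : 'rV[R]_p := \row_l lap (fun y => w y 0 l) x.
pose rhs : 'rV[R]_p := \row_k if (n <= k)%N then
  - \sum_j \sum_m 'D_(delta_mx 0 m) ('D_(delta_mx 0 j) (phi_co k)) (w x) * Q j m else 0.
have LM : L *m frame_mx (w x) = rhs.
  apply/rowP => k; rewrite !mxE; case: (ltnP k n) => kn.
    by rewrite -[RHS](EL k kn); apply: eq_bigr => i _; rewrite !mxE kn.
  have E v := @constraint_second k x v kn Dx.
  transitivity (\sum_l 'D_(e1 R) ('D_(e1 R) (fun y => w y 0 l)) x * 'D_(delta_mx 0 l) (phi_co k) (w x)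
    + \sum_l 'D_(e2 R) ('D_(e2 R) (fun y => w y 0 l)) x * 'D_(delta_mx 0 l) (phi_co k) (w x)).
    rewrite -big_split/=; apply: eq_bigr => i _.
    by rewrite !mxE ltnNge kn /= -mulrDl.
  apply: (etrans (congr2 +%R (E (e1 R)) (E (e2 R)))).
  rewrite -opprD -big_split/=; congr (- _); apply: eq_bigr => j _.
  by rewrite -big_split/=; apply: eq_bigr => m _; rewrite -mulrDr.
have -> : lap (fun y => w y 0 l) x = (rhs *m invmx (frame_mx (w x))) 0 l.
  by rewrite -LM mulmxK ?frame_mx_unit// mxE.
rewrite mxE.
under [RHS]eq_bigr => j _ do under eq_bigr => m _ do rewrite /second_ff mulr_suml.
under [RHS]eq_bigr => j _ do rewrite exchange_big/=.
rewrite exchange_big/= [RHS]big_mkcond/=; apply: eq_bigr => k _; rewrite mxE.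
case: ifP => _; last by rewrite mul0r.
rewrite mulNr mulr_suml -sumrN; apply: eq_bigr => j _; rewrite mulr_suml -sumrN.
apply: eq_bigr => m _; rewrite mulNr; congr (- _); rewrite mulrAC; congr (_ * _).
Qed.

End Map.
End NormalForm.

(** * Cylinder coordinates *)

Section Polar.
Variable R : realType.
Implicit Types (t : R) (z : R * R).

Lemma enorm2_continuous : continuous (@enorm2 R).
Proof.
move=> x; apply: (@continuous_comp _ _ _ (fun x : R * R => x.1 ^+ 2 + x.2 ^+ 2) Num.sqrt); last exact: sqrt_continuous.
apply: (@continuousD _ _ _ (fun x : R * R => x.1 ^+ 2) (fun x : R * R => x.2 ^+ 2)).
  by apply: (@continuous_comp _ _ _ fst (fun x : R => x ^+ 2)); [exact: cvg_fst|exact: exprn_continuous].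
by apply: (@continuous_comp _ _ _ snd (fun x : R => x ^+ 2)); [exact: cvg_snd|exact: exprn_continuous].
Qed.

Lemma open_eball (r : R) : open (eball r).
Proof. by apply: (@open_comp _ _ (@enorm2 R) [set x | x < r]) => // x _; exact: enorm2_continuous. Qed.

Definition cyls t z : R * R := cyl (z.1 + t, z.2).

Lemma enorm2_cyl z : enorm2 (cyl z) = expR z.1.
Proof.
rewrite /enorm2 /cyl/= !exprMn -mulrDr cos2Dsin2 mulr1 sqrtr_sqr ger0_norm// expR_ge0.
Qed.

Lemma cyls_in t z : z.1 + t < 0 -> eball 1 (cyls t z).
Proof. by move=> zt; rewrite /eball/= enorm2_cyl/= -expR0 ltr_expR. Qed.

Lemma smooth_cyls t : smooth_on setT (fun z => (cyls t z).1) /\ smooth_on setT (fun z => (cyls t z).2).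
Proof.
have F := frame_pair (frame_R R) (frame_R R).
have s1 : smooth_on [set: R * R] (fun z => expR (z.1 + t)).
  apply: (@smooth_comp_R R _ setT (@expR R) (fun z => z.1 + t) F openT (@smooth_expR R)).
  apply: (@smoothD R _ R setT fst (fun=> t) openT); [exact: smooth_fst|exact: smooth_cst].
have [sc ss] := smooth_trig R.
have s2 : smooth_on [set: R * R] (fun z => cos z.2).
  exact: (@smooth_comp_R R _ setT (@cos R) snd F openT sc (@smooth_snd R)).
have s3 : smooth_on [set: R * R] (fun z => sin z.2).
  exact: (@smooth_comp_R R _ setT (@sin R) snd F openT ss (@smooth_snd R)).
by split; [exact: smoothM openT s1 s2|exact: smoothM openT s1 s3].
Qed.

(** The map is the complex exponential, and each derivative is again one of its
components, up to sign. *)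
Lemma derive_cyls t z :
  [/\ 'D_(e1 R) (fun z => (cyls t z).1) z = (cyls t z).1,
      'D_(e1 R) (fun z => (cyls t z).2) z = (cyls t z).2,
      'D_(e2 R) (fun z => (cyls t z).1) z = - (cyls t z).2 &
      'D_(e2 R) (fun z => (cyls t z).2) z = (cyls t z).1].
Proof.
have dE (c : R) : 'D_1 (fun s : R => expR s * c) (z.1 + t) = expR (z.1 + t) * c.
  have := is_deriveM (is_derive_expR (z.1 + t)) (is_derive_cst c (z.1 + t) 1).
  by move=> [_ E]; apply: (etrans E); rewrite scaler0 add0r /GRing.scale/= mulrC.
have dC (c : R) : 'D_1 (fun s : R => c * cos s) z.2 = - (c * sin z.2).
  have := is_deriveM (is_derive_cst c z.2 1) (is_derive_cos z.2).
  by move=> [_ E]; apply: (etrans E); rewrite scaler0 addr0 /GRing.scale/= mulrN.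
have dS (c : R) : 'D_1 (fun s : R => c * sin s) z.2 = c * cos z.2.
  have := is_deriveM (is_derive_cst c z.2 1) (is_derive_sin z.2).
  by move=> [_ E]; apply: (etrans E); rewrite scaler0 addr0 /GRing.scale/=.
split.
- rewrite -[RHS](dE (cos z.2)); apply: derive_along => h.
  by rewrite /cyls/cyl/e1/= scaler0 addr0 addrAC.
- rewrite -[RHS](dE (sin z.2)); apply: derive_along => h.
  by rewrite /cyls/cyl/e1/= scaler0 addr0 addrAC.
- rewrite -[RHS](dC (expR (z.1 + t))); apply: derive_along => h.
  by rewrite /cyls/cyl/e2/= scaler0 addr0.
- rewrite -[RHS](dS (expR (z.1 + t))); apply: derive_along => h.
  by rewrite /cyls/cyl/e2/= scaler0 addr0.
Qed.

Section Lap.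
Variables (E D : set (R * R)) (t : R).
Hypothesis oE : open E.
Hypothesis oD : open D.
Hypothesis DE : forall y, D y -> E (cyls t y).

Lemma smooth_polar (g : R * R -> R) : smooth_on E g -> smooth_on D (fun y => g (cyls t y)).
Proof.
move=> sg; have [s1 s2] := smooth_cyls t.
by apply: (smooth_comp2 oD oE DE sg); [exact: smooth_sub s1|exact: smooth_sub s2].
Qed.

Lemma derive_polar (g : R * R -> R) z : smooth_on E g -> D z ->
  'D_(e1 R) (fun y => g (cyls t y)) z =
    (cyls t z).1 * 'D_(e1 R) g (cyls t z) + (cyls t z).2 * 'D_(e2 R) g (cyls t z) /\
  'D_(e2 R) (fun y => g (cyls t y)) z =
    - (cyls t z).2 * 'D_(e1 R) g (cyls t z) + (cyls t z).1 * 'D_(e2 R) g (cyls t z).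
Proof.
move=> sg Dz; have [s1 s2] := smooth_cyls t.
have [d1 d2 d3 d4] := derive_cyls t z.
have s1' : smooth_on D (fun z => (cyls t z).1) by exact: smooth_sub s1.
have s2' : smooth_on D (fun z => (cyls t z).2) by exact: smooth_sub s2.
split.
  by rewrite (derive_comp2 (e1 R) oD oE Dz DE sg s1' s2') d1 d2.
by rewrite (derive_comp2 (e2 R) oD oE Dz DE sg s1' s2') d3 d4.
Qed.

Lemma derive_mul2 (f g : R * R -> R) z v : smooth_on D f -> smooth_on D g -> D z ->
  'D_v (fun y => f y * g y) z = 'D_v f z * g z + f z * 'D_v g z.
Proof.
move=> sf sg Dz.
have := deriveM (smooth_drv (v := v) sf Dz) (smooth_drv (v := v) sg Dz).
by move=> E'; apply: (etrans E'); rewrite /GRing.scale/= addrC mulrC.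
Qed.

Lemma derive_add2 (f g : R * R -> R) z v : smooth_on D f -> smooth_on D g -> D z ->
  'D_v (fun y => f y + g y) z = 'D_v f z + 'D_v g z.
Proof.
by move=> sf sg Dz; exact: deriveD (smooth_drv (v := v) sf Dz) (smooth_drv (v := v) sg Dz).
Qed.

(** Conformality: the coefficients (x, y) and (-y, x) of the first derivatives form
an orthogonal frame of length exp (z.1 + t), and the first order terms cancel. *)
Lemma lap_polar (g : R * R -> R) z : smooth_on E g -> D z ->
  lap (fun y => g (cyls t y)) z = expR (z.1 + t) ^+ 2 * lap g (cyls t z).
Proof.
move=> sg Dz; have [s1 s2] := smooth_cyls t.
have [d1 d2 d3 d4] := derive_cyls t z.
pose X y := (cyls t y).1; pose Y y := (cyls t y).2.
have sX : smooth_on D X by exact: smooth_sub s1.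
have sY : smooth_on D Y by exact: smooth_sub s2.
have sYN : smooth_on D (fun y => - Y y) by exact: smoothN.
pose P y := 'D_(e1 R) g (cyls t y); pose Q y := 'D_(e2 R) g (cyls t y).
have sDg1 := smooth_D (e1 R) sg; have sDg2 := smooth_D (e2 R) sg.
have sP : smooth_on D P by exact: (smooth_polar sDg1).
have sQ : smooth_on D Q by exact: (smooth_polar sDg2).
have [p1 p2] := derive_polar sDg1 Dz.
have [q1 q2] := derive_polar sDg2 Dz.
have L1 : 'D_(e1 R) ('D_(e1 R) (fun y => g (cyls t y))) z =
    'D_(e1 R) (fun y => X y * P y + Y y * Q y) z.
  by apply: (iterD_eq [:: e1 R] oD _ Dz) => y Dy; have [-> _] := derive_polar sg Dy.
have L2 : 'D_(e2 R) ('D_(e2 R) (fun y => g (cyls t y))) z =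
    'D_(e2 R) (fun y => (- Y y) * P y + X y * Q y) z.
  by apply: (iterD_eq [:: e2 R] oD _ Dz) => y Dy; have [_ ->] := derive_polar sg Dy.
have A1 := etrans L1 (etrans (derive_add2 (e1 R) (smoothM oD sX sP) (smoothM oD sY sQ) Dz)
  (congr2 +%R (derive_mul2 (e1 R) sX sP Dz) (derive_mul2 (e1 R) sY sQ Dz))).
have A2 := etrans L2 (etrans (derive_add2 (e2 R) (smoothM oD sYN sP) (smoothM oD sX sQ) Dz)
  (congr2 +%R (derive_mul2 (e2 R) sYN sP Dz) (derive_mul2 (e2 R) sX sQ Dz))).
have dN : 'D_(e2 R) (fun y => - Y y) z = - X z.
  by rewrite -[X z]d4; exact: deriveN (smooth_drv (v := e2 R) sY Dz).
have XY : expR (z.1 + t) ^+ 2 = X z ^+ 2 + Y z ^+ 2.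
  by rewrite /X /Y /cyls /cyl/= !exprMn -mulrDr cos2Dsin2 mulr1.
have alg (x y p q a b c d x1 y1 n2 x2 a1 a2 c1 c2 L M ee : R) :
    L = x1 * p + x * a1 + (y1 * q + y * c1) -> M = n2 * p + - y * a2 + (x2 * q + x * c2) ->
    x1 = x -> y1 = y -> n2 = - x -> x2 = - y ->
    a1 = x * a + y * b -> a2 = - y * a + x * b -> c1 = x * c + y * d -> c2 = - y * c + x * d ->
    ee = x ^+ 2 + y ^+ 2 -> L + M = ee * (a + d).
  by move=> -> -> -> -> -> -> -> -> -> -> ->; ring.
exact: (alg _ _ _ _ _ _ _ _ _ _ _ _ _ _ _ _ _ _ _ A1 A2 d1 d2 dN d3 p1 p2 q1 q2 XY).
Qed.

End Lap.
End Polar.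

Section Rescaled.
Variables (R : realType) (n p : nat) (N U V : set 'rV[R]_p) (Phi Psi : 'rV[R]_p -> 'rV[R]_p).
Hypothesis oU : open U.
Hypothesis oV : open V.
Hypothesis sPhi : smooth_on U Phi.
Hypothesis sPsi : smooth_on V Psi.
Hypothesis PhiK : forall y, U y -> V (Phi y) /\ Psi (Phi y) = y.
Hypothesis PsiK : forall z, V z -> U (Psi z) /\ Phi (Psi z) = z.
Hypothesis slice : forall y, U y -> (N y <-> forall j : 'I_p, (n <= j)%N -> Phi y 0 j = 0).
Variables (u : R * R -> 'rV[R]_p) (t e : R) (P : 'rV[R]_p) (v : R * R -> 'rV[R]_p).
Hypothesis hu : harmonic_map (eball 1) N u.
Hypothesis e0 : 0 < e.
Hypothesis vE : forall z, P + e *: v z = u (cyls t z).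

Lemma rescaled_smooth (B : set (R * R)) : open B -> (forall z, B z -> z.1 + t < 0) ->
  smooth_on B v.
Proof.
move=> oB Bt; have [su _ _] := hu; apply/(smooth_rV _ oB) => l.
have BE z : B z -> eball 1 (cyls t z) by move=> /Bt; exact: cyls_in.
have [h _] := smooth_rV u (@open_eball R 1).
have sp := smooth_polar (@open_eball R 1) oB BE (h su l).
have sB : smooth_on B (fun z => e^-1 * (u (cyls t z) 0 l - P 0 l)).
  apply: (@smoothM R _ B (fun=> e^-1) _ oB); first exact: smooth_cst.
  apply: (@smoothB R _ B _ (fun=> P 0 l) oB sp); exact: smooth_cst.
apply: smooth_eq sB => // z _.
by rewrite -vE !mxE addrAC subrr add0r mulrA mulVf ?mul1r// gt_eqF.
Qed.

(** The map P + e v is harmonic in cylinder coordinates; passing to v divides the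
Laplacian by e and the quadratic gradient term by e^2. *)
Lemma rescaled_normal_form (B : set (R * R)) z l : open B -> (forall z, B z -> z.1 + t < 0) ->
  (forall z, B z -> U (P + e *: v z)) -> B z ->
  lap (fun y => v y 0 l) z = e * \sum_j \sum_m second_ff n Phi Psi l j m (P + e *: v z) *
    ('D_(e1 R) (fun y => v y 0 j) z * 'D_(e1 R) (fun y => v y 0 m) z +
     'D_(e2 R) (fun y => v y 0 j) z * 'D_(e2 R) (fun y => v y 0 m) z).
Proof.
move=> oB Bt BU Bz; have [su Nu _] := hu.
have BE y : B y -> eball 1 (cyls t y) by move=> /Bt; exact: cyls_in.
have sv := rescaled_smooth oB Bt.
have svl j : smooth_on B (fun y => v y 0 j) by have [h _] := smooth_rV v oB; exact: (h sv j).
pose w y := P + e *: v y.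
have wE j : (fun y => w y 0 j) = (fun y => P 0 j + e * v y 0 j).
  by apply/funext => y; rewrite /w !mxE.
have Dw1 j d y : B y -> 'D_d (fun y => w y 0 j) y = e * 'D_d (fun y => v y 0 j) y.
  move=> By; rewrite wE.
  have dv := smooth_drv (v := d) (svl j) By.
  have E1 := deriveD (derivable_cst (P 0 j) y d) (derivableZ (k := e) dv).
  apply: (etrans E1); rewrite derive_cst add0r.
  exact: deriveZ.
have Dw2 j d : 'D_d ('D_d (fun y => w y 0 j)) z = e * 'D_d ('D_d (fun y => v y 0 j)) z.
  have -> : 'D_d ('D_d (fun y => w y 0 j)) z = 'D_d (e *: 'D_d (fun y => v y 0 j)) z.
    by apply: (iterD_eq [:: d] oB _ Bz) => y By; rewrite Dw1.
  by rewrite deriveZ//; exact: smooth_drv (smooth_D d (svl j)) Bz.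
have Lw j : lap (fun y => w y 0 j) z = e * lap (fun y => v y 0 j) z.
  by rewrite /lap mulrDr; exact: (congr2 +%R (Dw2 j _) (Dw2 j _)).
have sw : smooth_on B w.
  apply/(smooth_rV _ oB) => j; rewrite wE.
  apply: (@smoothD R _ R B (fun=> P 0 j) _ oB); first exact: smooth_cst.
  apply: (@smoothM R _ B (fun=> e) _ oB); [exact: smooth_cst|exact: svl].
have wN y : B y -> N (w y) /\ U (w y).
  by move=> By; split; [rewrite /w vE; apply: Nu; exact: BE|exact: BU].
have [h _] := smooth_rV u (@open_eball R 1).
have EL (k : 'I_p) : (k < n)%N -> \sum_l lap (fun y => w y 0 l) z * tangent Phi Psi k (w z) 0 l = 0.
  move=> kn.
  have Uc : U (u (cyls t z)) by rewrite -vE; exact: BU.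
  have := euler_lagrange oU oV sPhi sPsi PhiK PsiK slice (@open_eball R 1) hu kn (BE z Bz) Uc.
  move=> E; rewrite -[RHS](mulr0 (expR (z.1 + t) ^+ 2)) -[in RHS]E mulr_sumr.
  apply: eq_bigr => i _; rewrite mulrA; congr (_ * _); last by rewrite /w vE.
  have -> : (fun y => w y 0 i) = (fun y => u (cyls t y) 0 i).
    by apply/funext => y; rewrite /w vE.
  exact: (lap_polar (@open_eball R 1) oB BE (h su i) Bz).
have := harmonic_normal_form oU oV sPhi sPsi PhiK slice oB sw wN l Bz EL.
rewrite Lw => H; apply: (mulfI (lt0r_neq0 e0)); rewrite H mulrA mulr_sumr.
apply: eq_bigr => j _; rewrite mulr_sumr; apply: eq_bigr => m _.
have alg (A a b c d a' b' c' d' : R) : a' = e * a -> b' = e * b -> c' = e * c -> d' = e * d ->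
  A * (a' * b' + c' * d') = e * e * (A * (a * b + c * d)) by move=> -> -> -> ->; ring.
exact: (alg _ _ _ _ _ _ _ _ _ (Dw1 _ _ _ Bz) (Dw1 _ _ _ Bz) (Dw1 _ _ _ Bz) (Dw1 _ _ _ Bz)).
Qed.

End Rescaled.

(** * Limits of the coefficients at one end of the neck *)

Section Sequences.
Variable R : realType.

Lemma increasing_subseq (f : nat -> nat) : {homo f : i j / (i < j)%N} -> f @ \oo --> \oo.
Proof.
move=> hf; have le i : (i <= f i)%N.
  by elim: i => // i IH; apply: leq_ltn_trans IH _; exact: hf.
move=> A [m _ mA]; exists m => // k mk; apply: mA => /=; exact: leq_trans (le k).
Qed.

Lemma bolzano_weierstrass_rV p (x : nat -> 'rV[R]_p) (C : R) : (forall i, `|x i| <= C) ->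
  exists2 f : nat -> nat, {homo f : i j / (i < j)%N} &
  exists l : 'rV[R]_p, (fun i => x (f i)) @ \oo --> l.
Proof.
move=> xC.
suff [f hf cf] : exists2 f : nat -> nat, {homo f : i j / (i < j)%N} &
    forall j, j \in enum 'I_p -> cvgn (fun i => x (f i) 0 j).
  exists f => //; exists (\row_j lim ((fun i => x (f i) 0 j) @ \oo)).
  apply/cvgrPdist_le => e e0.
  have H j : \forall i \near \oo, `|lim ((fun i => x (f i) 0 j) @ \oo) - x (f i) 0 j| <= e.
    have /cvgrPdist_le := cf j (mem_enum _ _); exact.
  have HH : \forall i \near \oo, forall j, `|lim ((fun i => x (f i) 0 j) @ \oo) - x (f i) 0 j| <= e.
    exact: filter_forall H.
  move: HH; apply: filterS => i Hi.
  by apply: rV_norm_le; [exact: ltW|move=> j; rewrite !mxE; exact: Hi].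
elim: (enum 'I_p) => [|j s [f hf cf]]; first by exists id.
have bx : bounded_fun (fun i => x (f i) 0 j).
  exists C; split; first exact: num_real.
  move=> D CD i _; apply: le_trans (mx_coord_le _ _ _) _.
  exact: le_trans (xC _) (ltW CD).
have [g ig cg] := bolzano_weierstrass bx.
have hg : {homo g : i k / (i < k)%N}
  by move=> i k ik; rewrite (leqW_mono (ig : {mono g : m n / (m <= n)%N})).
exists (f \o g); first by move=> i k ik; apply: hf; exact: hg.
move=> k; rewrite inE => /orP[/eqP ->|ks]; first exact: cg.
have /cvg_ex[l xl] := cf k ks; apply/cvg_ex; exists l.
exact: (cvg_comp g (fun i => x (f i) 0 k) (increasing_subseq hg) xl).
Qed.

Lemma coord_cvg p (x : nat -> 'rV[R]_p) (l : 'rV[R]_p) j : x @ \oo --> l -> (fun i => x i 0 j) @ \oo --> l 0 j.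
Proof.
move=> xl.
exact: (cvg_comp x (fun v : 'rV[R]_p => v 0 j) xl (@coord_continuous _ _ _ 0 j l)).
Qed.

Lemma dotp_cvg p (x y : nat -> 'rV[R]_p) (a b : 'rV[R]_p) : x @ \oo --> a -> y @ \oo --> b ->
  (fun i => dotp (x i) (y i)) @ \oo --> dotp a b.
Proof.
move=> xa yb; apply: (@cvg_big _ _ +%R 0 predT add_continuous _ _ (index_enum _)) => j _.
by apply: cvgM; exact: coord_cvg.
Qed.

Lemma dotp_coord p (v : 'rV[R]_p) j : v 0 j ^+ 2 <= dotp v v.
Proof.
rewrite /dotp (bigD1 j)//= expr2 lerDl; apply: sumr_ge0 => k _.
by rewrite -expr2 sqr_ge0.
Qed.

Lemma dotp_le p (v w : 'rV[R]_p) A B : `|v| <= A -> `|w| <= B -> `|dotp v w| <= p%:R * (A * B).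
Proof.
move=> vA wB; apply: le_trans (ler_norm_sum _ _ _) _.
apply: (@le_trans _ _ (\sum_(j < p) A * B)).
  apply: ler_sum => j _; rewrite normrM; apply: ler_pM => //.
    exact: le_trans (mx_coord_le _ _ _) vA.
  exact: le_trans (mx_coord_le _ _ _) wB.
by rewrite sumr_const card_ord mulr_natl.
Qed.

Lemma sqrt_cvg0 (x : nat -> R) : x @ \oo --> (0 : R) -> (fun i => Num.sqrt (x i)) @ \oo --> (0 : R).
Proof. by move=> x0; rewrite -[X in _ --> X]sqrtr0; apply: cvg_comp x0 _; exact: sqrt_continuous. Qed.

(** With s the fourth root of x this is s ln(1/s) <= 1. *)
Lemma sqrt_ln (x : R) : 0 < x -> x <= 1 ->
  `|Num.sqrt x * ln x| <= 4 * Num.sqrt (Num.sqrt x).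
Proof.
move=> x0 x1; set s := Num.sqrt (Num.sqrt x).
have s0 : 0 < s by rewrite !sqrtr_gt0.
have ss : Num.sqrt x = s * s by rewrite -expr2 sqr_sqrtr// sqrtr_ge0.
have xs : x = s ^+ 4 by rewrite -[LHS](sqr_sqrtr (ltW x0)) ss; ring.
rewrite ss {1}xs lnXn//.
have l1 : ln s^-1 < s^-1 by apply: ln_sublinear; rewrite invr_gt0.
have l2 : ln s <= 0.
  apply: ln_le0; rewrite -(@sqrtr1 R) ler_wsqrtr// -(@sqrtr1 R) ler_wsqrtr//.
rewrite lnV ?posrE// in l1.
have -> : s * s * (ln s *+ 4) = 4 * s * (s * ln s) by rewrite -mulr_natl; ring.
rewrite normrM (gtr0_norm (mulr_gt0 _ s0))// normrM (gtr0_norm s0) (ler0_norm l2).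
rewrite -[leRHS]mulr1 ler_pM2l ?mulr_gt0// -(mulfV (lt0r_neq0 s0)) ler_pM2l//.
exact: ltW.
Qed.

Lemma cos_sin_le1 (th : R) : `|cos th| <= 1 /\ `|sin th| <= 1.
Proof.
have := cos2Dsin2 th; have := sqr_ge0 (cos th); have := sqr_ge0 (sin th) => h1 h2 h3.
by split; rewrite -(@ler_pXn2r _ 2)// ?nnegrE// expr1n real_normK ?num_real//; lra.
Qed.

End Sequences.

Section Coefficients.
Variables (R : realType) (p : nat) (T : R * R -> 'rV[R]_p) (pinf X0 Y0 : 'rV[R]_p).
Variables (lam : nat -> R) (delta C M : R).
Variables (G : nat -> R -> R -> 'rV[R]_p) (B : nat -> R -> 'rV[R]_p).
Variables (X Y : nat -> 'rV[R]_p) (Z : nat -> R -> 'rV[R]_p).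
Hypothesis lam0 : forall i, 0 < lam i.
Hypothesis lamc : lam @ \oo --> (0 : R).
Hypothesis d0 : 0 < delta.
Hypothesis C0 : 0 <= C.
Hypothesis M0 : 0 <= M.
Hypothesis TT : taylor1_at0 T pinf X0 Y0.
Hypothesis ZM : forall i th, `|Z i th| <= M.
Hypothesis GT : forall t th, t <= ln delta -> t < 0 ->
  (fun i => G i t th) @ \oo --> T (cyl (t, th)).
Let eta i t := expR t + lam i * expR (- t).
Hypothesis GB : forall i t th, ln (lam i / delta) <= t <= ln delta ->
  `|G i t th - (B i t + (expR t * cos th) *: X i + (expR t * sin th) *: Y i
     + (lam i * expR (- t)) *: Z i th)| <= C * (eta i t * Num.sqrt (eta i t)).

Lemma lam_eventually_le e : 0 < e -> \forall i \near \oo, lam i <= e.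
Proof.
move=> e0; have /cvgrPdist_le /(_ e e0) := lamc; apply: filterS => i.
by rewrite sub0r normrN gtr0_norm.
Qed.

Lemma cyl_norm (t th : R) : `|cyl (t, th)| <= expR t.
Proof.
rewrite prod_normE/= ge_max !normrM (gtr0_norm (expR_gt0 t)).
have cs := cos_sin_le1 th.
by apply/andP; split; rewrite -[leRHS]mulr1 ler_pM2l ?expR_gt0//; case: cs.
Qed.

(** With r = exp t small but fixed, the Taylor remainder and the error of the
expansion are each at most e r / 4, and so are the remaining terms once i is
large. *)
Lemma direction_estimate e : 0 < e -> exists t, [/\ t <= ln delta, t < 0 &
  forall th, \forall i \near \oo,
  `|(B i t - pinf) + expR t *: (cos th *: (X i - X0) + sin th *: (Y i - Y0))| <= e * expR t].
Proof.
move=> e0; have e4 : 0 < e / 4 by rewrite divr_gt0.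
have := TT; move=> /eqoP /(_ _ e4) /nbhs_ballP[k /= k0 Hk].
have [s s0 sE] : exists2 s : R, 0 < s & C * (2 * s) <= e / 4.
  exists (e / 8 / (C + 1)); first by rewrite !divr_gt0// ltr_wpDl.
  have C1 : 0 < C + 1 by rewrite ltr_wpDl.
  have -> : C * (2 * (e / 8 / (C + 1))) = (e / 4) * (C / (C + 1)).
    by field; rewrite lt0r_neq0.
  by rewrite -[leRHS]mulr1 ler_pM2l// ler_pdivrMr// mul1r lerDl.
(* Below k the Taylor estimate holds, below delta the expansion, and the bound on
   sqrt (2 r) makes C (2 r)^(3/2) at most e r / 4. *)
have [r [r0 rk rd r1 rs]] : exists r : R, [/\ 0 < r, r < k, r <= delta, r < 1 & Num.sqrt (2 * r) <= s].
  exists (Num.min (Num.min (k / 2) delta) (Num.min (1 / 2) (s ^+ 2 / 2))).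
  have s2 : 0 < s ^+ 2 by rewrite exprn_gt0.
  split.
  - by rewrite !lt_min d0 !divr_gt0.
  - rewrite !gt_min; apply/orP; left; apply/orP; left; lra.
  - by rewrite !ge_min lexx orbT.
  - by rewrite !gt_min; apply/orP; right; apply/orP; left; lra.
  - have ss : Num.sqrt (s ^+ 2) = s by rewrite sqrtr_sqr gtr0_norm.
    rewrite -[leRHS]ss ler_wsqrtr//.
    by rewrite mulrC -ler_pdivlMr// !ge_min lexx !orbT.
have rE : expR (ln r) = r by rewrite lnK ?posrE.
exists (ln r); split.
- by rewrite ler_ln ?posrE.
- by apply: ln_lt0; rewrite r0.
move=> th.
have rl : ln r <= ln delta by rewrite ler_ln ?posrE.
(* Three conditions on lam i: the term with Z is small, eta is at most 2 r, and
   ln r lies in the range of the expansion. *)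
have r2 : 0 < e / 4 * r / r^-1 / (M + 1) by rewrite !divr_gt0 ?invr_gt0// ?mulr_gt0// ltr_wpDl.
have A1 := lam_eventually_le r2.
have A2 := lam_eventually_le (exprn_gt0 2 r0).
have A3 := lam_eventually_le (mulr_gt0 r0 d0).
have er : 0 < e / 4 * r by rewrite mulr_gt0.
have /cvgrPdist_le/(_ _ er) A4 := @GT (ln r) th rl (ln_lt0 (introT andP (conj r0 r1))).
near=> i.
have a1 : lam i <= e / 4 * r / r^-1 / (M + 1) by near: i.
have a2 : lam i <= r ^+ 2 by near: i.
have a3 : lam i <= r * delta by near: i.
have a4 : `|T (cyl (ln r, th)) - G i (ln r) th| <= e / 4 * r by near: i.
have := @GB i (ln r) th; rewrite rl ler_ln ?posrE ?divr_gt0// ler_pdivrMr// a3 => /(_ isT).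
rewrite /eta expRN rE.
have := Hk (cyl (ln r, th)); rewrite -ball_normE/= sub0r normrN.
have cn := cyl_norm (ln r) th; rewrite rE in cn.
move=> /(_ (le_lt_trans cn rk)); rewrite rE => T1 G1.
have T2 : `|T (cyl (ln r, th)) - (pinf + (r * cos th) *: X0 + (r * sin th) *: Y0)| <= e / 4 * r.
  by apply: le_trans T1 _; rewrite ler_wpM2l// ltW.
have eta2 : r + lam i / r <= 2 * r.
  rewrite mulr_natl mulr2n lerD2l ler_pdivrMr//.
have eta0 : 0 <= r + lam i / r by rewrite addr_ge0 ?divr_ge0 ?ltW.
have G2 : C * ((r + lam i / r) * Num.sqrt (r + lam i / r)) <= e / 4 * r.
  apply: (@le_trans _ _ (C * ((2 * r) * s))).
    rewrite ler_wpM2l// ler_pM// ?sqrtr_ge0//.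
    by apply: le_trans rs; rewrite ler_wsqrtr.
  have -> : C * (2 * r * s) = C * (2 * s) * r by ring.
  by rewrite ler_pM2r.
have Z1 : `|(lam i / r) *: Z i th| <= e / 4 * r.
  rewrite normrZ ger0_norm; last by rewrite divr_ge0 ?ltW.
  move: a1; rewrite ler_pdivlMr ?ltr_wpDl// ler_pdivlMr ?invr_gt0// => a1.
  apply: le_trans a1; rewrite mulrAC ler_pM2r ?invr_gt0// ler_pM2l//.
  by apply: le_trans (ZM i th) _; rewrite lerDl.
have -> : B i (ln r) - pinf + r *: (cos th *: (X i - X0) + sin th *: (Y i - Y0)) =
   - (G i (ln r) th - (B i (ln r) + (r * cos th) *: X i + (r * sin th) *: Y i + (lam i / r) *: Z i th))
   - (T (cyl (ln r, th)) - G i (ln r) th)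
   + (T (cyl (ln r, th)) - (pinf + (r * cos th) *: X0 + (r * sin th) *: Y0))
   - (lam i / r) *: Z i th.
  apply/rowP => j; rewrite !mxE; ring.
apply: le_trans (ler_normB _ _) _.
have -> : e * r = e / 4 * r + e / 4 * r + e / 4 * r + e / 4 * r by field.
apply: lerD => //; apply: le_trans (ler_normD _ _) _; apply: lerD => //.
apply: le_trans (ler_normB _ _) _; apply: lerD => //.
rewrite normrN; exact: le_trans G1 G2.
Unshelve. all: by end_near.
Qed.

Lemma half_sum_le (b x : 'rV[R]_p) (r e : R) : 0 < r ->
  `|b + r *: x| <= e * r -> `|b - r *: x| <= e * r -> `|b| <= e * r /\ `|x| <= e.
Proof.
move=> r0 h1 h2; split.
  have -> : b = 2^-1 *: ((b + r *: x) + (b - r *: x)).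
    by apply/rowP => j; rewrite !mxE; field.
  rewrite normrZ ger0_norm ?invr_ge0//; have := ler_normD (b + r *: x) (b - r *: x); lra.
rewrite -(ler_pM2r r0); have -> : `|x| * r = `|r *: x| by rewrite normrZ gtr0_norm// mulrC.
have -> : r *: x = 2^-1 *: ((b + r *: x) - (b - r *: x)).
  by apply/rowP => j; rewrite !mxE; field.
rewrite normrZ ger0_norm ?invr_ge0//; have := ler_normB (b + r *: x) (b - r *: x); lra.
Qed.

(** One argument serves both ends of the neck: T is the limit map or the inverted
bubble, t the logarithm of the distance in the domain of T, G the sequence in
this coordinate, Z the terms that belong to the other end. Opposite directions
separate the centre B from the linear terms. *)
Lemma coefficient_limits :
  [/\ X @ \oo --> X0, Y @ \oo --> Y0 &
    forall e, 0 < e -> exists t, \forall i \near \oo, `|B i t - pinf| <= e].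
Proof.
have main e : 0 < e -> exists t, [/\ t < 0, \forall i \near \oo, `|B i t - pinf| <= e * expR t /\ `|X i - X0| <= e
    & \forall i \near \oo, `|Y i - Y0| <= e].
  move=> e0; have [t [_ t0 H]] := direction_estimate e0; exists t; split=> //.
    apply: filterS2 (H 0) (H pi) => i.
    rewrite cos0 sin0 cospi sinpi !scale0r !addr0 scale1r scaleN1r scalerN => h1 h2.
    exact: (half_sum_le (expR_gt0 t) h1 h2).
  apply: filterS2 (H (pi / 2)) (H (- (pi / 2))) => i.
  rewrite cosN sinN cos_pihalf sin_pihalf !scale0r !add0r scale1r scaleN1r scalerN => h1 h2.
  by have [_] := half_sum_le (expR_gt0 t) h1 h2.
split.
- apply/cvgrPdist_le => e /main[t [_ + _]]; apply: filterS => i [_].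
  by rewrite distrC.
- apply/cvgrPdist_le => e /main[t [_ _]]; apply: filterS => i.
  by rewrite distrC.
- move=> e e0; have [t [t0 H _]] := main e e0; exists t; move: H; apply: filterS => i [h _].
  apply: le_trans h _; rewrite -[leRHS]mulr1 ler_pM2l// -expR0 ler_expR ltW//.
Qed.

End Coefficients.

(** * The expansion in the middle of the neck *)

Section Neck.
Variables (R : realType) (p : nat).
Implicit Types (lam : nat -> R) (u : nat -> R * R -> 'rV[R]_p).

Lemma powR_3half (x : R) : 0 < x -> x `^ (1 + 2^-1) = x * Num.sqrt x.
Proof.
move=> x0; rewrite powRD; last by rewrite (gt_eqF x0) implybT.
by rewrite powRr1 ?ltW// powR12_sqrt// ltW.
Qed.

Lemma powR_5quarter (x : R) : 0 < x -> x `^ (1 + 2^-1 / 2) = x * Num.sqrt (Num.sqrt x).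
Proof.
move=> x0; rewrite powRD; last by rewrite (gt_eqF x0) implybT.
by rewrite powRr1 ?ltW// powRrM !powR12_sqrt ?sqrtr_ge0// ltW.
Qed.

(** The expansion with alpha = 1/2, the powers being written as square roots. *)
Definition neck_estimate lam u (ps qs As bs cs ds : nat -> 'rV[R]_p) (M delta C : R) : Prop :=
  [/\ forall i, [/\ `|As i| <= M, `|bs i| <= M, `|cs i| <= M & `|ds i| <= M],
   forall i t th, ln (lam i / delta) <= t <= ln delta ->
     let eta := expR t + lam i * expR (- t) in
     `|u i (cyl (t, th)) - neck_approx (lam i) (ps i) (qs i) (As i) (bs i) (cs i) (ds i) t th|
       <= C * (eta * Num.sqrt eta) &
   forall i, `|dotp (qs i) (qs i) - 2 * lam i * (dotp (As i) (cs i) + dotp (bs i) (ds i))|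
       <= C * (lam i * Num.sqrt (Num.sqrt (lam i)))].

Lemma neck_estimateE lam u ps qs As bs cs ds : (forall i, 0 < lam i) ->
  neck_expansion lam u ps qs As bs cs ds -> exists M delta C : R,
  [/\ 0 <= M, 0 < delta, 0 <= C & neck_estimate lam u ps qs As bs cs ds M delta C].
Proof.
move=> lam0 [[M HM] [delta /andP[d0 d1] H]].
have [|C [H1 H2]] := H 2^-1; first by apply/andP; split; lra.
have C0 : 0 <= `|C| by [].
exists `|M|, delta, `|C|; split=> //; split.
- move=> i; have [_ _ [a b] c d] := HM i; have MM := ler_norm M.
  by split; apply: le_trans MM.
- move=> i t th tt /=; have e0 : 0 < expR t + lam i * expR (- t).
    by rewrite addr_gt0// ?mulr_gt0// expR_gt0.
  apply: le_trans (H1 i t th tt) _; rewrite powR_3half// ler_wpM2r ?ler_norm//.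
  by rewrite mulr_ge0 ?sqrtr_ge0// ltW.
- move=> i; apply: le_trans (H2 i) _; rewrite powR_5quarter// ler_wpM2r ?ler_norm//.
  by rewrite mulr_ge0 ?sqrtr_ge0// ltW.
Qed.

Section Estimates.
Variables (lam : nat -> R) (u : nat -> R * R -> 'rV[R]_p) (ps qs As bs cs ds : nat -> 'rV[R]_p).
Variables (M delta C : R).
Hypothesis M0 : 0 <= M.
Hypothesis d0 : 0 < delta.
Hypothesis C0 : 0 <= C.
Hypothesis lam0 : forall i, 0 < lam i.
Hypothesis lamc : lam @ \oo --> (0 : R).
Hypothesis NE : neck_estimate lam u ps qs As bs cs ds M delta C.

Lemma s_gt0 i : 0 < Num.sqrt (lam i). Proof. by rewrite sqrtr_gt0. Qed.

(** The quadratic identity bounds the Euclidean norm of qs i by a multiple of lam i. *)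
Lemma q_bound : exists2 K, 0 <= K & forall i, `|qs i| <= K * Num.sqrt (lam i).
Proof.
have [Hb _ Hq] := NE.
have [L L0 HL] : exists2 L, 0 <= L & forall i, lam i <= L.
  have [L [_ HL]] : bounded_fun lam.
    by apply: cvg_seq_bounded; apply/cvg_ex; exists 0.
  exists (`|L| + 1); first by rewrite addr_ge0.
  move=> i; apply: le_trans (ler_norm _) _; apply: (HL (`|L| + 1)) => //.
  by apply: le_lt_trans (ler_norm L) _; rewrite ltrDl.
(* The two dot products are at most p M^2, and lam i is at most L. *)
pose K2 := 2 * (p%:R * (M * M) + p%:R * (M * M)) + C * Num.sqrt (Num.sqrt L).
have K20 : 0 <= K2 by rewrite addr_ge0 ?mulr_ge0 ?addr_ge0 ?mulr_ge0 ?sqrtr_ge0.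
exists (Num.sqrt K2); first exact: sqrtr_ge0.
move=> i; apply: rV_norm_le; first by rewrite mulr_ge0 ?sqrtr_ge0.
move=> j; rewrite -sqrtrM// -sqrtr_sqr ler_wsqrtr//.
apply: le_trans (dotp_coord (qs i) j) _.
have [ha hb hc hd] := Hb i.
have h1 := dotp_le ha hc; have h2 := dotp_le hb hd.
set Q := dotp (qs i) (qs i); set S := dotp (As i) (cs i) + dotp (bs i) (ds i).
have hS : `|S| <= p%:R * (M * M) + p%:R * (M * M).
  by apply: le_trans (ler_normD _ _) _; exact: lerD.
have hQ : Q <= 2 * lam i * S + C * (lam i * Num.sqrt (Num.sqrt (lam i))).
  have := Hq i; rewrite -/Q -/S => h; have := ler_norm (Q - 2 * lam i * S).
  by move=> h'; rewrite -lerBlDl; exact: le_trans h.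
apply: le_trans hQ _; rewrite [leRHS]mulrDl; apply: lerD.
  rewrite -!mulrA ler_pM2l// mulrC ler_wpM2r ?(ltW (lam0 i))//.
  exact: le_trans (ler_norm _) hS.
rewrite -mulrA ler_wpM2l// mulrC ler_wpM2r ?(ltW (lam0 i))//.
by do 2 apply: ler_wsqrtr; exact: HL.
Qed.

Lemma near_K_sqrt (K e : R) : 0 <= K -> 0 < e -> \forall i \near \oo, K * Num.sqrt (lam i) <= e.
Proof.
move=> K0 e0; have K1 : 0 < K + 1 by rewrite ltr_wpDl.
have /cvgrPdist_le/(_ _ (divr_gt0 e0 K1)) := sqrt_cvg0 lamc; apply: filterS => i.
rewrite sub0r normrN ger0_norm ?sqrtr_ge0// ler_pdivlMr// => h; apply: le_trans h.
by rewrite mulrC ler_wpM2l ?sqrtr_ge0// lerDl.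
Qed.

Lemma near_K_sqrt2 (K e : R) : 0 <= K -> 0 < e ->
  \forall i \near \oo, K * Num.sqrt (Num.sqrt (lam i)) <= e.
Proof.
move=> K0 e0; have K1 : 0 < K + 1 by rewrite ltr_wpDl.
have /cvgrPdist_le/(_ _ (divr_gt0 e0 K1)) := sqrt_cvg0 (sqrt_cvg0 lamc); apply: filterS => i.
rewrite sub0r normrN ger0_norm ?sqrtr_ge0// ler_pdivlMr// => h; apply: le_trans h.
by rewrite mulrC ler_wpM2l ?sqrtr_ge0// lerDl.
Qed.

Lemma rotation_bound (a b : 'rV[R]_p) th : `|a| <= M -> `|b| <= M ->
  `|cos th *: a + sin th *: b| <= 2 * M.
Proof.
move=> ha hb; have [hc hs] := cos_sin_le1 th.
apply: le_trans (ler_normD _ _) _; rewrite !normrZ mulr_natl mulr2n; apply: lerD.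
  by rewrite -[leRHS]mul1r ler_pM.
by rewrite -[leRHS]mul1r ler_pM.
Qed.

Lemma outer_limits (uinf : R * R -> 'rV[R]_p) pinf ainf binf :
  (forall x, eball 1 x -> x != 0 -> (fun i => u i x) @ \oo --> uinf x) ->
  taylor1_at0 uinf pinf ainf binf ->
  [/\ As @ \oo --> ainf, bs @ \oo --> binf &
    forall e, 0 < e -> exists t, \forall i \near \oo, `|ps i + t *: qs i - pinf| <= e].
Proof.
move=> uc TT; have [Hb Hn _] := NE.
have M2 : 0 <= 2 * M by rewrite mulr_ge0.
apply: (@coefficient_limits R p uinf pinf ainf binf lam delta C (2 * M)
  (fun i t th => u i (cyl (t, th))) (fun i t => ps i + t *: qs i) As bs
  (fun i th => cos th *: cs i + sin th *: ds i)) => //.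
- by move=> i th; have [_ _ hc hd] := Hb i; exact: rotation_bound.
- move=> t th _ t0; apply: uc.
    by rewrite /eball/= enorm2_cyl/= -expR0 ltr_expR.
  apply/eqP => E; have := enorm2_cyl (t, th); rewrite E/= /enorm2/= expr0n/= addr0 sqrtr0.
  by move/esym/eqP; rewrite gt_eqF// expR_gt0.
- move=> i t th tt; apply: le_trans (Hn i t th tt); rewrite le_eqVlt; apply/orP; left; apply/eqP.
  by congr (`|_|); apply/rowP => j; rewrite /neck_approx !mxE; ring.
Qed.

(** At the distance lam i exp (- t) the expansion has the same form as at the
distance exp t, with the two ends of the neck exchanged. *)
Lemma inner_limits (omega omegat : R * R -> 'rV[R]_p) pinf cinf dinf :
  (forall y, (fun i => u i (lam i *: y)) @ \oo --> omega y) ->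
  (forall y, y != 0 -> omegat y = omega (inversion y)) ->
  taylor1_at0 omegat pinf cinf dinf ->
  cs @ \oo --> cinf /\ ds @ \oo --> dinf.
Proof.
move=> uc oE TT; have [Hb Hn _] := NE.
have M2 : 0 <= 2 * M by rewrite mulr_ge0.
have lE i t : expR (ln (lam i) - t) = lam i * expR (- t) by rewrite expRD lnK ?posrE.
suff [] : [/\ cs @ \oo --> cinf, ds @ \oo --> dinf &
    forall e, 0 < e -> exists t, \forall i \near \oo, `|ps i + (ln (lam i) - t) *: qs i - pinf| <= e].
  by [].
apply: (@coefficient_limits R p omegat pinf cinf dinf lam delta C (2 * M)
  (fun i t th => u i (cyl (ln (lam i) - t, th))) (fun i t => ps i + (ln (lam i) - t) *: qs i) cs ds
  (fun i th => cos th *: As i + sin th *: bs i)) => //.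
- by move=> i th; have [ha hb _ _] := Hb i; exact: rotation_bound.
- move=> t th _ t0.
  have e0 : expR t != 0 by rewrite gt_eqF// expR_gt0.
  have -> : omegat (cyl (t, th)) = omega (cyl (- t, th)).
    rewrite oE; last first.
      apply/eqP => E; have := enorm2_cyl (t, th); rewrite E/= /enorm2/= expr0n/= addr0 sqrtr0.
      by move/esym/eqP; rewrite gt_eqF// expR_gt0.
    congr omega; rewrite /inversion enorm2_cyl/= /cyl/= expRN; congr (_, _); by field.
  have -> : (fun i => u i (cyl (ln (lam i) - t, th))) = (fun i => u i (lam i *: cyl (- t, th))).
    apply/funext => i; congr (u i _); rewrite [RHS]surjective_pairing/= /cyl/= lE.
    by rewrite -!mulrA.
  exact: uc.
- move=> i t th /andP[t1 t2].
  have := Hn i (ln (lam i) - t) th; rewrite !ln_div ?posrE// in t1 *.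
  have -> : ln (lam i) - ln delta <= ln (lam i) - t <= ln delta.
    by apply/andP; split; lra.
  move=> /(_ isT) /= h.
  have E2 : lam i * expR (- (ln (lam i) - t)) = expR t.
    by rewrite expRN lE invfM expRN invrK mulrA mulfV ?mul1r// gt_eqF.
  have eE : expR (ln (lam i) - t) + lam i * expR (- (ln (lam i) - t)) = expR t + lam i * expR (- t).
    by rewrite E2 lE addrC.
  rewrite eE in h; apply: le_trans h; rewrite le_eqVlt; apply/orP; left; apply/eqP.
  congr (`|_|); rewrite /neck_approx E2 lE; apply/rowP => j; rewrite !mxE; ring.
Qed.

(** Along the neck the centre moves by multiples of qs i, and ln (lam i) grows more
slowly than any negative power of lam i. *)
Lemma base_point_limit (pinf : 'rV[R]_p) :
  (forall e, 0 < e -> exists t, \forall i \near \oo, `|ps i + t *: qs i - pinf| <= e) ->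
  (fun i => ps i + (2^-1 * ln (lam i)) *: qs i) @ \oo --> pinf.
Proof.
move=> H; have [K K0 HK] := q_bound.
apply/cvgrPdist_le => e e0; have e3 : 0 < e / 3 by rewrite divr_gt0.
have [t Ht] := H _ e3.
have tK : 0 <= `|t| * K by rewrite mulr_ge0.
have A1 := near_K_sqrt tK e3.
have K2 : 0 <= 2 * K by rewrite mulr_ge0.
have A2 := near_K_sqrt2 K2 e3.
have A3 := lam_eventually_le lam0 lamc (ltr01 : 0 < (1 : R)).
near=> i.
have h1 : `|ps i + t *: qs i - pinf| <= e / 3 by near: i.
have h2 : `|t| * K * Num.sqrt (lam i) <= e / 3 by near: i.
have h3 : 2 * K * Num.sqrt (Num.sqrt (lam i)) <= e / 3 by near: i.
have h4 : lam i <= 1 by near: i.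
have q1 : `|t *: qs i| <= e / 3.
  by apply: le_trans h2; rewrite normrZ -mulrA ler_wpM2l.
have q2 : `|(2^-1 * ln (lam i)) *: qs i| <= e / 3.
  apply: le_trans h3; rewrite normrZ normrM [`|2^-1|]ger0_norm ?invr_ge0//.
  have := sqrt_ln (lam0 i) h4; rewrite normrM (ger0_norm (sqrtr_ge0 _)) => h5.
  apply: (@le_trans _ _ (2^-1 * `|ln (lam i)| * (K * Num.sqrt (lam i)))).
    by rewrite ler_wpM2l// mulr_ge0.
  have -> : 2^-1 * `|ln (lam i)| * (K * Num.sqrt (lam i)) =
    2^-1 * K * (Num.sqrt (lam i) * `|ln (lam i)|) by ring.
  have -> : 2 * K * Num.sqrt (Num.sqrt (lam i)) = 2^-1 * K * (4 * Num.sqrt (Num.sqrt (lam i))).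
    by field.
  by rewrite ler_wpM2l// mulr_ge0.
have -> : pinf - (ps i + (2^-1 * ln (lam i)) *: qs i) =
   - (ps i + t *: qs i - pinf) + t *: qs i - (2^-1 * ln (lam i)) *: qs i.
  by apply/rowP => j; rewrite !mxE; ring.
apply: le_trans (ler_normB _ _) _; have -> : e = e / 3 + e / 3 + e / 3 by field.
apply: lerD => //; apply: le_trans (ler_normD _ _) _; apply: lerD => //.
by rewrite normrN.
Unshelve. all: by end_near.
Qed.

Lemma q_limit_norm (qinf ainf binf cinf dinf : 'rV[R]_p) :
  (fun i => (Num.sqrt (lam i))^-1 *: qs i) @ \oo --> qinf ->
  As @ \oo --> ainf -> bs @ \oo --> binf -> cs @ \oo --> cinf -> ds @ \oo --> dinf ->
  dotp qinf qinf = 2 * (dotp ainf cinf + dotp binf dinf).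
Proof.
move=> cq ca cb cc cd; have [_ _ Hq] := NE.
have l1 := dotp_cvg cq cq.
have l2 : (fun i => dotp (As i) (cs i) + dotp (bs i) (ds i)) @ \oo --> dotp ainf cinf + dotp binf dinf.
  by apply: cvgD; exact: dotp_cvg.
have l3 : (fun i => 2 * (dotp (As i) (cs i) + dotp (bs i) (ds i))) @ \oo -->
    2 * (dotp ainf cinf + dotp binf dinf) by apply: cvgM l2; exact: cvg_cst.
have l4 : (fun i => dotp ((Num.sqrt (lam i))^-1 *: qs i) ((Num.sqrt (lam i))^-1 *: qs i)
    - 2 * (dotp (As i) (cs i) + dotp (bs i) (ds i))) @ \oo -->
    dotp qinf qinf - 2 * (dotp ainf cinf + dotp binf dinf) by exact: cvgB l1 l3.
apply/eqP; rewrite -subr_eq0; apply/eqP.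
apply: (cvg_unique _ l4) => //.
apply/cvgrPdist_le => e e0; apply: filterS (near_K_sqrt2 C0 e0) => i h.
rewrite sub0r normrN; apply: le_trans h.
have s0 := s_gt0 i; have ss : Num.sqrt (lam i) ^+ 2 = lam i by rewrite sqr_sqrtr ?ltW.
have E : dotp ((Num.sqrt (lam i))^-1 *: qs i) ((Num.sqrt (lam i))^-1 *: qs i) =
    (lam i)^-1 * dotp (qs i) (qs i).
  rewrite /dotp mulr_sumr; apply: eq_bigr => j _; rewrite !mxE.
  by move: (Num.sqrt (lam i)) s0 ss => t t0 <-; field; rewrite gt_eqF.
have -> : dotp ((Num.sqrt (lam i))^-1 *: qs i) ((Num.sqrt (lam i))^-1 *: qs i)
   - 2 * (dotp (As i) (cs i) + dotp (bs i) (ds i)) =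
   (lam i)^-1 * (dotp (qs i) (qs i) - 2 * lam i * (dotp (As i) (cs i) + dotp (bs i) (ds i))).
  by rewrite E; field; rewrite gt_eqF.
rewrite normrM gtr0_norm ?invr_gt0// mulrC ler_pdivrMr//.
by apply: le_trans (Hq i) _; rewrite -mulrA (mulrC (lam i)).
Qed.

Lemma expR_half_ln i : expR (2^-1 * ln (lam i)) = Num.sqrt (lam i).
Proof. by rewrite -powR12_sqrt ?ltW// /powR gt_eqF. Qed.

Lemma expR_le_square (r : R) x : `|x| < r -> expR x <= expR r /\ expR (- x) <= expR r.
Proof. by move=> /ltr_normlP[h1 h2]; rewrite !ler_expR; split; lra. Qed.

(** In the variable z.1 = t - ln (lam i) / 2 both exp t and lam i exp (- t) are of
order sqrt (lam i), so that the error of order 3/2 still tends to 0 after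
division by sqrt (lam i). *)
Lemma neck_remainder (r e : R) : 0 < e -> \forall i \near \oo, forall z : R * R, `|z| < r ->
  `|rescaled_neck lam u ps qs i z
    - neck_limit ((Num.sqrt (lam i))^-1 *: qs i) (As i) (bs i) (cs i) (ds i) z| <= e.
Proof.
move=> e0; have [_ Hn _] := NE.
pose g := 2 * expR r; have g0 : 0 < g by rewrite mulr_gt0// expR_gt0.
have K0 : 0 <= C * (g * Num.sqrt g) := mulr_ge0 C0 (mulr_ge0 (ltW g0) (sqrtr_ge0 _)).
have dr : 0 < delta * expR (- r) by rewrite mulr_gt0// expR_gt0.
have A1 := near_K_sqrt2 K0 e0; have A2 := near_K_sqrt (ler01 : 0 <= (1 : R)) dr.
near=> i; move=> [z1 z2] zr.
have a1 : C * (g * Num.sqrt g) * Num.sqrt (Num.sqrt (lam i)) <= e by near: i.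
have a2 : 1 * Num.sqrt (lam i) <= delta * expR (- r) by near: i.
have s0 := s_gt0 i; have ss : Num.sqrt (lam i) ^+ 2 = lam i by rewrite sqr_sqrtr ?ltW.
have zr1 : `|z1| < r.
  by apply: le_lt_trans zr; rewrite prod_normE/= le_max lexx.
have [x1 x2] := expR_le_square zr1.
(* The square of radius r is mapped into the neck. *)
have lnS : 2^-1 * ln (lam i) <= ln delta - r.
  rewrite -ler_expR expR_half_ln expRD lnK ?posrE//; rewrite mul1r in a2.
  exact: a2.
have := Hn i (z1 + 2^-1 * ln (lam i)) z2.
have /ltr_normlP[zl zu] := zr1.
have -> : ln (lam i / delta) <= z1 + 2^-1 * ln (lam i) <= ln delta.
  rewrite ln_div ?posrE//; apply/andP; split; lra.
move=> /(_ isT) /=.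
have E1 : expR (z1 + 2^-1 * ln (lam i)) = Num.sqrt (lam i) * expR z1.
  by rewrite expRD expR_half_ln mulrC.
have E2 : lam i * expR (- (z1 + 2^-1 * ln (lam i))) = Num.sqrt (lam i) * expR (- z1).
  rewrite opprD expRD [expR (- (2^-1 * _))]expRN expR_half_ln -{1}ss; field; exact: lt0r_neq0.
rewrite E1 E2 -mulrDr => h.
have -> : rescaled_neck lam u ps qs i (z1, z2) -
   neck_limit ((Num.sqrt (lam i))^-1 *: qs i) (As i) (bs i) (cs i) (ds i) (z1, z2) =
   (Num.sqrt (lam i))^-1 *: (u i (cyl (z1 + 2^-1 * ln (lam i), z2)) -
    neck_approx (lam i) (ps i) (qs i) (As i) (bs i) (cs i) (ds i) (z1 + 2^-1 * ln (lam i)) z2).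
  rewrite /rescaled_neck /neck_limit /neck_approx E1 E2 /=.
  apply/rowP => j; rewrite !mxE; field; exact: lt0r_neq0.
rewrite normrZ gtr0_norm ?invr_gt0// mulrC ler_pdivrMr//; apply: le_trans h _.
have h0 : 0 < expR z1 + expR (- z1) by rewrite addr_gt0 ?expR_gt0.
have hg : expR z1 + expR (- z1) <= g by rewrite /g mulr_natl mulr2n; exact: lerD.
rewrite sqrtrM; last exact: ltW.
move: (expR z1 + expR (- z1)) h0 hg => y y0 yg.
apply: (@le_trans _ _ (C * (g * Num.sqrt g) * Num.sqrt (Num.sqrt (lam i)) * Num.sqrt (lam i))); last first.
  by rewrite ler_pM2r.
have -> : C * (Num.sqrt (lam i) * y * (Num.sqrt (Num.sqrt (lam i)) * Num.sqrt y)) =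
   C * (y * Num.sqrt y) * Num.sqrt (Num.sqrt (lam i)) * Num.sqrt (lam i) by ring.
rewrite ler_pM2r// ler_wpM2r ?sqrtr_ge0// ler_wpM2l//.
by apply: ler_pM => //; [exact: ltW|exact: ler_wsqrtr].
Unshelve. all: by end_near.
Qed.

Lemma neck_limit_lip (r e : R) (q a b c d q' a' b' c' d' : 'rV[R]_p) z : 0 <= e -> `|z| < r ->
  `|q - q'| <= e -> `|a - a'| <= e -> `|b - b'| <= e -> `|c - c'| <= e -> `|d - d'| <= e ->
  `|neck_limit q a b c d z - neck_limit q' a' b' c' d' z| <= (r + 4 * expR r) * e.
Proof.
case: z => z1 z2 e0 zr hq ha hb hc hd.
have zr1 : `|z1| < r.
  by apply: le_lt_trans zr; rewrite prod_normE/= le_max lexx.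
have [x1 x2] := expR_le_square zr1; have [c1 s1] := cos_sin_le1 z2.
have -> : neck_limit q a b c d (z1, z2) - neck_limit q' a' b' c' d' (z1, z2) =
  z1 *: (q - q') + (expR z1 * cos z2) *: (a - a') + (expR z1 * sin z2) *: (b - b')
  + (expR (- z1) * cos z2) *: (c - c') + (expR (- z1) * sin z2) *: (d - d').
  by apply/rowP => j; rewrite /neck_limit/= !mxE; ring.
have B x y (v : 'rV[R]_p) : 0 < x -> x <= expR r -> `|y| <= 1 -> `|v| <= e ->
    `|(x * y) *: v| <= expR r * e.
  move=> x0 xr y1 ve; rewrite normrZ normrM (gtr0_norm x0).
  apply: ler_pM => //; first by rewrite mulr_ge0// ltW.
  by rewrite -[leRHS]mulr1; apply: ler_pM => //; exact: ltW.
have -> : (r + 4 * expR r) * e = r * e + expR r * e + expR r * e + expR r * e + expR r * e by ring.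
do 4 (apply: le_trans (ler_normD _ _) _; apply: lerD; last by apply: B; rewrite ?expR_gt0).
by rewrite normrZ; apply: ler_pM => //; exact: ltW.
Qed.

Lemma neck_uniform_cvg (qinf ainf binf cinf dinf : 'rV[R]_p) :
  (fun i => (Num.sqrt (lam i))^-1 *: qs i) @ \oo --> qinf ->
  As @ \oo --> ainf -> bs @ \oo --> binf -> cs @ \oo --> cinf -> ds @ \oo --> dinf ->
  forall r e : R, 0 < e -> \forall i \near \oo, forall z : R * R, `|z| < r ->
  `|rescaled_neck lam u ps qs i z - neck_limit qinf ainf binf cinf dinf z| <= e.
Proof.
move=> cq ca cb cc cd r e e0; have e2 : 0 < e / 2 by rewrite divr_gt0.
have A1 := neck_remainder r e2.
have K0 : 0 < `|r| + 4 * expR r by rewrite ltr_wpDl// mulr_gt0// expR_gt0.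
have k0 : 0 < e / 2 / (`|r| + 4 * expR r) by rewrite divr_gt0.
have ev (x : nat -> 'rV[R]_p) (l : 'rV[R]_p) : x @ \oo --> l ->
    \forall i \near \oo, `|x i - l| <= e / 2 / (`|r| + 4 * expR r).
  by move=> /cvgrPdist_le/(_ _ k0); apply: filterS => i; rewrite distrC.
have B1 := ev _ _ cq; have B2 := ev _ _ ca; have B3 := ev _ _ cb.
have B4 := ev _ _ cc; have B5 := ev _ _ cd.
near=> i; move=> z zr.
have h1 : forall z : R * R, `|z| < r ->
  `|rescaled_neck lam u ps qs i z
    - neck_limit ((Num.sqrt (lam i))^-1 *: qs i) (As i) (bs i) (cs i) (ds i) z| <= e / 2 by near: i.
have b1 : `|(Num.sqrt (lam i))^-1 *: qs i - qinf| <= e / 2 / (`|r| + 4 * expR r) by near: i.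
have b2 : `|As i - ainf| <= e / 2 / (`|r| + 4 * expR r) by near: i.
have b3 : `|bs i - binf| <= e / 2 / (`|r| + 4 * expR r) by near: i.
have b4 : `|cs i - cinf| <= e / 2 / (`|r| + 4 * expR r) by near: i.
have b5 : `|ds i - dinf| <= e / 2 / (`|r| + 4 * expR r) by near: i.
have L := neck_limit_lip (ltW k0) zr b1 b2 b3 b4 b5.
have rr : `|r| = r by rewrite ger0_norm//; apply: le_trans (ltW zr).
have LE : (r + 4 * expR r) * (e / 2 / (`|r| + 4 * expR r)) = e / 2.
  by rewrite -{1}rr mulrC divfK// gt_eqF.
rewrite LE in L.
have := lerD (h1 z zr) L; rewrite -splitr; apply: le_trans.
by apply: le_trans (ler_normD _ _); rewrite addrA subrK.
Unshelve. all: by end_near.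
Qed.

End Estimates.
End Neck.

(** * Smooth convergence of the rescaled necks *)

Section Limit.
Variables (R : realType) (p : nat).

Lemma smooth_neck_limit (q a b c d : 'rV[R]_p) : smooth_on setT (neck_limit q a b c d).
Proof.
have F := frame_pair (frame_R R) (frame_R R).
apply/(smooth_rV _ openT) => j.
have s1 : smooth_on [set: R * R] (fun z => expR z.1).
  exact: (@smooth_comp_R R _ setT (@expR R) fst F openT (@smooth_expR R) (@smooth_fst R)).
have sN : smooth_on [set: R * R] (fun z => - z.1) by exact: smoothN openT (@smooth_fst R).
have s2 : smooth_on [set: R * R] (fun z => expR (- z.1)).
  exact: (@smooth_comp_R R _ setT (@expR R) (fun z => - z.1) F openT (@smooth_expR R) sN).
have [sc ss] := smooth_trig R.
have s3 : smooth_on [set: R * R] (fun z => cos z.2).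
  exact: (@smooth_comp_R R _ setT (@cos R) snd F openT sc (@smooth_snd R)).
have s4 : smooth_on [set: R * R] (fun z => sin z.2).
  exact: (@smooth_comp_R R _ setT (@sin R) snd F openT ss (@smooth_snd R)).
have sM (f : R * R -> R) (k : R) : smooth_on setT f -> smooth_on setT (fun z => f z * k).
  by move=> sf; apply: (@smoothM R _ setT f (fun=> k) openT sf); exact: smooth_cst.
have sA (f g : R * R -> R) : smooth_on setT f -> smooth_on setT g -> smooth_on setT (fun z => f z + g z).
  exact: (@smoothD R _ R setT f g openT).
have := sA _ _ (sA _ _ (sA _ _ (sA _ _ (sM _ (q 0 j) (@smooth_fst R)) (sM _ (a 0 j) (smoothM openT s1 s3)))
  (sM _ (b 0 j) (smoothM openT s1 s4))) (sM _ (c 0 j) (smoothM openT s2 s3)))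
  (sM _ (d 0 j) (smoothM openT s2 s4)).
apply: smooth_eq; first exact: openT.
by move=> z _; rewrite /neck_limit !mxE.
Qed.

Lemma iterD_sub (U : set (R * R)) (f g : R * R -> R) vs x : open U ->
  smooth_on U f -> smooth_on U g -> U x ->
  Defs.iterD vs (fun y => f y - g y) x = Defs.iterD vs f x - Defs.iterD vs g x.
Proof.
move=> oU sf sg; elim: vs x => //= v vs IH x Ux.
have -> : 'D_v (Defs.iterD vs (fun y => f y - g y)) x =
    'D_v (fun y => Defs.iterD vs f y - Defs.iterD vs g y) x.
  exact: (iterD_eq [:: v] oU IH Ux).
have [_ df] := sf vs x Ux; have [_ dg] := sg vs x Ux.
exact: deriveB (df v) (dg v).
Qed.

Lemma loc_bounded_smooth (f : R * R -> R) : smooth_on setT f -> loc_bounded (fun=> f).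
Proof.
move=> sf r; have [C _ HC] := bounded_on_compact (@compact_square R 0 r)
  (fun x _ => smooth_cont sf (I : setT x)).
by exists C; apply: nearW => _ x xr; apply: HC; rewrite /square/= subr0 ltW.
Qed.

End Limit.

Section Core.
Variables (R : realType) (n p : nat) (N : set 'rV[R]_p).
Variables (lam : nat -> R) (u : nat -> R * R -> 'rV[R]_p) (ps qs : nat -> 'rV[R]_p).
Variables (pinf q a b c d : 'rV[R]_p).
Hypothesis hN : closed_submanifold n N.
Hypothesis hu : forall i, harmonic_map (eball 1) N (u i).
Hypothesis lam0 : forall i, 0 < lam i.
Hypothesis lamc : lam @ \oo --> (0 : R).
Hypothesis Npinf : N pinf.
Hypothesis Pc : (fun i => ps i + (2^-1 * ln (lam i)) *: qs i) @ \oo --> pinf.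
Hypothesis C0c : forall r e : R, 0 < e -> \forall i \near \oo, forall z : R * R, `|z| < r ->
  `|rescaled_neck lam u ps qs i z - neck_limit q a b c d z| <= e.

Notation V := (rescaled_neck lam u ps qs).
Notation L := (neck_limit q a b c d).
Notation P := (fun i => ps i + (2^-1 * ln (lam i)) *: qs i).
Notation eps := (fun i => Num.sqrt (lam i)).

Lemma rescaled_neckE i z : P i + eps i *: V i z = u i (cyls (2^-1 * ln (lam i)) z).
Proof.
rewrite /rescaled_neck scalerA mulfV ?gt_eqF ?sqrtr_gt0// scale1r addrC subrK.
by [].
Qed.

(** In the shifted cylinder coordinates the unit disc becomes a half plane that
exhausts the plane. *)
Lemma rescaled_domain (r : R) : \forall i \near \oo, forall z : R * R, open_square r z ->
  z.1 + 2^-1 * ln (lam i) < 0.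
Proof.
have e0 : 0 < expR (- r) by exact: expR_gt0.
have := near_K_sqrt lamc (ler01 : 0 <= (1 : R)) e0; apply: filterS => i.
rewrite mul1r -expR_half_ln// ler_expR => h z zr.
have : z.1 < r.
  apply: le_lt_trans zr; apply: le_trans (ler_norm _) _.
  by rewrite prod_normE/= le_max lexx.
lra.
Qed.

Lemma rescaled_ev_smooth l : ev_smooth (fun i x => V i x 0 l).
Proof.
move=> r; apply: filterS (rescaled_domain r) => i Hi.
have s0 : 0 < Num.sqrt (lam i) by rewrite sqrtr_gt0.
have sV := rescaled_smooth (hu i) s0 (rescaled_neckE i) (@open_open_square R r) Hi.
by have [h _] := smooth_rV (V i) (@open_open_square R r); exact: (h sV l).
Qed.

Lemma L_co l : smooth_on setT (fun z => L z 0 l).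
Proof. by have [h _] := smooth_rV L openT; exact: (h (@smooth_neck_limit R p q a b c d) l). Qed.

Lemma rescaled_loc_bounded l : loc_bounded (fun i x => V i x 0 l).
Proof.
move=> r; have [C HC] := loc_bounded_smooth (L_co l) r.
exists (1 + C); apply: filterS2 HC (C0c r ltr01) => i h1 h2 x xr.
have -> : V i x 0 l = (V i x - L x) 0 l + L x 0 l by rewrite !mxE subrK.
apply: le_trans (ler_normD _ _) _; apply: lerD; last exact: h1.
exact: le_trans (mx_coord_le _ _ _) (h2 x xr).
Qed.

Lemma rescaled_derivatives_bounded l vs : loc_bounded (fun i => Defs.iterD vs (fun x => V i x 0 l)).
Proof.
have [_ _ /(_ _ Npinf)[U [W [Phi [Psi [[oU Upinf] oW [sPhi sPsi] [PhiK PsiK] sl]]]]]] := hN.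
have epc := sqrt_cvg0 lamc.
have ep0 i : 0 <= eps i by exact: sqrtr_ge0.
have epp i : 0 < eps i by rewrite sqrtr_gt0.
have /nbhs_ballP[k /= k0 Hk] : nbhs pinf U by exact: open_nbhs_nbhs.
apply: (@all_derivatives_bounded R p U pinf V P eps (second_ff n Phi Psi) oU Upinf
  (fun l j m => @smooth_second_ff R n p U W Phi Psi oU oW sPhi sPsi PhiK l j m)
  rescaled_ev_smooth rescaled_loc_bounded ep0 epc Pc) => r.
have UC := U_cvg rescaled_loc_bounded ep0 epc Pc r k0.
apply: filterS2 (rescaled_domain r) UC => i Hd HU x xr l'.
have BU z : open_square r z -> U (P i + eps i *: V i z).
  by move=> zr; apply: Hk; rewrite -ball_normE/= distrC; exact: HU.
exact: (rescaled_normal_form oU oW sPhi sPsi PhiK PsiK sl (hu i) (epp i) (rescaled_neckE i)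
  l' (@open_open_square R r) Hd BU xr).
Qed.

Theorem rescaled_cvg_smooth : cvg_smooth setT V L.
Proof.
have ESd l : ev_smooth (fun i x => V i x 0 l - L x 0 l).
  move=> r; apply: filterS (rescaled_ev_smooth l r) => i sV.
  apply: (@smoothB R _ (open_square r) _ (fun x => L x 0 l) (@open_open_square R r) sV).
  by apply: smooth_sub (L_co l).
have eqD l vs r : \forall i \near \oo, forall x, open_square r x ->
    Defs.iterD vs (fun x => V i x 0 l - L x 0 l) x =
    Defs.iterD vs (fun x => V i x 0 l) x - Defs.iterD vs (fun x => L x 0 l) x.
  apply: filterS (rescaled_ev_smooth l r) => i sV x Bx.
  apply: (iterD_sub vs (@open_open_square R r) sV _ Bx).
  by apply: smooth_sub (L_co l).
have LBd l vs : loc_bounded (fun i => Defs.iterD vs (fun x => V i x 0 l - L x 0 l)).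
  move=> r; have [C1 H1] := rescaled_derivatives_bounded l vs r.
  have sLv : smooth_on setT (Defs.iterD vs (fun x => L x 0 l)).
    by elim: vs {H1} => [|v vs IH]; [exact: L_co|exact: smooth_D].
  have [C2 H2] := loc_bounded_smooth sLv r.
  exists (C1 + C2); apply: filterS3 H1 H2 (eqD l vs r) => i h1 h2 h3 x xr.
  rewrite h3//; apply: le_trans (ler_normB _ _) _; apply: lerD; [exact: h1|exact: h2].
have c0 l r e : 0 < e -> \forall i \near \oo, forall x, open_square r x -> `|V i x 0 l - L x 0 l| <= e.
  move=> e0; apply: filterS (C0c r e0) => i Hi x xr.
  have -> : V i x 0 l - L x 0 l = (V i x - L x) 0 l by rewrite !mxE.
  exact: le_trans (mx_coord_le _ _ _) (Hi x xr).
move=> vs K cK _ e e0.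
have [r Kr] : exists r, forall x, K x -> open_square r x.
  have [M [_ HM]] := compact_bounded cK; exists (`|M| + 2) => x Kx.
  apply: (@le_lt_trans _ _ (`|M| + 1)); last by rewrite ltrD2l ltr1n.
  by apply: (HM (`|M| + 1)) => //; apply: le_lt_trans (ler_norm M) _; rewrite ltrDl.
have e2 : 0 < e / 2 by rewrite divr_gt0.
have H1 : \forall i \near \oo, forall l, forall x, open_square r x ->
    `|Defs.iterD vs (fun x => V i x 0 l) x - Defs.iterD vs (fun x => L x 0 l) x| <= e / 2.
  apply: filter_forall => l.
  apply: filterS2 (eqD l vs r) (cvg_all_derivatives (ESd l) (LBd l) (c0 l) vs r e2) => i h1 h2 x xr.
  by rewrite -h1//; exact: h2.
have H2 : \forall i \near \oo, forall l, smooth_on (open_square r) (fun x => V i x 0 l).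
  by apply: filter_forall => l; exact: rescaled_ev_smooth.
apply: filterS2 H1 H2 => i h1 h2 x Kx _; have Bx := Kr x Kx.
have sV : smooth_on (open_square r) (V i) by apply/(smooth_rV _ (@open_open_square R r)).
apply: (@le_lt_trans _ _ (e / 2)); last by rewrite ltr_pdivrMr// ltr_pMr// ltr1n.
apply: rV_norm_le; first exact: ltW.
move=> j; rewrite !mxE (iterD_rV vs j (@open_open_square R r) sV Bx).
rewrite (iterD_rV vs j openT (@smooth_neck_limit R p q a b c d) (I : setT x)).
exact: h1.
Qed.

End Core.

Lemma cvg_smooth_pointwise (R : realType) p (D A : set (R * R)) (f : nat -> R * R -> 'rV[R]_p) g x :
  cvg_smooth_within D A f g -> D x -> A x -> (fun i => f i x) @ \oo --> g x.
Proof.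
move=> H Dx Ax; apply/cvgrPdist_lt => e e0.
have sA : [set x] `<=` A by move=> y ->.
have := H [::] [set x] (@compact_set1 _ x) sA e e0; apply: filterS => i h.
by rewrite distrC; exact: h.
Qed.

Theorem corollary1p3 (R : realType) (n p : nat) (N : set 'rV[R]_p)
    (u : nat -> R * R -> 'rV[R]_p) (uinf omega omegat : R * R -> 'rV[R]_p)
    (lam : nat -> R) (ps qs As bs cs ds : nat -> 'rV[R]_p)
    (pinf ainf binf cinf dinf : 'rV[R]_p)
    (hN : closed_submanifold n N)
    (hu : forall i, harmonic_map (eball 1) N (u i))
    (hE : exists M : R, forall i, (energy (eball 1) (u i) <= M%:E)%E)
    (huinf : harmonic_map (eball 1) N uinf)
    (hcvg : cvg_smooth_within (eball 1) (eclosed_ball 1 `\ 0) u uinf)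
    (hlam : forall i, 0 < lam i)
    (hlam0 : lam @ \oo --> (0 : R))
    (homega : harmonic_map setT N omega)
    (homegaE : (energy setT omega < +oo)%E)
    (homega_nc : nonconstant_on setT omega)
    (hbubble : cvg_smooth setT (fun i y => u i (lam i *: y)) omega)
    (honly : only_bubble lam u)
    (hneck : neck_expansion lam u ps qs As bs cs ds)
    (homegat : smooth_on setT omegat)
    (homegatE : forall y, y != 0 -> omegat y = omega (inversion y))
    (hpinf : pinf = uinf 0 /\ pinf = omegat 0)
    (hab : taylor1_at0 uinf pinf ainf binf)
    (hcd : taylor1_at0 omegat pinf cinf dinf) :
  forall phi : nat -> nat, {homo phi : i j / (i < j)%N} ->
  exists2 psi : nat -> nat, {homo psi : i j / (i < j)%N} &
  exists qinf : 'rV[R]_p,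
    cvg_smooth setT (fun k => rescaled_neck lam u ps qs (phi (psi k)))
      (neck_limit qinf ainf binf cinf dinf)
    /\ dotp qinf qinf = 2 * (dotp ainf cinf + dotp binf dinf).
Proof.
move=> phi hphi.
have [M [delta [C [M0 d0 C0 NE]]]] := neck_estimateE hlam hneck.
have uc x : eball 1 x -> x != 0 -> (fun i => u i x) @ \oo --> uinf x.
  move=> x1 x0; apply: cvg_smooth_pointwise hcvg _ _ => //; split.
    exact: ltW.
  by move=> /= x00; move: x0; rewrite x00 eqxx.
have bc y : (fun i => u i (lam i *: y)) @ \oo --> omega y.
  exact: (cvg_smooth_pointwise hbubble).
have [ca cb cp] := outer_limits M0 d0 C0 hlam hlam0 NE uc hab.
have [cc cd] := inner_limits M0 d0 C0 hlam hlam0 NE bc homegatE hcd.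
have cP := base_point_limit M0 C0 hlam hlam0 NE cp.
have [K K0 HK] := q_bound M0 C0 hlam hlam0 NE.
have qK i : `|(Num.sqrt (lam (phi i)))^-1 *: qs (phi i)| <= K.
  have s0 : 0 < Num.sqrt (lam (phi i)) by rewrite sqrtr_gt0.
  by rewrite normrZ gtr0_norm ?invr_gt0// mulrC ler_pdivrMr.
(* All other coefficients converge along the full sequence. *)
have [psi hpsi [qinf cq]] := bolzano_weierstrass_rV qK.
exists psi => //; exists qinf.
pose f k := phi (psi k).
have ff : f @ \oo --> \oo.
  by apply: increasing_subseq => i j ij; apply: hphi; exact: hpsi.
have sub (T : topologicalType) (x : nat -> T) (l : T) : x @ \oo --> l -> (fun k => x (f k)) @ \oo --> l.
  by move=> xl; exact: (cvg_comp f x ff xl).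
have NEf : neck_estimate (fun k => lam (f k)) (fun k => u (f k)) (fun k => ps (f k))
    (fun k => qs (f k)) (fun k => As (f k)) (fun k => bs (f k)) (fun k => cs (f k))
    (fun k => ds (f k)) M delta C.
  by have [h1 h2 h3] := NE; split=> *; [exact: h1|exact: h2|exact: h3].
have lf i : 0 < lam (f i) by [].
have lfc := sub _ _ _ hlam0.
have Npinf : N pinf.
  have [_ Nu _] := huinf; have [-> _] := hpinf; apply: Nu.
  by rewrite /eball/= /enorm2/= expr0n/= addr0 sqrtr0 ltr01.
split; last first.
  exact: (q_limit_norm C0 lf lfc NEf cq (sub _ _ _ ca) (sub _ _ _ cb) (sub _ _ _ cc) (sub _ _ _ cd)).
have C0c := neck_uniform_cvg d0 C0 lf lfc NEf cq (sub _ _ _ ca) (sub _ _ _ cb) (sub _ _ _ cc) (sub _ _ _ cd).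
exact: (rescaled_cvg_smooth hN (fun k => hu (f k)) lf lfc Npinf (sub _ _ _ cP) C0c).
Qed.
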